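(* Assume that $a(x)\equiv0$, that $f,B$ are Lipschitz continuous on the torus $\mathcal X$, and that there exists $\alpha\in L^\infty(\mathcal X;\mathbb R^m)$ with $a(x)=B(x)\alpha(x)$ for all $x$ (automatic here with $\alpha=0$). Let $D\ge0$ be a constant such that, for almost every $x\in\mathcal X$, $\sup_{w\in\mathcal H^m}\left\|\frac{\partial\Gamma(w,x)}{\partial w}\right\|_{\mathcal H^m}\le D$ (such a constant exists). Let $\gamma>0$, and consider the iterations $$w_0=0,\qquad w_k=w_{k-1}-\gamma\,\frac{\partial\Gamma}{\partial w}(w_{k-1},x^{(k)}),\qquad x^{(k)}\text{ i.i.d. uniform on }\mathcal X .$$ For $n\ge1$ let $\bar w_n=\frac1n\sum_{k=0}^{n-1}w_k$ and $G(w)=\mathbb E_{x\sim\mathcal U(\mathcal X)}[\Gamma(w,x)]$. Then $$\mathbb E[G(\bar w_n)]\le\inf_{w\in\mathcal H^m}\left\{G(w)+\frac{\|w\|_{\mathcal H^m}^2}{2\gamma n}\right\}+\frac{\gamma D^2}2 .$$ In particular, if $\mathcal H$ is dense in $H^1(\mathcal X)$ for the $H^1$-norm and, for each $n$, the step size is set to $\gamma=\gamma_0/\sqrt n$ for a constant $\gamma_0>0$, then $$\lim_{n\to+\infty}\mathbb E[G(\bar w_n)]=\inf_{w\in(H^1(\mathcal X))^m}G(w).$$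
   Context: Setting. $d,m\ge1$, $\rho>0$, $q\in(1,2]$; $\mathcal X=[0,1]^d$ is the $d$-dimensional torus (functions on $\mathcal X$ are 1-periodic in each coordinate); $f:\mathcal X\to\mathbb R_+$, $a:\mathcal X\to\mathbb R^d$, $B:\mathcal X\to\mathbb R^{d\times m}$. $\mu_0$ is a probability measure on $\mathcal X$ with full support and bounded density, also denoted $\mu_0$. $C_V$ is a constant with $C_V\ge\|f\|_\infty$. For $C\ge c\ge0$ and $(\alpha,\beta)\in\mathbb R_+\times\mathbb R$ define $$L_{c,C}(\alpha,\beta)=\inf_{\mu\ge0}\ c\mu+\frac{\alpha^q}q\mu^{1-q}+C[\beta-\mu]_+,\qquad [y]_+=\max(y,0),$$ (at $\mu=0$ the middle term is $0$ if $\alpha=0$ and $+\infty$ if $\alpha>0$). Define $$\Gamma(w,x)=L_{f(x),C_V}\Big(\|w(x)\|_2,\ \mu_0(x)-\tfrac1\rho\mathrm{div}(B(x)w(x))\Big),$$ where $\mathrm{div}(B(x)w(x))$ is the divergence in $x$ of $x\mapsto B(x)w(x)$ (defined at a.e. $x$). $\frac{\partial\Gamma}{\partial w}(w,x)$ denotes a subgradient in $\mathcal H^m$ of the convex function $\Gamma(\cdot,x)$ at $w$ . RKHS. $\mathcal H\subset L^2(\mathcal X)$ is a real reproducing kernel Hilbert space of functions on the torus, dense in $L^2(\mathcal X)$, with Mercer kernel $K\in C^2(\mathcal X\times\mathcal X)$. $\mathcal H^m$ has norm $\|w\|_{\mathcal H^m}^2=\sum_{i=1}^m\|w_i\|_{\mathcal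 H}^2$. $H^1(\mathcal X)=W^{1,2}(\mathcal X)$. *)

(* Defs.v *)
From HB Require Import structures.
From mathcomp Require Import all_boot all_order all_algebra finmap sesquilinear.
From mathcomp Require Import all_classical all_reals all_analysis.

Set Implicit Arguments.
Unset Strict Implicit.
Unset Printing Implicit Defensive.

Import Order.TTheory GRing.Theory Num.Theory.
Import numFieldNormedType.Exports.

Local Open Scope classical_set_scope.
Local Open Scope ring_scope.

(* Matrices carry the sigma-algebra generated by their entries; on 'rV[R]_d
   and 'cV[R]_m this is the Borel sigma-algebra. *)
Definition measure_matrix_display : measure_display -> measure_display.
Proof. exact. Qed.

Section measurable_matrix.
Context {d : measure_display} {T : measurableType d} (m n : nat).

Definition mx_entry_sets : set (set 'M[T]_(m, n)) :=
  [set A | exists i j (Y : set T),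
     measurable Y /\ A = (fun M : 'M[T]_(m, n) => M i j) @^-1` Y].

Let mx_set0 : <<s mx_entry_sets >> set0.
Proof. exact: sigma_algebra0. Qed.

Let mx_setC A : <<s mx_entry_sets >> A -> <<s mx_entry_sets >> (~` A).
Proof. exact: sigma_algebraC. Qed.

Let mx_bigcup (F : (set 'M[T]_(m, n))^nat) :
  (forall i, <<s mx_entry_sets >> (F i)) ->
  <<s mx_entry_sets >> (\bigcup_i (F i)).
Proof. exact: sigma_algebra_bigcup. Qed.

HB.instance Definition _ := @isMeasurable.Build (measure_matrix_display d)
  'M[T]_(m, n) <<s mx_entry_sets >> mx_set0 mx_setC mx_bigcup.

End measurable_matrix.

Section measurable_matrix_lemmas.
Context {d : measure_display} {T : measurableType d} {m n : nat}.

Lemma measurable_mx_entry (i : 'I_m) (j : 'I_n) :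
  measurable_fun [set: 'M[T]_(m, n)] (fun M : 'M[T]_(m, n) => M i j).
Proof.
move=> _ Y mY; rewrite setTI; apply: sub_sigma_algebra.
by exists i, j, Y.
Qed.

Lemma measurable_fun_mx d' (S : measurableType d') (g : S -> 'M[T]_(m, n)) :
  (forall i j, measurable_fun [set: S] (fun s => g s i j)) ->
  measurable_fun [set: S] g.
Proof.
move=> mg; apply: (@measurability _ _ _ _ setT g (mx_entry_sets (m:=m) (n:=n))).
  by [].
move=> _ [A [i [j [Y [mY ->]]]] <-].
exact: (mg i j measurableT Y mY).
Qed.

End measurable_matrix_lemmas.

(* The uniform law on [0,1]^d, i.e. Lebesgue measure restricted to the cube,
   as a probability on 'rV[R]_d. *)
Section uniform_cube.
Context {R : realType}.

Definition cons_rv (d : nat) (p : measurableTypeR R * 'rV[R]_d) : 'rV[R]_d.+1 :=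
  \row_j (if unlift ord0 j is Some k then p.2 0 k else p.1).

Lemma measurable_cons_rv (d : nat) : measurable_fun setT (@cons_rv d).
Proof.
apply: measurable_fun_mx => i j.
have [k jk|j0] := unliftP ord0 j.
  rewrite (_ : (fun _ => _) = (fun M : 'rV[R]_d => M 0 k) \o snd); last first.
    by apply/funext => p; rewrite mxE jk liftK.
  by apply: measurableT_comp => //; exact: measurable_mx_entry.
rewrite (_ : (fun _ => _) = fst) //.
by apply/funext => p; rewrite mxE j0 unlift_none.
Qed.

HB.instance Definition _ (d : nat) :=
  isMeasurableFun.Build _ _ _ _ (@cons_rv d) (@measurable_cons_rv d).

Fixpoint unif (d : nat) : probability 'rV[R]_d R :=
  if d is d'.+1 then
    distribution (uniform_prob (@ltr01 R) \x unif d')%E (@cons_rv d')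
  else \d_(0 : 'rV[R]_0).

Lemma unif_box (d : nat) (A : 'I_d -> set R) : (forall j, measurable (A j)) ->
  unif d [set x | forall j, A j (x 0 j)]
  = (\prod_(j < d) uniform_prob (@ltr01 R) (A j))%E.
Proof.
elim: d A => [|d IH] A mA.
  by rewrite big_ord0 /= diracE mem_set //=; case.
rewrite big_ord_recl -IH//= -product_measure1E//.
  rewrite /distribution /pushforward/=; congr (product_measure1 _ _ _).
  apply/seteqP; split => -[x y] /=.
    move=> h; split; first by have := h ord0; rewrite mxE unlift_none.
    by move=> j; have := h (lift ord0 j); rewrite mxE liftK.
  by move=> [h1 h2] j; rewrite mxE; case: unliftP => [k ->|->].
  exact: mA.
rewrite [X in measurable X](_ : _ = \bigcap_(j in [set: 'I_d])
    ((fun M : 'rV[R]_d => M 0 j) @^-1` A (lift ord0 j))); last first.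
  by apply/seteqP; split => x /= h j; [move=> _|]; exact: h.
apply: fin_bigcap_measurable => // j _; rewrite -[X in measurable X]setTI.
exact: (measurable_mx_entry (T := R)).
Qed.

End uniform_cube.

Definition unit_cube {R : realType} (d : nat) : set 'rV[R]_d :=
  [set x | forall j, 0 <= x 0 j <= 1].
Arguments unit_cube {R} d.

(* Functions on the torus are 1-periodic functions on R^d. *)
Definition torus_periodic {R : realType} (d : nat) {T : Type}
    (g : 'rV[R]_d -> T) : Prop :=
  forall j x, g (x + delta_mx 0 j) = g x.

Definition pderiv {R : realType} (d : nat) (j : 'I_d) (g : 'rV[R]_d -> R) :
    'rV[R]_d -> R :=
  fun x => 'D_(delta_mx 0 j) g x.

Fixpoint is_Ck {R : realType} (d k : nat) (g : 'rV[R]_d -> R) : Prop :=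
  continuous g /\
  if k is k'.+1 then
    forall j, (forall x, derivable g x (delta_mx 0 j)) /\ is_Ck k' (pderiv j g)
  else True.

Section sobolev.
Context {R : realType} {d : nat}.
Implicit Types (u g : 'rV[R]_d -> R) (v : 'rV[R]_d -> 'cV[R]_d).

Definition L2 u : Prop := u \in Lfun (unif d : probability 'rV[R]_d R) 2%:E.

(* Classical divergence; a junk value where some partial derivative does not
   exist. *)
Definition cdiv v : 'rV[R]_d -> R :=
  fun x => \sum_(j < d) pderiv j (fun y => v y j 0) x.

(* Weak derivatives on the torus: the test functions are periodic and C^1. *)
Definition is_wpartial (j : 'I_d) u g : Prop :=
  forall phi : 'rV[R]_d -> R, is_Ck 1 phi -> torus_periodic phi ->
    \int[unif d]_x (u x * pderiv j phi x) = - \int[unif d]_x (g x * phi x).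

Definition is_wdiv v g : Prop :=
  forall phi : 'rV[R]_d -> R, is_Ck 1 phi -> torus_periodic phi ->
    \int[unif d]_x (\sum_(j < d) v x j 0 * pderiv j phi x)
    = - \int[unif d]_x (g x * phi x).

(* The weak partial derivative and the weak divergence in L^2 when they exist
   (they are unique up to a.e. equality), 0 otherwise. *)
Definition wpartial (j : 'I_d) u : 'rV[R]_d -> R :=
  xget (cst 0) [set g | L2 g /\ is_wpartial j u g].

Definition wdiv v : 'rV[R]_d -> R :=
  xget (cst 0) [set g | L2 g /\ is_wdiv v g].

Definition H1 u : Prop :=
  L2 u /\ forall j, exists g, L2 g /\ is_wpartial j u g.

Definition L2norm u : \bar R :=
  'N[unif d : probability 'rV[R]_d R]_2%:E[EFin \o u].

Definition H1norm u : \bar R :=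
  ((L2norm u `^ 2 + \sum_(j < d) L2norm (wpartial j u) `^ 2) `^ 2^-1)%E.

End sobolev.

Section value.
Context {R : realType}.
Implicit Types (q c C alpha beta mu : R).
Local Open Scope ereal_scope.

(* The case mu = 0 is separate because 0 `^ (1 - q) = 0 in the library. *)
Definition Lobj q c C alpha beta mu : \bar R :=
  (c * mu)%:E
  + (if mu == 0%R then (if alpha == 0%R then 0 else +oo)
     else (alpha `^ q / q * mu `^ (1 - q))%:E)
  + (C * Num.max (beta - mu) 0)%:E.

Definition Lval q c C alpha beta : \bar R :=
  ereal_inf [set Lobj q c C alpha beta mu | mu in [set mu : R | (0 <= mu)%R]].

Definition norm2 (m : nat) (y : 'cV[R]_m) : R :=
  Num.sqrt (\sum_(i < m) y i 0 ^+ 2)%R.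

End value.

Section objective.
Context {R : realType} {d m : nat}.
Variables (q rho C_V : R) (f : 'rV[R]_d -> R) (B : 'rV[R]_d -> 'M[R]_(d, m)).
Variable mu0 : 'rV[R]_d -> R.
(* dv is the divergence operator: cdiv for w in H^m, wdiv for w in (H^1)^m;
   they agree almost everywhere on H^m. *)
Variable dv : ('rV[R]_d -> 'cV[R]_d) -> 'rV[R]_d -> R.

Definition Gamma (w : 'rV[R]_d -> 'cV[R]_m) (x : 'rV[R]_d) : \bar R :=
  Lval q (f x) C_V (norm2 (w x))
    (mu0 x - rho^-1 * dv (fun y => B y *m w y) x).

Definition Gfun (w : 'rV[R]_d -> 'cV[R]_m) : \bar R :=
  (\int[unif d]_x Gamma w x)%E.

End objective.

(* A real RKHS of functions on the torus, as an abstract Hilbert space H with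
   an injective evaluation map ev into functions: ev h is the function h. *)
Record is_rkhs {R : realType} {d : nat} (H : completeNormedModType R)
    (ip : {dot H for idfun}) (ev : H -> 'rV[R]_d -> R)
    (K : 'rV[R]_d -> 'rV[R]_d -> R) : Prop := {
  rkhs_norm : forall h : H, `|h| ^+ 2 = ip h h ;
  rkhs_ev_linear : forall (a : R) (g h : H) x,
    ev (a *: g + h) x = a * ev g x + ev h x ;
  rkhs_ev_inj : injective ev ;
  rkhs_periodic : forall h, torus_periodic (ev h) ;
  rkhs_kernel : forall x, exists k : H,
    (forall y, ev k y = K x y) /\ (forall h, ev h x = ip h k)
}.

Section rkhs.
Context {R : realType} {d m : nat} {H : completeNormedModType R}.
Variables (ip : {dot H for idfun}) (ev : H -> 'rV[R]_d -> R).
Implicit Types w g : 'I_m -> H.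

Definition ip_Hm g w : R := \sum_(i < m) ip (g i) (w i).

Definition norm_Hm w : R := Num.sqrt (\sum_(i < m) `|w i| ^+ 2).

Definition ev_Hm w : 'rV[R]_d -> 'cV[R]_m := fun x => \col_i ev (w i) x.

(* The sigma-algebra on H^m generated by the evaluations w |-> w_i(z); it is the
   Borel sigma-algebra of H^m when H is separable, in particular when the
   kernel is continuous. *)
Definition eval_sets : set (set ('I_m -> H)) :=
  [set A | exists i z (Y : set R),
     measurable Y /\ A = (fun w => ev (w i) z) @^-1` Y].

Definition is_subgradient (F : ('I_m -> H) -> \bar R) w g : Prop :=
  forall v, (F w + (ip_Hm g (v - w))%:E <= F v)%E.

Definition dense_L2 : Prop :=
  forall u : 'rV[R]_d -> R, L2 u -> forall e : R, 0 < e ->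
    exists h, L2 (ev h) /\ (L2norm (u \- ev h)%R < e%:E)%E.

Definition dense_H1 : Prop :=
  forall u : 'rV[R]_d -> R, H1 u -> forall e : R, 0 < e ->
    exists h, H1 (ev h) /\ (H1norm (u \- ev h)%R < e%:E)%E.

(* sg is a choice of subgradient, sg w x standing for (dGamma/dw)(w, x);
   the sample xs k is x^(k+1). *)
Variable sg : ('I_m -> H) -> 'rV[R]_d -> ('I_m -> H).

Fixpoint sgd (gamma : R) (xs : nat -> 'rV[R]_d) (k : nat) : 'I_m -> H :=
  if k is k'.+1 then
    sgd gamma xs k' - gamma *: sg (sgd gamma xs k') (xs k')
  else 0.

Definition sgd_mean (gamma : R) (xs : nat -> 'rV[R]_d) (n : nat) : 'I_m -> H :=
  n%:R^-1 *: \sum_(k < n) sgd gamma xs k.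

End rkhs.

Definition iid_uniform {R : realType} {d : nat} {dO : measure_display}
    {Omega : measurableType dO} (P : probability Omega R)
    (X : nat -> {RV P >-> 'rV[R]_d}) : Prop :=
  (forall k (A : set 'rV[R]_d), measurable A ->
     distribution P (X k) A = unif d A) /\
  (forall (I : {fset nat}) (A : nat -> set 'rV[R]_d),
     (forall k, measurable (A k)) ->
     P (\bigcap_(k in [set` I]) (X k @^-1` A k))
     = (\prod_(k <- I) P (X k @^-1` A k))%E).

(* Main.v *)
Require Import Defs.
From HB Require Import structures.
From mathcomp Require Import all_boot all_order all_algebra finmap sesquilinear.
From mathcomp Require Import ring lra.
From mathcomp Require Import all_classical all_reals all_analysis.
From mathcomp Require Import measurable_realfun.

Set Implicit Arguments.
Unset Strict Implicit.
Unset Printing Implicit Defensive.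

Import Order.TTheory GRing.Theory Num.Theory.
Import numFieldNormedType.Exports.

Local Open Scope classical_set_scope.
Local Open Scope ring_scope.

(** The heart of the matter is the analysis of stochastic subgradient descent
    for a convex Lipschitz integrand; most of the work is to show that [Gamma]
    is such an integrand on [H^m], and that its mean [G] extends continuously
    to [(H^1)^m].

    _The integrand._  Off one null set of points [x], independent of [w], the
    entries of the Lipschitz matrix [B] are differentiable in their own
    coordinate (Rademacher, [lipschitz_unif_derivable]).  There the divergence
    of [B w] is a linear expression [wdivE] in the values and the partial
    derivatives of [w], with bounded coefficients, and [Gamma] becomes a
    function [Phi] of these.  The value function [L] is Lipschitz in both
    arguments ([Lval_lipschitz]): although [alpha^q mu^(1-q)] is singular at
    [mu = 0], it is the perspective of a convex function, so that raising
    [alpha] by [t] is compensated by raising [mu] by [t].  Hence [Phi] is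
    Lipschitz in the values and derivatives of [w] ([Phi_lipschitz]).

    _The kernel space._  Since the kernel is [C^2], the difference quotients of
    its representers form a Cauchy family ([ip_kquot_near]); so every function
    of the space is [C^1], and its values and derivatives on the cube are
    bounded by a multiple of its norm ([rkhs_cube_bound]).  Therefore
    [Gamma(., x)] is nonnegative and grows at most linearly in the norm, and
    such a function has bounded subgradients ([subgradient_bound]); this
    provides a constant [D].

    _Descent._  Each step decreases [|w_k - w|^2] by [2 gamma] times the gap
    [Gamma(w_k, x) - Gamma(w, x)], up to [gamma^2 D^2] ([sgd_descent]).  The
    iterate [w_k] depends on the first [k] samples only and is independent of the
    next one ([independent_past]), so in expectation the gap becomes
    [G(w_k) - G(w)] ([integral_iterate_next]); Jensen passes to the mean of the
    iterates ([expected_regret]).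

    _Passage to Sobolev functions._  On the torus, translation invariance makes
    the mean of a difference quotient vanish, which gives integration by parts
    for products of test functions and entries of [B] ([torus_lip_parts]).
    Density of [H] in [L^2] makes weak derivatives unique, and density in [H^1]
    carries the product rule over to [w] in [(H^1)^m], so the weak divergence of
    [B w] is again [wdivE] ([wdiv_B]).  As [Phi] is Lipschitz, [G] at [w] is
    approached by [G] at elements of [H^m] ([G_approx]), and both infima agree
    ([infG_H1]).  With the step [gamma0 / sqrt n] the regret bound at a fixed
    [w] is [G(w) + O(1 / sqrt n)], while every value of [G] on [H^m] is at least
    the infimum; the limit follows ([cvg_ereal_inf]). *)

(** * Lipschitz functions of one real variable *)

Section lipschitz_1d.
Context {R : realType}.
Implicit Types (u : R -> R) (L : R).
Local Notation mu := (@lebesgue_measure R).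

(** The proof [uL] is an argument so that a monotone, right-continuous
    instance can be attached to the function [x |-> L x + u x]. *)
Definition lip_tilt (u : R -> R) (L : R)
  (uL : forall x y, `|u x - u y| <= L * `|x - y|) : R -> R :=
  fun x => L * x + u x.

Lemma lip_tilt_nd u L (uL : forall x y, `|u x - u y| <= L * `|x - y|) :
  {homo lip_tilt uL : x y / x <= y}.
Proof.
move=> x y xy; rewrite /lip_tilt.
have := uL x y; rewrite (distrC x) ler_norml (ger0_norm (x := y - x)) ?subr_ge0//.
by move=> /andP[_]; rewrite mulrBr; lra.
Qed.

Lemma lip_tilt_rc u L (uL : forall x y, `|u x - u y| <= L * `|x - y|) :
  right_continuous (lip_tilt uL).
Proof.
apply: right_continuousW => x.
apply: (@continuousD _ _ _ (fun x : R => L * x) u); first exact: mulrl_continuous.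
have L0 : 0 <= L.
  by have := le_trans (normr_ge0 _) (uL 1 0); rewrite subr0 normr1 mulr1.
apply/cvgrPdist_le => e e0; near=> y.
rewrite (le_trans (uL _ _))// (@le_trans _ _ ((L + 1) * `|x - y|))//.
  by rewrite ler_wpM2r// lerDl.
rewrite mulrC -ler_pdivlMr ?ltr_wpDl//.
by near: y; apply: cvgr_dist_le => //; rewrite divr_gt0// ltr_wpDl.
Unshelve. all: by end_near. Qed.

HB.instance Definition _ u L (uL : forall x y, `|u x - u y| <= L * `|x - y|) :=
  isCumulative.Build R _ R (lip_tilt uL) (@lip_tilt_nd _ _ uL) (@lip_tilt_rc _ _ uL).

Lemma stieltjes_itv (g : cumulative R R) a b : a <= b ->
  lebesgue_stieltjes_measure g `]a, b] = (g b - g a)%:E.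
Proof.
move=> ab; rewrite /lebesgue_stieltjes_measure /measure_extension.
rewrite measurable_mu_extE/=; last exact: is_ocitv.
by rewrite wlength_itv_bnd.
Qed.

(** Tilting [u] and [- u] by the same slope gives two Stieltjes measures
    whose sum is [2 L] times the Lebesgue measure, so each of them is
    dominated by it. *)
Lemma lip_tilt_dom u L (uL : forall x y, `|u x - u y| <= L * `|x - y|) :
  0 < L -> lebesgue_stieltjes_measure (lip_tilt uL) `<< mu.
Proof.
move=> L0.
have uL' x y : `|(\- u) x - (\- u) y| <= L * `|x - y|.
  by rewrite /= opprK addrC distrC.
pose nu1 := lebesgue_stieltjes_measure (lip_tilt uL).
pose nu2 := lebesgue_stieltjes_measure (lip_tilt uL').
have i0 : 0 <= (2 * L)^-1 by rewrite invr_ge0 mulr_ge0// ltW.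
pose nu := mscale (NngNum i0) (measure_add nu1 nu2).
have E A : measurable A -> mu A = nu A.
  apply: (@lebesgue_measure_unique R nu) => _ [[a b] _ <-].
  change (mu `]a, b] = ((2 * L)^-1)%:E * (measure_add nu1 nu2 `]a, b]))%E.
  rewrite measure_addE.
  have [ab|ba] := leP a b; last first.
    rewrite set_itv_ge; last by rewrite bnd_simp -leNgt ltW.
    by rewrite !measure0 adde0 mule0.
  transitivity (b - a)%:E; first exact: stieltjes_itv.
  transitivity (((2 * L)^-1)%:E *
      ((L * b + u b - (L * a + u a))%:E + (L * b - u b - (L * a - u a))%:E))%E; last first.
    by congr (_ * (_ + _))%E; apply/esym; exact: stieltjes_itv.
  rewrite -EFinD -EFinM; congr (_%:E).
  by have := lt0r_neq0 L0 => ?; field.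
apply/null_content_dominatesP => A mA A0.
have {}E : (0 = ((2 * L)^-1)%:E * measure_add nu1 nu2 A)%E by rewrite -A0; exact: E.
move: E; rewrite measure_addE => /esym/eqP; rewrite mule_eq0 eqe invr_eq0 mulf_eq0.
rewrite pnatr_eq0/= (gt_eqF L0)/=.
by rewrite padde_eq0 ?measure_ge0// => /andP[/eqP].
Qed.

(** The Stieltjes measure of [x |-> L x + u x] has a density by
    Radon-Nikodym, so [u] is an indefinite integral up to a linear term, and
    Lebesgue differentiation applies.  The measure is restricted to an
    interval because the density theorem concerns finite measures. *)
Lemma lipschitz_ae_derivable u L :
  (forall x y, `|u x - u y| <= L * `|x - y|) ->
  {ae mu, forall x, 0 < x < 1 -> derivable u x 1}.
Proof.
move=> uL0.
have {uL0} [L' L0 uL] : exists2 L', 0 < L' & forall x y, `|u x - u y| <= L' * `|x - y|.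
  exists (`|L| + 1); first by rewrite ltr_wpDl.
  move=> x y; rewrite (le_trans (uL0 x y))// ler_wpM2r//.
  by rewrite (le_trans (ler_norm _))// lerDl.
pose g := lip_tilt uL.
pose nu0 := lebesgue_stieltjes_measure g.
have nuitv (a b : R) : a <= b -> nu0 `]a, b]%classic = (g b - g a)%:E.
  exact: stieltjes_itv.
have mI : measurable (`]0, 1] : set (measurableTypeR R)) by exact: measurable_itv.
pose nu := mrestr nu0 mI.
have nufin : fin_num_fun nu.
  move=> A mA; rewrite /nu /mrestr ge0_fin_numE//.
  apply: (@le_lt_trans _ _ (nu0 `]0, 1]%classic)); last by rewrite nuitv ?ltry.
  by apply: le_measure; rewrite ?inE//; exact: measurableI.
pose fin := Measure_isFinite.Build _ _ _ nu nufin.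
pose nuF : {finite_measure set _ -> \bar R} := HB.pack nu fin.
pose c := charge_of_finite_measure nuF.
have cdom : c `<< mu.
  apply/null_content_dominatesP => A mA A0.
  have /null_content_dominatesP/(_ _ mA A0) := @lip_tilt_dom u L' uL L0.
  rewrite /c /charge_of_finite_measure /= /nu /mrestr => nuA0.
  apply/eqP; rewrite eq_le measure_ge0 andbT -nuA0.
  by apply: le_measure; rewrite ?inE//; exact: measurableI.
pose h := Radon_Nikodym c mu.
have hint : mu.-integrable setT h by exact: Radon_Nikodym_integrable.
have hfin x : h x \is a fin_num by exact: Radon_Nikodym_fin_num.
pose F (y : R) : R := \int[mu]_(t in `]0, y]) fine (h t).
have hE x : 0 <= x <= 1 -> g x = g 0 + F x.
  move=> /andP[x0 x1].
  have : c `]0, x]%classic = (g x - g 0)%:E.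
    rewrite /c /charge_of_finite_measure /= /nu /mrestr setIidl ?nuitv//.
    by apply: subset_itvl; rewrite bnd_simp.
  have mx : measurable (`]0, x]%classic : set (measurableTypeR R)) by exact: measurable_itv.
  move=> cE; have := etrans (esym (Radon_Nikodym_integral cdom mx)) cE => /(congr1 fine) e.
  apply/eqP; rewrite addrC -subr_eq; apply/eqP/esym; rewrite -[RHS]e /F /Rintegral.
  by congr fine; apply: eq_integral => t _; rewrite fineK.
have hfE : EFin \o (fine \o h) = h by apply/funext => x /=; rewrite fineK.
have fint : mu.-integrable setT (EFin \o (fine \o h)) by rewrite hfE.
have floc : locally_integrable setT (fine \o h).
  by apply: open_integrable_locally => //; exact: openT.
have /= := @FTC1 R (fine \o h) (BRight 0) _ floc.
have fy : forall y : R, mu.-integrable [set` Interval (BRight 0) (BRight y)] (EFin \o (fine \o h)).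
  by move=> y; exact: integrableS fint.
move=> /(_ fy); apply: filterS; first exact: (ae_filter_ringOfSetsType mu).
move=> x Fx /andP[x0 x1].
have [|dF _] := Fx; first exact: x0.
have {}dF : derivable F x 1 by exact: dF.
have : derivable (cst (g 0) + F - L' *: id) x 1.
  apply: derivableB; first exact: derivableD.
  exact: derivableZ.
apply: near_eq_derivable => //.
near=> y.
have y01 : y \in `]0, 1[ by near: y; apply: near_in_itvoo; rewrite in_itv/= x0.
have yE : L' * y + u y = g 0 + F y.
  by apply: hE; move: y01; rewrite in_itv/= => /andP[/ltW -> /ltW ->].
by apply: (@addrI _ (L' * y)); rewrite yE addrC; exact: subrK.
Unshelve. all: by end_near. Qed.
End lipschitz_1d.

(** * Joint measurability *)

Section caratheodory.
Context {R : realType} {d : nat}.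

Definition floor_grid (n : nat) (x : 'rV[R]_d) : 'rV[int]_d :=
  \row_j Num.floor (n.+1%:R * x 0 j).

Definition grid_point (n : nat) (z : 'rV[int]_d) : 'rV[R]_d :=
  \row_j ((z 0 j)%:~R / n.+1%:R).

Lemma cvg_grid_point (x : 'rV[R]_d) :
  grid_point n (floor_grid n x) @[n --> \oo] --> x.
Proof.
apply/cvg_ballP => e e0.
near=> n; split => // i j; rewrite ord1 !mxE /ball /=.
have n0 : 0 < n.+1%:R :> R by [].
have -> : x 0 j - (Num.floor (n.+1%:R * x 0 j))%:~R / n.+1%:R =
    (n.+1%:R * x 0 j - (Num.floor (n.+1%:R * x 0 j))%:~R) / n.+1%:R.
  by rewrite mulrBl mulrAC divff ?mul1r// gt_eqF.
have /andP[f1 f2] := @mem_rg1_floor R (n.+1%:R * x 0 j).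
rewrite ger0_norm; last by rewrite divr_ge0// ?subr_ge0.
rewrite (@lt_trans _ _ (n.+1%:R^-1))//.
  by rewrite ltr_pdivrMr// mulVf ?gt_eqF// ltrBlDl.
by near: n; exact: (near_infty_natSinv_lt (PosNum e0)).
Unshelve. all: by end_near. Qed.

Lemma measurable_floor_grid n z : measurable (floor_grid n @^-1` [set z]).
Proof.
have -> : floor_grid n @^-1` [set z] = \bigcap_(j in [set: 'I_d])
    ((fun x : 'rV[R]_d => n.+1%:R * x 0 j) @^-1` `[(z 0 j)%:~R, (z 0 j + 1)%:~R[%classic).
  apply/seteqP; split => x /=.
    by move=> <- j _; rewrite /= !mxE in_itv/= intrD; exact: (mem_rg1_floor (n.+1%:R * x 0 j)).
  move=> h; apply/rowP => j; rewrite mxE; apply: floor_def.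
  by have := h j I; rewrite /= in_itv.
apply: fin_bigcap_measurable => // j _; rewrite -[X in measurable X]setTI.
apply: measurable_funM => //; exact: measurable_mx_entry.
Qed.

(** Evaluating the second argument at a grid point instead of [x] leaves
    countably many values of that argument, hence a measurable function; the
    mesh tends to 0 and continuity gives the limit.  This is what makes
    evaluations [ev (w i) x] measurable in the pair [(w, x)]. *)
Lemma measurable_caratheodory dT (T : measurableType dT) (g : T -> 'rV[R]_d -> R) :
  (forall x, measurable_fun setT (g ^~ x)) -> (forall t, continuous (g t)) ->
  measurable_fun setT (fun p : T * 'rV[R]_d => g p.1 p.2).
Proof.
move=> mg cg.
apply: (@measurable_fun_cvg _ _ _ _
  (fun n p => g p.1 (grid_point n (floor_grid n p.2)))); last first.
  move=> [t x] _ /=; apply: continuous_cvg; [exact: cg|exact: cvg_grid_point].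
move=> n _ Y mY; rewrite setTI.
rewrite [X in measurable X](_ : _ = \bigcup_k
  (if (choice.unpickle k : option 'rV[int]_d) is Some z then
     ((g ^~ (grid_point n z)) @^-1` Y) `*` (floor_grid n @^-1` [set z])
   else set0)).
  apply: bigcup_measurable => k _; case: choice.unpickle => // z.
  apply: measurableX; last exact: measurable_floor_grid.
  by rewrite -[X in measurable X]setTI; exact: mg.
apply/seteqP; split => [[t x]/= gY|[t x] [k _]].
  by exists (choice.pickle (floor_grid n x)) => //; rewrite choice.pickleK.
by case: choice.unpickle => // z [/= + xz]; rewrite xz.
Qed.

Lemma continuous_measurable_rV (g : 'rV[R]_d -> R) :
  continuous g -> measurable_fun setT g.
Proof.
move=> cg.
pose h (t : unit) := g.
have mh := @measurable_caratheodory _ unit h (fun x => measurable_cst _) (fun _ => cg).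
have -> : g = (fun p => h p.1 p.2) \o (fun x => (tt, x)) by [].
by apply: measurableT_comp => //; exact: measurable_fun_pair.
Qed.

End caratheodory.

(** * The uniform law on the torus *)

Section resample.
Context {R : realType} {d : nat}.
Local Notation U := (uniform_prob (@ltr01 R)).
Local Notation V := (unif d : probability 'rV[R]_d R).

(** Replacing one coordinate reduces statements about the law on the cube to
    one-dimensional ones, without reordering coordinates. *)
Definition resample (j : 'I_d) (p : measurableTypeR R * 'rV[R]_d) : 'rV[R]_d :=
  \row_k (if k == j then p.1 else p.2 0 k).

Lemma measurable_resample j : measurable_fun setT (resample j).
Proof.
apply: measurable_fun_mx => i k; have [kj|kj] := eqVneq k j.
  rewrite (_ : (fun _ => _) = fst) //.
  by apply/funext => p; rewrite mxE kj eqxx.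
rewrite (_ : (fun _ => _) = (fun M : 'rV[R]_d => M 0 k) \o snd); last first.
  by apply/funext => p; rewrite mxE (negbTE kj).
by apply: measurableT_comp => //; exact: measurable_mx_entry.
Qed.

HB.instance Definition _ (j : 'I_d) :=
  isMeasurableFun.Build _ _ _ _ (@resample j) (@measurable_resample j).

Definition boxes : set (set 'rV[R]_d) :=
  [set A | exists2 B : 'I_d -> set R, (forall k, measurable (B k)) &
           A = [set x : 'rV[R]_d | forall k, B k (x 0 k)]].

Lemma measurable_box (B : 'I_d -> set R) : (forall k, measurable (B k)) ->
  measurable [set x : 'rV[R]_d | forall k, B k (x 0 k)].
Proof.
move=> mB; rewrite [X in measurable X](_ : _ = \bigcap_(j in [set: 'I_d])
    ((fun M : 'rV[R]_d => M 0 j) @^-1` B j)); last first.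
  by apply/seteqP; split => x /= h j; [move=> _|]; exact: h.
apply: fin_bigcap_measurable => // j _; rewrite -[X in measurable X]setTI.
exact: (measurable_mx_entry (T := R)).
Qed.

Lemma measurable_rV_boxes : @measurable _ 'rV[R]_d = <<s boxes >>.
Proof.
apply/seteqP; split; last first.
  apply: smallest_sub; first exact: sigma_algebra_measurable.
  by move=> _ [B mB ->]; exact: measurable_box.
apply: smallest_sub; first exact: smallest_sigma_algebra.
move=> _ [i [j [Y [mY ->]]]].
apply: sub_sigma_algebra; exists (fun k => if k == j then Y else setT); first by move=> k; case: ifP.
apply/seteqP; split => x /=; last by move/(_ j); rewrite eqxx ord1.
by rewrite ord1 => Yx k; case: ifPn => // /eqP ->.
Qed.

(** The two laws agree on boxes, which form a generating pi-system. *)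
Lemma unif_resample (j : 'I_d) A : measurable A ->
  distribution (U \x V)%E (resample j) A = V A.
Proof.
move=> mA.
apply: (@measure_unique _ R 'rV[R]_d boxes (fun=> setT)) => //.
- exact: measurable_rV_boxes.
- move=> _ _ [B mB ->] [C mC ->]; exists (fun k => B k `&` C k).
    by move=> k; exact: measurableI.
  by apply/seteqP; split => x /=; [move=> [h1 h2] k|move=> h; split=> k; case: (h k)].
- by move=> _; exists (fun=> setT) => //; apply/seteqP; split.
- by rewrite bigcup_const//; exists 0%N.
- move=> _ [B mB ->].
  transitivity (\prod_(k < d) U (B k))%E; last exact/esym/unif_box.
  rewrite (bigD1 j)//= /distribution /pushforward.
  pose C k := if k == j then setT else B k.
  have mC k : measurable (C k) by rewrite /C; case: ifP.
  pose D := [set x : 'rV[R]_d | forall k, C k (x 0 k)].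
  have VD : V D = (\prod_(k < d) U (C k))%E by exact: unif_box.
  rewrite [X in (U \x V)%E X](_ : _ = B j `*` D); last first.
    apply/seteqP; split => -[t x] /= h.
      split; first by have := h j; rewrite mxE eqxx.
      by move=> k; have := h k; rewrite mxE /C; case: ifP.
    move=> k; case: h => h1 h2; rewrite mxE; have := h2 k.
    by rewrite /C; case: ifPn => // /eqP ->.
  transitivity (U (B j) * V D)%E.
    have mD : measurable D by exact: (measurable_box mC).
    exact (product_measure1E U V (mB j) mD).
  have CjT : C j = setT by rewrite /C eqxx.
  have UT : U setT = 1%E by exact: probability_setT.
  rewrite VD [in LHS](bigD1 j)//= CjT UT mul1e.
  by congr (_ * _)%E; apply: eq_bigr => k /negbTE; rewrite /C => ->.
- move=> _; apply: (@le_lt_trans _ _ 1%E); last exact: ltry.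
  exact: (@probability_le1 _ _ _ (distribution (U \x V)%E (resample j))).
Qed.

Lemma ge0_integral_resample j (g : 'rV[R]_d -> \bar R) :
  measurable_fun setT g -> (forall x, 0 <= g x)%E ->
  (\int[V]_x g x = \int[V]_x \int[U]_t g (resample j (t, x)))%E.
Proof.
move=> mg g0.
transitivity (\int[distribution (U \x V)%E (resample j)]_x g x)%E.
  by apply: eq_measure_integral => A mA _; exact/esym/unif_resample.
have mgr : measurable_fun setT (g \o resample j).
  exact: (measurableT_comp mg (@measurable_resample j)).
rewrite ge0_integral_distribution//.
exact (@fubini_tonelli2 _ _ _ _ R U V (g \o resample j) mgr (fun p => g0 _)).
Qed.

(** A set that meets almost every point of no line in direction [j] is null:
    Fubini along that direction. *)
Lemma unif_null_lines j (N : set 'rV[R]_d) : measurable N ->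
  (forall x, {ae lebesgue_measure, forall t, 0 < t < 1 -> ~ N (resample j (t, x))}) ->
  V N = 0%E.
Proof.
move=> mN h.
rewrite -(setIT N) -integral_indic// (ge0_integral_resample j)//; last exact/measurable_EFinP.
apply: integral0_eq => x _.
pose M := (fun t => resample j (t, x)) @^-1` N.
have mM : measurable M.
  have mr : measurable_fun setT (fun t : measurableTypeR R => resample j (t, x)).
    apply: (@measurableT_comp _ _ _ _ _ _ (resample j)) => //.
  by rewrite -[X in measurable X]setTI; exact: mr.
rewrite (_ : (fun t => _) = (fun t => (\1_M t)%:E))//.
rewrite integral_indic// setIT.
change (\int[lebesgue_measure]_(x in M) (uniform_pdf 0 1 x)%:E = 0)%E.
rewrite integral_uniform_pdf.
have [A [mA A0 hA]] := h x.
have m01 : measurable (M `&` `[0, 1]%classic) by exact: measurableI.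
apply: null_set_integral => //.
  by apply/measurable_EFinP/measurable_funTS; exact: measurable_uniform_pdf.
apply/negligibleP => //.
apply: (@negligibleS _ _ _ _ (A `|` [set 0] `|` [set 1])).
  move=> t [Mt]; rewrite /= in_itv/= => /andP[t0 t1].
  have [->|tn0] := eqVneq t 0; first by left; right.
  have [->|tn1] := eqVneq t 1; first by right.
  left; left; apply: hA => /= /(_ _) H; apply: H => //.
  by rewrite !lt_neqAle t0 t1 eq_sym tn0 tn1.
apply: negligibleU; [apply: negligibleU|]; apply/negligibleP => //.
- exact: lebesgue_measure_set1.
- exact: lebesgue_measure_set1.
Qed.

Lemma lebesgue_shift (h : R) (D : set (measurableTypeR R)) (g : R -> \bar R) :
  measurable D -> measurable_fun setT g -> (forall x, 0 <= g x)%E ->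
  (\int[lebesgue_measure]_(t in (fun t => (t + h)%R) @^-1` D) g (t + h)%R
   = \int[lebesgue_measure]_(t in D) g t)%E.
Proof.
move=> mD mg g0.
pose phi : measurableTypeR R -> measurableTypeR R := fun t => t + h.
have mphi : measurable_fun setT phi by apply: measurable_realfun.measurable_funD.
rewrite -(@ge0_integral_pushforward _ _ _ _ _ phi mphi lebesgue_measure D g)//; last first.
  exact: measurable_funTS.
pose mix := isMeasurableFun.Build _ _ _ _ _ mphi.
pose phiM : {mfun _ >-> _} := HB.pack phi mix.
apply: eq_measure_integral => A mA _.
apply/esym; apply: (@lebesgue_measure_unique R (pushforward lebesgue_measure phiM)) => //.
move=> _ [[a b] _ <-].
rewrite [RHS](_ : _ = lebesgue_measure (`]a - h, b - h]%classic : set (measurableTypeR R))); last first.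
  congr lebesgue_measure; apply/seteqP; split => t;
  by rewrite /phi /= !in_itv/= ltrBlDr lerBrDr.
by rewrite !lebesgue_measure_itv/= !lte_fin ltrD2r -!EFinB opprB addrA subrK.
Qed.

(** The piece of the shifted interval that leaves the unit interval on the
    right is moved back by one period. *)
Lemma uniform_shift (h : R) (g : R -> \bar R) : 0 <= h <= 1 ->
  measurable_fun setT g -> (forall x, 0 <= g x)%E -> (forall x, g (x + 1)%R = g x) ->
  (\int[U]_t g (t + h)%R = \int[U]_t g t)%E.
Proof.
move=> /andP[h0 h1] mg g0 gp.
rewrite !integral_uniform//; last first.
  apply: (measurableT_comp mg); exact: measurable_realfun.measurable_funD.
congr (_ * _)%E.
have cut (a b c : R) (k : R -> \bar R) : a <= b -> b <= c ->
    measurable_fun setT k -> (forall x, 0 <= k x)%E ->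
    (\int[lebesgue_measure]_(t in `]a, c]) k t = \int[lebesgue_measure]_(t in `]a, b]) k t
      + \int[lebesgue_measure]_(t in `]b, c]) k t)%E.
  move=> ab bc mk k0.
  rewrite -ge0_integral_setU//.
  - congr integral; apply/seteqP; split => t; rewrite /= !in_itv/=.
      by move=> /andP[at_ tc]; have [tb|bt] := leP t b; [left|right]; apply/andP.
    by move=> [/andP[at_ tb]|/andP[bt tc]]; apply/andP; split=> //;
      [exact: le_trans bc|exact: le_lt_trans bt].
  - exact: measurable_funTS.
  - apply/disj_setPS => t []/=; rewrite !in_itv/= => /andP[_ tb] /andP[/(le_lt_trans tb)].
    by rewrite ltxx.
have mgh : measurable_fun setT (fun t : R => g (t + h)).
  by apply: (measurableT_comp mg); exact: measurable_realfun.measurable_funD.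
rewrite -!integral_itv_obnd_cbnd; [|exact: measurable_funTS..].
transitivity (\int[lebesgue_measure]_(t in `]h, (1 + h)%R]) g t)%E.
  rewrite -[RHS](lebesgue_shift h)// (_ : _ @^-1` _ = `]0, 1]%classic)//.
  by apply/seteqP; split => t; rewrite /= !in_itv/= lerD2r -ltrBlDr subrr.
have h1h : 1 <= 1 + h by rewrite lerDl.
(* the interval from h to 1 + h is cut at 1, the one from 0 to 1 at h *)
rewrite (cut _ _ _ _ h1 h1h mg g0) (cut _ _ _ _ h0 h1 mg g0) addeC; congr (_ + _)%E.
transitivity (\int[lebesgue_measure]_(t in `]0%R, h]) g (t + 1)%R)%E; last first.
  by apply: eq_integral => t _; exact: gp.
rewrite -[LHS](lebesgue_shift 1)// (_ : _ @^-1` _ = `]0, h]%classic)//.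
by apply/seteqP; split => t; rewrite /= !in_itv/= (addrC 1 h) lerD2r -ltrBlDr subrr.
Qed.

(** This is where periodicity enters; it replaces the boundary terms of an
    integration by parts. *)
Lemma unif_shift (j : 'I_d) (h : R) (g : 'rV[R]_d -> \bar R) : 0 <= h <= 1 ->
  measurable_fun setT g -> (forall x, 0 <= g x)%E ->
  (forall x, g (x + delta_mx 0 j) = g x) ->
  (\int[V]_x g (x + h *: delta_mx 0 j)%R = \int[V]_x g x)%E.
Proof.
move=> h01 mg g0 gp.
have msh : measurable_fun setT (fun x : 'rV[R]_d => x + h *: delta_mx 0 j).
  apply: measurable_fun_mx => i k; rewrite ord1.
  rewrite (_ : (fun _ => _) = (fun x : 'rV[R]_d => x 0 k + (h *: delta_mx 0 j : 'rV[R]_d) 0 k)).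
    by apply: measurable_realfun.measurable_funD => //; exact: measurable_mx_entry.
  by apply/funext => x; rewrite mxE.
rewrite (ge0_integral_resample j)//; last exact: (measurableT_comp mg msh).
rewrite [RHS](ge0_integral_resample j)//; apply: eq_integral => x _.
have rs t s : resample j (t, x) + s *: delta_mx 0 j = resample j (t + s, x).
  apply/rowP => k; rewrite !mxE eqxx/=.
  by have [kj|kj] := eqVneq k j; rewrite ?mulr1 ?mulr0 ?addr0.
under eq_integral do rewrite rs.
apply: (@uniform_shift h (fun t => g (resample j (t, x)))) => //.
  apply: (measurableT_comp mg).
  by apply: (measurableT_comp (@measurable_resample j)).
by move=> t; rewrite -(gp (resample j (t, x))) -[delta_mx 0 j]scale1r rs.
Qed.

End resample.

(** * Almost everywhere differentiability of Lipschitz functions *)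

Section derivable_set.
Context {R : realType}.

Lemma dnbhs0_ltP (P : R -> Prop) :
  (\forall h \near (0:R)^', P h) <->
  exists n : nat, forall h, h != 0 -> `|h| < n.+1%:R^-1 -> P h.
Proof.
split.
  move=> /nbhs_ballP[e /= e0 he].
  have [n _ hn] := near_infty_natSinv_lt (PosNum e0).
  exists n => h h0 hh; apply: he => //.
  rewrite /ball /= sub0r normrN; apply: (lt_trans hh).
  exact: (hn n (leqnn n)).
move=> [n hn]; apply/nbhs_ballP; exists n.+1%:R^-1 => //= h.
by rewrite /ball /= sub0r normrN => hh h0; exact: hn.
Qed.

(** The Cauchy criterion for a limit at 0 only needs rational increments
    when the function is continuous away from 0.  It expresses the set of
    points of differentiability by countable operations. *)
Lemma cvg_dnbhs0_ratP (Q : R -> R) : (forall h, h != 0 -> {for h, continuous Q}) ->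
  cvg (Q @ (0:R)^') <->
  forall p : nat, exists n : nat, forall r s : rat, ratr r != 0 :> R -> ratr s != 0 :> R ->
    `|ratr r : R| < n.+1%:R^-1 -> `|ratr s : R| < n.+1%:R^-1 ->
    `|Q (ratr r) - Q (ratr s)| <= p.+1%:R^-1.
Proof.
move=> cQ; split.
  move=> /cvg_ex[l Ql] p.
  have p0 : 0 < (p.+1%:R^-1 / 2 : R) by apply: divr_gt0; rewrite ?invr_gt0 ?ltr0n.
  have /dnbhs0_ltP[n hn] : \forall h \near (0:R)^', `|l - Q h| <= p.+1%:R^-1 / 2.
    by move/cvgrPdist_le : Ql; apply.
  exists n => r s r0 s0 hr hs.
  rewrite [leRHS]splitr (le_trans (ler_distD l _ _))// lerD//.
    by rewrite distrC; exact: hn.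
  exact: hn.
move=> H; apply/cauchy_cvgP; apply: cauchy_exP => e e0.
have [p _ /(_ p (leqnn p)) pe] := near_infty_natSinv_lt (PosNum e0).
have [n hn] := H p.
have n20 : 0 < (n.+2%:R^-1 : rat) by rewrite invr_gt0.
pose s : rat := n.+2%:R^-1.
have sE : ratr s = n.+2%:R^-1 :> R by rewrite /s fmorphV rmorph_nat.
have s0 : ratr s != 0 :> R by rewrite sE invr_neq0.
have sn : `|ratr s : R| < n.+1%:R^-1.
  by rewrite sE gtr0_norm// ltf_pV2 ?posrE// ltr_nat.
exists (Q (ratr s)).
suff : \forall h \near (0:R)^', ball (Q (ratr s)) e (Q h) by [].
apply/dnbhs0_ltP; exists n => h h0 hh; rewrite /ball /= distrC.
apply: le_lt_trans pe; rewrite leNgt; apply/negP => lt.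
have c0 : {for h, continuous (fun h => `|Q h - Q (ratr s)|)}.
  by apply: cvg_norm; apply: cvgB; [exact: cQ|exact: cvg_cst].
(* a violation at h would persist at a nearby rational *)
have : \forall k \near h, [/\ p.+1%:R^-1 < `|Q k - Q (ratr s)|, k != 0 & `|k| < n.+1%:R^-1].
  near=> k; split; near: k.
  - exact: (cvgr_gt _ c0).
  - by apply: (cvgr_neq0 h) => //; exact: cvg_id.
  - by apply: (cvgr_lt `|h|) => //; apply: cvg_norm; exact: cvg_id.
move=> /nbhs_ballP[d /= d0 hd].
have /(rat_in_itvoo)[r] : h < h + d by rewrite ltrDl.
rewrite in_itv/= => /andP[hr rd].
have [] := hd (ratr r).
  by rewrite /ball /= ltr0_norm ?subr_lt0// opprB ltrBlDl.
by move=> lt2 r0 rn; move: lt2; rewrite ltNge hn.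
Unshelve. all: by end_near. Qed.

End derivable_set.

Section rademacher.
Context {R : realType} {d : nat}.
Implicit Types (u : 'rV[R]_d -> R) (j : 'I_d).
Local Notation V := (unif d : probability 'rV[R]_d R).
Local Notation e j := (delta_mx 0 j : 'rV[R]_d).

Definition quot j u (x : 'rV[R]_d) (h : R) : R := h^-1 * (u (h *: e j + x) - u x).

Lemma continuous_line j (x : 'rV[R]_d) : continuous (fun h : R => h *: e j + x).
Proof. by move=> h; apply: cvgD; [apply: cvgZr_tmp; exact: cvg_id|exact: cvg_cst]. Qed.

Lemma continuous_quot j u x h : continuous u -> h != 0 ->
  {for h, continuous (quot j u x)}.
Proof.
move=> cu h0; apply: (@continuousM _ _ (fun h : R => h^-1) (fun h => u (h *: e j + x) - u x)).
  by apply: cvgV => //; exact: cvg_id.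
apply: cvgB; last exact: cvg_cst.
by apply: (@continuous_comp _ _ _ (fun h : R => h *: e j + x) u); [exact: continuous_line|exact: cu].
Qed.

Lemma measurable_quot j u h : continuous u -> measurable_fun setT (quot j u ^~ h).
Proof.
move=> cu; apply: continuous_measurable_rV => x.
apply: (@continuousM _ _ (fun=> h^-1) (fun x => u (h *: e j + x) - u x)).
  exact: cst_continuous.
apply: (@continuousB _ _ _ (fun x => u (h *: e j + x)) u); last exact: cu.
apply: (@continuous_comp _ _ _ (fun x : 'rV[R]_d => h *: e j + x) u); last exact: cu.
apply: (@continuousD _ _ _ (fun=> h *: e j) id); first exact: cst_continuous.
by move=> ?.
Qed.

Lemma measurable_derivable j u : continuous u ->
  measurable [set x | derivable u x (e j)].
Proof.
move=> cu.
pose C n (rs : rat * rat) := [&& ratr rs.1 != 0 :> R, ratr rs.2 != 0 :> R,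
    `|ratr rs.1 : R| < n.+1%:R^-1 & `|ratr rs.2 : R| < n.+1%:R^-1].
pose S p n (rs : rat * rat) := [set x : 'rV[R]_d | C n rs ==>
    (`|quot j u x (ratr rs.1) - quot j u x (ratr rs.2)| <= p.+1%:R^-1)].
have mS p n rs : measurable (S p n rs).
  rewrite /S; case: (C n rs) => /=; last first.
    by rewrite (_ : [set _ | _] = setT)//; apply/seteqP; split.
  rewrite -[X in measurable X]setTI; apply: measurable_fun_ler => //.
  apply: measurableT_comp => //.
  by apply: measurable_realfun.measurable_funB; exact: measurable_quot.
rewrite [X in measurable X](_ : _ = \bigcap_p \bigcup_n \bigcap_k
  (if (choice.unpickle k : option (rat * rat)) is Some rs then S p n rs else setT)).
  apply: bigcap_measurable => // p _; apply: bigcup_measurable => n _.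
  by apply: bigcap_measurable => // k _; case: choice.unpickle.
apply/seteqP; split => x /=.
  move=> /cvg_dnbhs0_ratP H p _.
  have [|n hn] := H _ p; first by move=> h h0; exact: continuous_quot.
  exists n => // k _; case: choice.unpickle => //= -[r s].
  by apply/implyP => /and4P[r0 s0 hr hs]; exact: hn.
move=> H; apply/cvg_dnbhs0_ratP; first by move=> h h0; exact: continuous_quot.
move=> p; have [n _ hn] := H p I; exists n => r s r0 s0 hr hs.
have := hn (choice.pickle (r, s)) I; rewrite choice.pickleK => /implyP; apply.
by apply/and4P.
Qed.

(** Rademacher for one partial derivative: on each line in direction [j] the
    one-dimensional result applies, and the exceptional set is measurable,
    so that it is null by Fubini. *)
Lemma lipschitz_unif_derivable j u (L : R) : continuous u ->
  (forall x t, `|u (t *: e j + x) - u x| <= L * `|t|) ->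
  {ae V, forall x, derivable u x (e j)}.
Proof.
move=> cu uL.
exists (~` [set x | derivable u x (e j)]); split => //.
  by apply: measurableC; exact: measurable_derivable.
apply: (@unif_null_lines _ _ j); first by apply: measurableC; exact: measurable_derivable.
move=> x.
pose v t := u (resample j (t, x)).
have rs t s : s *: e j + resample j (t, x) = resample j (s + t, x).
  apply/rowP => k; rewrite !mxE eqxx/=.
  by have [kj|kj] := eqVneq k j; rewrite ?mulr1 ?mulr0 ?add0r.
have vL t s : `|v t - v s| <= L * `|t - s|.
  by have := uL (resample j (s, x)) (t - s); rewrite rs subrK.
have := lipschitz_ae_derivable vL.
apply: filterS; first exact: (ae_filter_ringOfSetsType lebesgue_measure).
move=> t /[apply] dv; apply.
have E : (fun h : R => h^-1 *: ((v \o shift t) (h *: (1 : R)) - v t)) =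
    (fun h => h^-1 *: ((u \o shift (resample j (t, x))) (h *: e j) - u (resample j (t, x)))).
  by apply/funext => h; rewrite /= /v rs /GRing.scale/= mulr1.
exact: (@eq_ind _ _ (fun F : R -> R => cvg (F @ (0:R)^')) dv _ E).
Qed.

End rademacher.

(** * Bounded functions on the cube *)

Section cube.
Context {R : realType} {d : nat}.
Local Notation V := (unif d : probability 'rV[R]_d R).

Lemma compact_box (a b : R) : compact [set x : 'rV[R]_d | forall j : 'I_d, a <= x 0 j <= b].
Proof.
have h := @rV_compact R d (fun=> `[a, b]%classic) (fun=> @segment_compact R a b).
apply: (@eq_ind _ _ compact h); apply/seteqP; split => x /= H j; have := H j;
by rewrite ?in_itv/= ?in_itv.
Qed.

Lemma continuous_box_bounded (a b : R) (g : 'rV[R]_d -> R) : continuous g ->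
  exists2 M : R, 0 <= M & forall x : 'rV[R]_d, (forall j : 'I_d, a <= x 0 j <= b) -> `|g x| <= M.
Proof.
move=> cg; set A := [set x : 'rV[R]_d | forall j : 'I_d, a <= x 0 j <= b].
have /compact_bounded[M [Mr hM]] : compact (g @` A).
  apply: continuous_compact; last exact: compact_box.
  exact: continuous_subspaceT.
exists (`|M| + 1); first by rewrite addr_ge0.
move=> x Ax; apply: (hM (`|M| + 1)); last by exists x.
by rewrite (le_lt_trans (ler_norm _))// ltrDl.
Qed.

Lemma unif_cube_ae : {ae V, forall x, unit_cube d x}.
Proof.
pose C := [set x : 'rV[R]_d | forall j : 'I_d, `[0, 1]%classic (x 0 j)].
have mC : measurable C by exact: (@measurable_box _ _ (fun=> `[0, 1]%classic)).
have VC : V C = 1%E.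
  transitivity (\prod_(j < d) uniform_prob (@ltr01 R) `[0%R, 1%R])%E; first exact: unif_box.
  rewrite big1// => j _; exact: (integral_uniform_pdf1 (@ltr01 R)).
exists (~` C); split; first exact: measurableC.
  by have := probability_setC V mC; rewrite VC subee.
by move=> x /= nx Cx; apply: nx => j; have := Cx j; rewrite /= in_itv.
Qed.

Lemma ae_bounded_integrable (g : 'rV[R]_d -> R) (M : R) : measurable_fun setT g ->
  {ae V, forall x, `|g x| <= M} -> V.-integrable setT (EFin \o g).
Proof.
move=> mg gM.
have M0 : 0 <= M.
  have [N [mN N0 hN]] := gM.
  have [x Nx] : exists x, ~ N x.
    apply: contrapT => /forallNP NT.
    have NE : N = setT by apply/seteqP; split => // x _; exact: contrapT.
    by move: N0; rewrite NE probability_setT => /eqP; rewrite eqe oner_eq0.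
  apply: (le_trans (normr_ge0 (g x))).
  by apply: contrapT => h; apply: Nx; exact: hN.
apply/integrableP; split; first exact/measurable_EFinP.
apply: (@le_lt_trans _ _ (M%:E * V setT)%E).
  apply: integral_le_bound => //; first exact/measurable_EFinP.
  by apply: filterS gM => x gx _; rewrite lee_fin.
by rewrite probability_setT mule1 ltry.
Qed.

Lemma ae_bounded_L2 (g : 'rV[R]_d -> R) (M : R) : measurable_fun setT g ->
  {ae V, forall x, `|g x| <= M} -> L2 g.
Proof.
move=> mg gM.
rewrite /L2 inE; apply/andP; split; rewrite inE//=.
have /integrableP[_] : V.-integrable setT (EFin \o (fun x => g x ^+ 2)).
  apply: (@ae_bounded_integrable _ (M ^+ 2)); first exact: measurable_funX.
  apply: filterS gM => x gx; rewrite normrX ler_pXn2r ?nnegrE//.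
  exact: le_trans gx.
rewrite /finite_norm unlock /= => h; rewrite poweR_lty//.
apply: le_lt_trans h; rewrite le_eqVlt; apply/orP; left; apply/eqP.
apply: eq_integral => x _ /=; rewrite normrX -powR_mulrn//.
Qed.

End cube.

(** * Limits of difference quotients *)

Section difference_limits.
Context {R : realType} {d : nat}.
Implicit Types (u g : 'rV[R]_d -> R) (j : 'I_d).
Local Notation V := (unif d : probability 'rV[R]_d R).
Local Notation e j := (delta_mx 0 j : 'rV[R]_d).

Definition dquot j u (n : nat) (x : 'rV[R]_d) : R := quot j u x n.+1%:R^-1.

(** A measurable, everywhere defined version of the partial derivative. *)
Definition dlim j u (x : 'rV[R]_d) : R :=
  fine (limn_esup (fun n => (dquot j u n x)%:E)).

Lemma cvg_dquot j u x : derivable u x (e j) ->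
  dquot j u n x @[n --> \oo] --> pderiv j u x.
Proof.
move=> du; apply: (@cvg_comp _ _ _ (fun n : nat => n.+1%:R^-1 : R) (quot j u x) _ ((0:R)^')).
  move=> P /dnbhs0_ltP[n hn].
  have [m _ hm] := near_infty_natSinv_lt (PosNum (ltac:(by rewrite invr_gt0) : 0 < (n.+1%:R^-1 : R))).
  exists m => // k mk; apply: hn; first by rewrite invr_neq0.
  by rewrite ger0_norm//; exact: hm.
exact: du.
Qed.

Lemma dlimE j u x : derivable u x (e j) -> dlim j u x = pderiv j u x.
Proof.
move=> du; rewrite /dlim.
have /cvg_limn_einf_sup[_ ->] : (dquot j u n x)%:E @[n --> \oo] --> (pderiv j u x)%:E.
  by apply: cvg_EFin; [exact: nearW|exact: cvg_dquot].
by [].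
Qed.

Lemma measurable_dlim j u : continuous u -> measurable_fun setT (dlim j u).
Proof.
move=> cu; apply: measurableT_comp => //.
apply: measurable_fun_limn_esup => n; apply/measurable_EFinP.
exact: measurable_quot.
Qed.

Lemma pderiv_le j u x (L : R) : derivable u x (e j) ->
  (forall n, `|dquot j u n x| <= L) -> `|pderiv j u x| <= L.
Proof.
move=> du uL; apply: (ler_cvg_to (cvg_norm (cvg_dquot du)) (cvg_cst L)).
exact: nearW.
Qed.

Lemma continuous_integrable u : continuous u -> V.-integrable setT (EFin \o u).
Proof.
move=> cu; have [M M0 hM] := @continuous_box_bounded R d 0 1 u cu.
apply: (@ae_bounded_integrable _ _ _ M); first exact: continuous_measurable_rV.
by apply: filterS unif_cube_ae => x cx; exact: hM.
Qed.

Lemma Rintegral_unif_shift j u h : 0 <= h <= 1 -> continuous u ->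
  (forall x, u (x + e j) = u x) ->
  \int[V]_x u (h *: e j + x) = \int[V]_x u x.
Proof.
move=> h01 cu up; rewrite /Rintegral; congr fine.
rewrite integralE [RHS]integralE.
have mu : measurable_fun setT (EFin \o u).
  by apply/measurable_EFinP; exact: continuous_measurable_rV.
rewrite -(@unif_shift _ _ j h ((EFin \o u)^\+)%E)//; last 2 first.
  exact: measurable_funepos.
  by move=> x; rewrite !funeposE /= up.
rewrite -(@unif_shift _ _ j h ((EFin \o u)^\-)%E)//; last 2 first.
  exact: measurable_funeneg.
  by move=> x; rewrite !funenegE /= up.
by congr (_ - _)%E; apply: eq_integral => x _; rewrite ?funeposE ?funenegE /= addrC.
Qed.

(** The difference quotients of [u] have integral 0 by translation
    invariance, and they converge boundedly to [g].  Applied to a product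
    [u = v w], this is integration by parts on the torus. *)
Lemma integral_dlim0 j u g (M : R) : continuous u -> (forall x, u (x + e j) = u x) ->
  (forall x n, unit_cube d x -> `|dquot j u n x| <= M) ->
  measurable_fun setT g ->
  {ae V, forall x, dquot j u n x @[n --> \oo] --> g x} ->
  \int[V]_x g x = 0.
Proof.
move=> cu up uM mg ug.
have := @dominated_convergence _ _ R V setT measurableT (fun n x => (dquot j u n x)%:E) (EFin \o g) (cst M%:E).
case.
- by move=> n; apply/measurable_EFinP; exact: measurable_quot.
- exact/measurable_EFinP.
- by apply: filterS ug => x ux _; apply: cvg_EFin; [exact: nearW|exact: ux].
- exact: finite_measure_integrable_cst.
- by apply: filterS unif_cube_ae => x cx n _; rewrite lee_fin; exact: uM.
move=> ig _ H.
have Z n : (\int[V]_x (dquot j u n x)%:E = 0)%E.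
  rewrite /dquot /quot.
  have c1 : continuous (fun x : 'rV[R]_d => u (n.+1%:R^-1 *: e j + x)).
    move=> x; apply: (@continuous_comp _ _ _ (fun x : 'rV[R]_d => n.+1%:R^-1 *: e j + x) u); last exact: cu.
    by apply: (@continuousD _ _ _ (fun=> n.+1%:R^-1 *: e j) id); [exact: cst_continuous|move=> ?].
  under eq_integral do rewrite EFinM EFinB.
  have i1 := continuous_integrable c1.
  have i2 := continuous_integrable cu.
  rewrite integralZl//; last exact: integrableB.
  rewrite integralB// -[X in (X - _)%E]fineK; last exact: integrable_fin_num.
  rewrite -[X in (_ - X)%E]fineK; last exact: integrable_fin_num.
  have := @Rintegral_unif_shift j u n.+1%:R^-1 _ cu up; rewrite /Rintegral => ->.
    by rewrite -EFinB subrr mule0.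
  by rewrite invr_ge0 ler0n/= invf_le1 ?ler1n.
rewrite /Rintegral.
have -> : (\int[V]_x (g x)%:E = 0)%E; last by [].
move: H; rewrite [X in X @ _ --> _](_ : _ = cst 0%E); last first.
  by apply/funext => n; exact: Z.
by move=> H; apply/esym; apply: (cvg_unique _ (cvg_cst 0%E) H).
Qed.

End difference_limits.

(** * Differentiability in the reproducing kernel space *)

Section line_mvt.
Context {R : realType} {n : nat}.
Implicit Types (g : 'rV[R]_n -> R).
Local Notation e j := (delta_mx 0 j : 'rV[R]_n).

Lemma is_derive_line g j (x : 'rV[R]_n) (s : R) : derivable g (s *: e j + x) (e j) ->
  is_derive s 1 (fun t : R => g (t *: e j + x)) (pderiv j g (s *: e j + x)).
Proof.
move=> dg.
have E : (fun h : R => h^-1 *: (((fun t : R => g (t *: e j + x)) \o shift s) (h *: (1 : R)) - g (s *: e j + x))) =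
    (fun h => h^-1 *: ((g \o shift (s *: e j + x)) (h *: e j) - g (s *: e j + x))).
  apply/funext => h; have h1 : h *: (1 : R) = h by exact: mulr1.
  by rewrite /= h1 scalerDl addrA.
apply: DeriveDef; first by rewrite /derivable E.
by rewrite /pderiv /derive E.
Qed.

Lemma line_mvt g j (x : 'rV[R]_n) (t : R) : (forall x, derivable g x (e j)) ->
  exists2 s : R, `|s| <= `|t| & g (t *: e j + x) - g x = t * pderiv j g (s *: e j + x).
Proof.
move=> dg.
pose f s := g (s *: e j + x); pose f' s := pderiv j g (s *: e j + x).
have df (s : R) : is_derive s 1 f (f' s) by exact: is_derive_line.
have cf (a b : R) : {within `[a, b], continuous f}.
  apply: continuous_subspaceT => s.
  by apply/differentiable_continuous/derivable1_diffP; exact: ex_derive.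
have f0 : f 0 = g x by rewrite /f scale0r add0r.
have [t0|t0] := leP 0 t.
  have [s] := MVT_segment t0 (fun s _ => df s) (cf _ _).
  rewrite in_itv/= subr0 => /andP[s0 st] H; exists s.
    by rewrite !ger0_norm.
  by rewrite -f0 mulrC.
have [s] := MVT_segment (ltW t0) (fun s _ => df s) (cf _ _).
rewrite in_itv/= sub0r => /andP[st s0] H; exists s.
  by rewrite !ler0_norm ?lerN2// ltW.
have : f t - f 0 = t * f' s by rewrite -opprB H mulrN opprK mulrC.
by rewrite f0.
Qed.

End line_mvt.

Section double_mvt.
Context {R : realType} {n : nat}.
Implicit Types (g : 'rV[R]_n -> R).
Local Notation e j := (delta_mx 0 j : 'rV[R]_n).

(** One mean value theorem for the increment [x |-> g (s e_j + x) - g x] in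
    direction [i], a second one for [pderiv i g] in direction [j]. *)
Lemma double_mvt g i j (z : 'rV[R]_n) (t s : R) :
  (forall x, derivable g x (e i)) -> (forall x, derivable (pderiv i g) x (e j)) ->
  exists a b : R, [/\ `|a| <= `|t|, `|b| <= `|s| &
    g (t *: e i + (s *: e j + z)) - g (t *: e i + z) - g (s *: e j + z) + g z
    = t * s * pderiv j (pderiv i g) (a *: e i + (b *: e j + z))].
Proof.
move=> di dj.
pose G x := g (s *: e j + x) - g x.
have dsh x : derivable (fun x => g (s *: e j + x)) x (e i) /\
    pderiv i (fun x => g (s *: e j + x)) x = pderiv i g (s *: e j + x).
  have E : (fun h : R => h^-1 *: (((fun x => g (s *: e j + x)) \o shift x) (h *: e i) - g (s *: e j + x))) =
      (fun h => h^-1 *: ((g \o shift (s *: e j + x)) (h *: e i) - g (s *: e j + x))).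
    by apply/funext => h; rewrite /= addrCA.
  by split; [rewrite /derivable E; exact: di|rewrite /pderiv /derive E].
have dG x : derivable G x (e i) by have [d1 _] := dsh x; exact: derivableB d1 (di x).
have GE x : pderiv i G x = pderiv i g (s *: e j + x) - pderiv i g x.
  have [d1 E1] := dsh x.
  have := deriveB d1 (di x); rewrite -/(pderiv i _ x) => ->.
  by rewrite -/(pderiv i _ x) E1.
have [a at_ Ha] := line_mvt z t dG.
have [b bs Hb] := line_mvt (a *: e i + z) s dj.
exists a, b; split; [exact: at_|exact: bs|].
have sw1 : b *: e j + (a *: e i + z) = a *: e i + (b *: e j + z) by exact: addrCA.
have sw2 : s *: e j + (t *: e i + z) = t *: e i + (s *: e j + z) by exact: addrCA.
rewrite -sw1 -mulrA -Hb -GE -Ha /G sw2.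
by rewrite [X in _ = _ + X]opprB [RHS]addrA [LHS]addrAC.
Qed.

End double_mvt.

Section rkhs_regularity.
Context {R : realType} {d : nat} {H : completeNormedModType R}.
Variables (ip : {dot H for idfun}) (ev : H -> 'rV[R]_d -> R)
  (K : 'rV[R]_d -> 'rV[R]_d -> R).
Hypothesis rk : is_rkhs ip ev K.
Hypothesis KC2 : is_Ck 2 (fun z : 'rV[R]_(d + d) => K (lsubmx z) (rsubmx z)).
Local Notation e j := (delta_mx 0 j : 'rV[R]_d).

Lemma ipC g h : ip g h = ip h g.
Proof. by rewrite hermC expr0 mul1r. Qed.

Lemma ipBl g h w : ip (g - h) w = ip g w - ip h w.
Proof. exact: linearBl. Qed.

Lemma ipBr g h w : ip w (g - h) = ip w g - ip w h.
Proof. exact: linearBr. Qed.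

Lemma ipZl a g w : ip (a *: g) w = a * ip g w.
Proof. exact: linearZl_LR. Qed.

Lemma ipZr a g w : ip w (a *: g) = a * ip w g.
Proof. exact: linearZr_LR. Qed.

Lemma ip_norm h : ip h h = `|h| ^+ 2.
Proof. by rewrite (rkhs_norm rk). Qed.

Lemma cauchy_schwarz g h : `|ip g h| <= `|g| * `|h|.
Proof.
have [->|h0] := eqVneq h 0; first by rewrite linear0r normr0 normr0 mulr0.
have hn : 0 < `|h| by rewrite normr_gt0.
rewrite -ler_sqr ?nnegrE ?mulr_ge0// exprMn real_normK ?num_real//.
have := sqr_ge0 `|(`|h| ^+ 2) *: g - ip g h *: h|.
rewrite -(ip_norm (_ - _)) ipBl !ipBr !ipZl !ipZr !ip_norm (ipC h g).
move=> ge0.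
have {}ge0 : 0 <= `|h| ^+ 2 * (`|g| ^+ 2 * `|h| ^+ 2 - ip g h ^+ 2).
  apply: le_trans ge0 _; rewrite le_eqVlt; apply/orP; left; apply/eqP.
  by ring.
by move: ge0; rewrite pmulr_rge0 ?exprn_gt0// subr_ge0.
Qed.

Definition kern x : H := sval (cid (rkhs_kernel rk x)).

Lemma kernE x y : ev (kern x) y = K x y.
Proof. by rewrite /kern; case: cid => k []. Qed.

Lemma evE h x : ev h x = ip h (kern x).
Proof. by rewrite /kern; case: cid => k []. Qed.

Lemma ip_kern x y : ip (kern x) (kern y) = K x y.
Proof. by rewrite -evE kernE. Qed.

Let Kz (z : 'rV[R]_(d + d)) := K (lsubmx z) (rsubmx z).

(** The mixed derivative of [K(x, y)], once in [x_j] and once in [y_j]: the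
    expected inner product of the representers of the two derivatives. *)
Definition mixed j x y : R :=
  pderiv (rshift d j) (pderiv (lshift d j) Kz) (row_mx x y).

(** The representer of the difference quotient at [x] in direction [j]. *)
Definition kquot j x (t : R) : H := t^-1 *: (kern (t *: e j + x) - kern x).

Lemma quot_ev j h x t : quot j (ev h) x t = ip h (kquot j x t).
Proof. by rewrite /quot /kquot ipZr ipBr !evE. Qed.

Let cKz : continuous Kz. Proof. by case: KC2. Qed.
Let dKz i z : derivable Kz z (delta_mx 0 i).
Proof. by case: KC2 => _ /(_ i)[]. Qed.
Let ddKz i j z : derivable (pderiv i Kz) z (delta_mx 0 j).
Proof. by case: KC2 => _ /(_ i)[_ [_ /(_ j)[]]]. Qed.
Let cddKz i j : continuous (pderiv j (pderiv i Kz)).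
Proof. by case: KC2 => _ /(_ i)[_ [_ /(_ j)[_ []]]]. Qed.

Lemma delta_lshift j : delta_mx 0 (lshift d j) = row_mx (e j) 0 :> 'rV[R]_(d + d).
Proof.
apply/rowP => k; case: (split_ordP k) => l ->; rewrite ?row_mxEl ?row_mxEr !mxE ?eqxx/=.
  by rewrite (inj_eq (@lshift_inj _ _)).
by rewrite eq_rlshift.
Qed.

Lemma delta_rshift j : delta_mx 0 (rshift d j) = row_mx 0 (e j) :> 'rV[R]_(d + d).
Proof.
apply/rowP => k; case: (split_ordP k) => l ->; rewrite ?row_mxEl ?row_mxEr !mxE ?eqxx/=.
  by rewrite eq_lrshift.
by rewrite (inj_eq (@rshift_inj _ _)).
Qed.

Lemma row_mx_delta (t s : R) j (x y : 'rV[R]_d) :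
  t *: delta_mx 0 (lshift d j) + (s *: delta_mx 0 (rshift d j) + row_mx x y)
  = row_mx (t *: e j + x) (s *: e j + y) :> 'rV[R]_(d + d).
Proof.
by rewrite delta_lshift delta_rshift !scale_row_mx !add_row_mx !scaler0 !add0r.
Qed.

Lemma ip_kquot j x y (t s : R) : t != 0 -> s != 0 ->
  exists a b, [/\ `|a| <= `|t|, `|b| <= `|s| &
    ip (kquot j x t) (kquot j y s) = mixed j (a *: e j + x) (b *: e j + y)].
Proof.
move=> t0 s0.
have [a [b [at_ bs E]]] := double_mvt (row_mx x y) t s (@dKz (lshift d j))
  (@ddKz (lshift d j) (rshift d j)).
exists a, b; split; [exact: at_|exact: bs|].
rewrite /mixed /kquot ipZl ipZr ipBl !ipBr !ip_kern.
move: E; rewrite !row_mx_delta.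
have -> : t *: delta_mx 0 (lshift d j) + row_mx x y = row_mx (t *: e j + x) y :> 'rV[R]_(d + d).
  by have := row_mx_delta t 0 j x y; rewrite !scale0r !add0r.
have -> : s *: delta_mx 0 (rshift d j) + row_mx x y = row_mx x (s *: e j + y) :> 'rV[R]_(d + d).
  by have := row_mx_delta 0 s j x y; rewrite !scale0r !add0r.
rewrite /Kz !row_mxKl !row_mxKr -/Kz => E.
apply: (@mulfI _ (t * s)); first by rewrite mulf_neq0.
by rewrite -E; field; rewrite t0 s0.
Qed.

Let cmixed j x y : (fun ab : R * R => mixed j (ab.1 *: e j + x) (ab.2 *: e j + y)) @ (0, 0) --> mixed j x y.
Proof.
pose Z (ab : R * R) : 'rV[R]_(d + d) :=
  ab.1 *: delta_mx 0 (lshift d j) + (ab.2 *: delta_mx 0 (rshift d j) + row_mx x y).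
have Z0 : Z (0, 0) = row_mx x y by rewrite /Z row_mx_delta !scale0r !add0r.
have cZ : Z @ (0, 0) --> row_mx x y.
  rewrite -Z0; apply: cvgD; first by apply: cvgZr_tmp; exact: cvg_fst.
  by apply: cvgD; [apply: cvgZr_tmp; exact: cvg_snd|exact: cvg_cst].
have -> : (fun ab : R * R => mixed j (ab.1 *: e j + x) (ab.2 *: e j + y)) =
  pderiv (rshift d j) (pderiv (lshift d j) Kz) \o Z.
  by apply/funext => ab; rewrite /Z /= row_mx_delta.
apply: (cvg_comp _ _ cZ); exact: cddKz.
Qed.

(** Gram matrices of difference quotients converge because they are, by the
    double mean value theorem, values of a continuous mixed derivative. *)
Lemma ip_kquot_near j x y (eps : R) : 0 < eps ->
  exists n : nat, forall t s, t != 0 -> s != 0 -> `|t| < n.+1%:R^-1 -> `|s| < n.+1%:R^-1 ->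
    `|ip (kquot j x t) (kquot j y s) - mixed j x y| <= eps.
Proof.
move=> eps0.
move/cvgrPdist_le : (@cmixed j x y) => /(_ _ eps0) /nbhs_ballP[r /= r0 hr].
have [n _ hn] := near_infty_natSinv_lt (PosNum r0).
exists n => t s t0 s0 tn sn.
have [a [b [at_ bs ->]]] := ip_kquot j x y t0 s0.
rewrite distrC; apply: (hr (a, b)); split; rewrite /= /ball/= sub0r normrN.
  by rewrite (le_lt_trans at_)// (lt_trans tn)//; exact: (hn n (leqnn n)).
by rewrite (le_lt_trans bs)// (lt_trans sn)//; exact: (hn n (leqnn n)).
Qed.

Lemma ip_kquot_cvg j x y :
  ip (kquot j x n.+1%:R^-1) (kquot j y n.+1%:R^-1) @[n --> \oo] --> mixed j x y.
Proof.
apply/cvgrPdist_le => eps eps0.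
have [n hn] := ip_kquot_near j x y eps0.
have n0 : (0 < n.+1%:R^-1 :> R) by rewrite invr_gt0.
have [m _ hm] := near_infty_natSinv_lt (PosNum n0).
exists m => // k /= mk; rewrite distrC; apply: hn; rewrite ?invr_neq0//.
- by rewrite ger0_norm//; exact: hm.
- by rewrite ger0_norm//; exact: hm.
Qed.

(** The vectors [kquot j x t] are Cauchy as [t] tends to 0, since
    [|p - r|^2 = <p,p> - 2 <p,r> + <r,r>] and the three inner products share
    one limit. *)
Lemma derivable_ev h j x : derivable (ev h) x (e j).
Proof.
rewrite /derivable.
suff : cvg (quot j (ev h) x @ (0:R)^') by [].
apply/cauchy_cvgP; apply: cauchy_exP => eps eps0.
(* four inner products within [del / 4] of one limit make the squared distance at most [del] *)
pose del := (eps / (2 * (`|h| + 1))) ^+ 2.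
have h1 : 0 < `|h| + 1 by rewrite ltr_wpDl.
have del0 : 0 < del by rewrite exprn_gt0// divr_gt0// mulr_gt0.
have [n hn] := ip_kquot_near j x x (ltac:(by rewrite divr_gt0) : 0 < del / 4).
have s0 : (n.+2%:R^-1 : R) != 0 by rewrite invr_neq0.
have sn : `|n.+2%:R^-1 : R| < n.+1%:R^-1 by rewrite ger0_norm// ltf_pV2 ?posrE// ltr_nat.
(* any increment below 1/(n+1) can serve as center of the Cauchy ball *)
exists (quot j (ev h) x n.+2%:R^-1).
suff : \forall t \near (0:R)^', ball (quot j (ev h) x n.+2%:R^-1) eps (quot j (ev h) x t) by [].
apply/dnbhs0_ltP; exists n => t t0 tn; rewrite /ball /= !quot_ev -ipBr.
set s := n.+2%:R^-1; apply: le_lt_trans (cauchy_schwarz _ _) _.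
have N : `|kquot j x s - kquot j x t| ^+ 2 <= del.
  rewrite -ip_norm ipBl !ipBr.
  have a1 := hn s s s0 s0 sn sn; have a2 := hn s t s0 t0 sn tn.
  have a3 := hn t s t0 s0 tn sn; have a4 := hn t t t0 t0 tn tn.
  move: a1 a2 a3 a4; rewrite !ler_norml => /andP[? ?] /andP[? ?] /andP[? ?] /andP[? ?].
  by lra.
have {}N : `|kquot j x s - kquot j x t| <= eps / (2 * (`|h| + 1)).
  by rewrite -ler_sqr ?nnegrE// divr_ge0// ?mulr_ge0// ltW.
apply: le_lt_trans (ler_wpM2l (normr_ge0 h) N) _.
rewrite mulrA ltr_pdivrMr ?mulr_gt0//.
by rewrite mulrC ltr_pM2l//; have := normr_ge0 h; lra.
Qed.

Let continuous_row (g : 'rV[R]_(d + d) -> R) (x y : 'rV[R]_d -> 'rV[R]_d) :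
  continuous g -> continuous x -> continuous y ->
  continuous (fun z => g (row_mx (x z) (y z))).
Proof.
move=> cg cx cy z; apply: (@continuous_comp _ _ _ (fun z => row_mx (x z) (y z)) g); last exact: cg.
apply/(@cvg_ballP _ _ _ _ (@nbhs_filter _ z)) => r r0.
have Hx : nbhs z [set w | ball (x z) r (x w)] by exact: (@cvg_ballP _ _ _ _ (@nbhs_filter _ z) _ _).1 (cx z) r r0.
have Hy : nbhs z [set w | ball (y z) r (y w)] by exact: (@cvg_ballP _ _ _ _ (@nbhs_filter _ z) _ _).1 (cy z) r r0.
apply: (@filterS2 _ (nbhs z) (nbhs_filter z) _ _ _ _ Hx Hy) => w [_ xw] [_ yw].
split => // i k; rewrite ord1.
by case: (split_ordP k) => l ->; rewrite ?row_mxEl ?row_mxEr; [exact: xw|exact: yw].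
Qed.

(** For [g = <h, k_x>], Cauchy-Schwarz bounds [(g x - g y)^2] by [|h|^2]
    times such a second difference; it serves for [ev h] with the kernel
    itself and for the derivatives of [ev h] with the mixed derivative. *)
Let continuous_kernel_increment (g : 'rV[R]_d -> R) (D : 'rV[R]_(d + d) -> R) (c : R) :
  continuous D ->
  (forall x y, (g x - g y) ^+ 2 <=
     c * (D (row_mx x x) - D (row_mx x y) - D (row_mx y x) + D (row_mx y y))) ->
  continuous g.
Proof.
move=> cD gD x.
have cid_ : continuous (id : 'rV[R]_d -> 'rV[R]_d) by move=> ?.
have cc_ : continuous (cst x : 'rV[R]_d -> 'rV[R]_d) by exact: cst_continuous.
pose E y := c * (D (row_mx x x) - D (row_mx x y) - D (row_mx y x) + D (row_mx y y)).
have cE : E @ x --> (0 : R).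
  have -> : (0 : R) = E x by rewrite /E subrr sub0r addNr mulr0.
  apply: (@continuousM _ _ (cst c) (fun y => D (row_mx x x) - D (row_mx x y)
    - D (row_mx y x) + D (row_mx y y)) x); first exact: cst_continuous.
  apply: (@continuousD _ _ _ (fun y => D (row_mx x x) - D (row_mx x y) - D (row_mx y x))); last first.
    exact: (continuous_row cD cid_ cid_).
  apply: (@continuousB _ _ _ (fun y => D (row_mx x x) - D (row_mx x y))); last first.
    exact: (continuous_row cD cid_ cc_).
  apply: (@continuousB _ _ _ (fun y => D (row_mx x x))); first exact: cst_continuous.
  exact: (continuous_row cD cc_ cid_).
apply/(@cvgrPdist_le _ _ _ _ (@nbhs_filter _ x)) => eps eps0.
have e2 : 0 < eps ^+ 2 by rewrite exprn_gt0.
have := (@cvgrPdist_le _ _ _ _ (@nbhs_filter _ x) _ _).1 cE _ e2.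
apply: (@filterS _ _ (@nbhs_filter _ x)) => y.
rewrite sub0r normrN => Ey.
have eps1 := ltW eps0.
rewrite -ler_sqr ?nnegrE// real_normK ?num_real//.
by apply: (le_trans (gD x y)); apply: le_trans Ey; exact: ler_norm.
Qed.

Lemma continuous_ev h : continuous (ev h).
Proof.
apply: (@continuous_kernel_increment _ Kz (`|h| ^+ 2) cKz) => x y.
have -> : ev h x - ev h y = ip h (kern x - kern y) by rewrite ipBr !evE.
rewrite -(real_normK (num_real (ip _ _))).
apply: (@le_trans _ _ ((`|h| * `|kern x - kern y|) ^+ 2)).
  by rewrite ler_sqr ?nnegrE ?mulr_ge0//; exact: cauchy_schwarz.
rewrite exprMn -(ip_norm (_ - _)) ipBl !ipBr !ip_kern /Kz !row_mxKl !row_mxKr.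
by rewrite opprB addrA addrAC.
Qed.

Lemma continuous_pderiv_ev h j : continuous (pderiv j (ev h)).
Proof.
apply: (@continuous_kernel_increment _ _ (`|h| ^+ 2) (@cddKz (lshift d j) (rshift d j))) => x y.
rewrite -/(mixed j x x) -/(mixed j x y) -/(mixed j y x) -/(mixed j y y).
have c1 : (dquot j (ev h) n x - dquot j (ev h) n y) ^+ 2 @[n --> \oo] -->
    (pderiv j (ev h) x - pderiv j (ev h) y) ^+ 2.
  by apply: cvgM; apply: cvgB; apply: cvg_dquot; exact: derivable_ev.
have c2 : `|h| ^+ 2 * (ip (kquot j x n.+1%:R^-1) (kquot j x n.+1%:R^-1)
   - ip (kquot j x n.+1%:R^-1) (kquot j y n.+1%:R^-1)
   - ip (kquot j y n.+1%:R^-1) (kquot j x n.+1%:R^-1)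
   + ip (kquot j y n.+1%:R^-1) (kquot j y n.+1%:R^-1)) @[n --> \oo] -->
   `|h| ^+ 2 * (mixed j x x - mixed j x y - mixed j y x + mixed j y y).
  apply: cvgM; first exact: cvg_cst.
  by apply: cvgD; [apply: cvgB; [apply: cvgB|]|]; exact: ip_kquot_cvg.
apply: (ler_cvg_to c1 c2); apply: nearW => n.
rewrite /dquot !quot_ev; set p := kquot j x _; set r := kquot j y _.
have -> : ip h p - ip h r = ip h (p - r) by rewrite ipBr.
rewrite -(real_normK (num_real (ip _ _))).
apply: (@le_trans _ _ ((`|h| * `|p - r|) ^+ 2)).
  by rewrite ler_sqr ?nnegrE ?mulr_ge0//; exact: cauchy_schwarz.
by rewrite exprMn -(ip_norm (_ - _)) ipBl !ipBr opprB addrA addrAC.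
Qed.

Lemma rkhs_C1 h : is_Ck 1 (ev h).
Proof.
split; first exact: continuous_ev.
by move=> j; split; [exact: derivable_ev|split; [exact: continuous_pderiv_ev|]].
Qed.

(** The bounds are linear in the norm of [h], uniformly in [x]: this makes
    the subgradients bounded. *)
Lemma rkhs_cube_bound : exists2 M : R, 0 <= M & forall h x, unit_cube d x ->
  `|ev h x| <= M * `|h| /\ forall j n, `|dquot j (ev h) n x| <= M * `|h|.
Proof.
have [M1 M10 HM1] := @continuous_box_bounded R (d + d) 0 1 Kz cKz.
have /(_ _)/cid2 - /all_sig2[MD MD0 HMD] j := @continuous_box_bounded R (d + d) (-1) 2 _
  (@cddKz (lshift d j) (rshift d j)).
pose M := 1 + M1 + \sum_j MD j.
have sMD : 0 <= \sum_j MD j by exact: sumr_ge0.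
have M1_ : 1 <= M by rewrite /M -addrA lerDl addr_ge0.
have M0 : 0 <= M by exact: le_trans M1_.
(* the bound is on squared norms, so [M] has to exceed its own square root *)
have MM : M <= M ^+ 2 by rewrite expr2 ler_peMr.
exists M => // h x cx.
have key v : ip v v <= M -> `|ip h v| <= M * `|h|.
  move=> vM; apply: le_trans (cauchy_schwarz _ _) _; rewrite mulrC ler_wpM2r//.
  rewrite -ler_sqr ?nnegrE//; apply: le_trans MM; by rewrite -ip_norm.
split.
  rewrite evE; apply: key; rewrite ip_kern.
  have -> : K x x = Kz (row_mx x x) by rewrite /Kz row_mxKl row_mxKr.
  apply: (le_trans (ler_norm _)).
  apply: (@le_trans _ _ M1); last by rewrite /M; lra.
  by apply: HM1 => k; case: (split_ordP k) => l ->; rewrite ?row_mxEl ?row_mxEr; exact: cx.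
move=> j n; rewrite /dquot quot_ev; apply: key.
have n0 : (n.+1%:R^-1 : R) != 0 by rewrite invr_neq0.
have n1 : `|n.+1%:R^-1 : R| <= 1 by rewrite ger0_norm// invf_le1// ler1n.
have [a [b [an bn ->]]] := ip_kquot j x x n0 n0.
apply: (le_trans (ler_norm _)); apply: (@le_trans _ _ (MD j)); last first.
  by rewrite /M (bigD1 j)//=; have := @sumr_ge0 _ _ (index_enum _) (fun i => i != j) MD (fun i _ => MD0 i); lra.
have box (c : R) l : `|c| <= `|n.+1%:R^-1| -> -1 <= (c *: e j + x) 0 l <= 2.
  move=> /le_trans/(_ n1); rewrite ler_norml => /andP[c1 c2].
  rewrite !mxE eqxx/=; have /andP[x0 x1] := cx l.
  by case: eqP => _; rewrite ?mulr1 ?mulr0; apply/andP; split; lra.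
by apply: HMD => k; case: (split_ordP k) => l ->; rewrite ?row_mxEl ?row_mxEr; exact: box.
Qed.

End rkhs_regularity.

(** * The value function L *)

Section value_function.
Context {R : realType}.
Implicit Types (q c C alpha beta mu : R).

(** The perspective [a^q m^(1-q)] of the convex function [t |-> t^q] is
    convex and homogeneous, hence subadditive; it equals [b] at [(b, b)]. *)
Lemma powR_perspective q (a b m : R) : 1 < q -> 0 <= a -> 0 <= b -> 0 < m ->
  (a + b) `^ q * (m + b) `^ (1 - q) <= a `^ q * m `^ (1 - q) + b.
Proof.
move=> q1 a0 b0 m0.
have M0 : 0 < m + b by rewrite ltr_pwDl.
have t0 : 0 <= m / (m + b) by rewrite divr_ge0// ltW.
have t1 : m / (m + b) <= 1 by rewrite ler_pdivrMr// mul1r lerDl.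
have persp (x y : R) : 0 <= x -> 0 < y -> x `^ q * y `^ (1 - q) = y * (x / y) `^ q.
  move=> x0 y0; rewrite powRM ?invr_ge0 ?(ltW y0)//.
  rewrite -(powR_inv1 (ltW y0)) -powRrM mulN1r powRN powRB ?powRr1 ?(ltW y0)//.
    by rewrite mulrCA.
  by rewrite (gt_eqF y0) implybT.
rewrite !persp ?addr_ge0//.
have := @convex_powR R q (ltW q1) (Itv01 t0 t1) (a / m) 1.
rewrite !inE/= !in_itv/= !andbT => /(_ (divr_ge0 a0 (ltW m0)) ler01).
rewrite convRE [X in X `^ _ <= _ -> _]convRE /= powR1 /unstable.onem.
have -> : m / (m + b) * (a / m) + (1 - m / (m + b)) * 1 = (a + b) / (m + b).
  by field; rewrite !gt_eqF.
move=> /(ler_wpM2l (ltW M0)) /le_trans; apply.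
rewrite le_eqVlt; apply/orP; left; apply/eqP.
by field; rewrite !gt_eqF.
Qed.

Lemma Lobj_ge0 q c C alpha beta mu : 0 < q -> 0 <= c -> 0 <= C -> 0 <= mu ->
  (0 <= Lobj q c C alpha beta mu)%E.
Proof.
move=> q0 c0 C0 mu0; rewrite /Lobj !adde_ge0//.
- by rewrite lee_fin mulr_ge0.
- case: ifP => _; first by case: ifP.
  by rewrite lee_fin mulr_ge0 ?divr_ge0 ?powR_ge0// ltW.
- by rewrite lee_fin mulr_ge0// le_max lexx orbT.
Qed.

Lemma Lval_ge0 q c C alpha beta : 0 < q -> 0 <= c -> 0 <= C ->
  (0 <= Lval q c C alpha beta)%E.
Proof.
move=> q0 c0 C0; apply: le_ereal_inf_tmp => _ [mu /= mu0 <-]; exact: Lobj_ge0.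
Qed.

(** Raising [mu] along with [alpha] by the same amount [t] costs at most
    [(c + 1) t], so a near-minimizer for [(a, b)] yields one for
    [(a + t, b + s)]. This gives a Lipschitz bound that is free of the
    singularity at [mu = 0]. *)
Lemma Lval_subadd q c C a b t s : 1 < q -> 0 <= c -> 0 <= C -> 0 <= a -> 0 <= t ->
  (Lval q c C (a + t) (b + s) <= Lval q c C a b + ((c + 1) * t + C * `|s|)%:E)%E.
Proof.
move=> q1 c0 C0 a0 t0.
have q0 : 0 < q by exact: lt_trans q1.
rewrite -leeBlDr//; apply: le_ereal_inf_tmp => _ [mu mu0 <-]; rewrite leeBlDr//.
move: mu0 => /= mu0.
have hmax (x y z : R) : 0 <= y -> C * Num.max (x + z - y) 0 <= C * Num.max x 0 + C * `|z|.
  move=> y0; rewrite -mulrDr ler_wpM2l//.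
  have zz := ler_norm z; have zn := normr_ge0 z.
  by rewrite ge_max; have [x0|x0] := leP x 0; apply/andP; split; lra.
have inf (m : R) : 0 <= m -> (Lval q c C (a + t) (b + s) <= Lobj q c C (a + t) (b + s) m)%E.
  by move=> m0; apply: ereal_inf_lbound; exists m.
have q01 : q^-1 <= 1 by rewrite invf_le1// ltW.
have [mu_eq0|mu_neq0] := eqVneq mu 0.
  rewrite [in leRHS]/Lobj mu_eq0 eqxx.
  have [a_eq0|a_neq0] := eqVneq a 0; last first.
    by rewrite mulr0 add0e addye// leey.
  rewrite a_eq0 add0r mulr0 !add0e subr0 -EFinD in inf *.
(* for mu = 0 and a = 0 the competitor is mu = t, where the middle term is t / q *)
  apply: (le_trans (inf t t0)); rewrite /Lobj.
  have [t_eq0|t_neq0] := eqVneq t 0.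
    rewrite t_eq0 !mulr0 !add0e lee_fin add0r.
    exact: hmax.
  have -> : t `^ q / q * t `^ (1 - q) = t / q.
    have qE : q + (1 - q) = 1 by ring.
    have tE : t `^ q * t `^ (1 - q) = t.
      by rewrite -powRD ?t_neq0 ?implybT// qE powRr1.
    by rewrite mulrAC tE.
  rewrite -!EFinD lee_fin mulrDl mul1r.
  have tq : t / q <= t by rewrite ler_piMr.
  by have := hmax b t s t0; lra.
have mu_gt0 : 0 < mu by rewrite lt_neqAle eq_sym mu_neq0.
have m_gt0 : 0 < mu + t by rewrite ltr_pwDl.
apply: (le_trans (inf (mu + t) (ltW m_gt0))).
rewrite /Lobj (negbTE mu_neq0) (gt_eqF m_gt0) -!EFinD lee_fin.
have P := powR_perspective q1 a0 t0 mu_gt0.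
have {P} : (a + t) `^ q / q * (mu + t) `^ (1 - q) <= a `^ q / q * mu `^ (1 - q) + t.
  rewrite mulrAC [X in _ <= X + _]mulrAC.
  have qi0 : 0 <= q^-1 by rewrite invr_ge0 ltW.
  apply: (le_trans (ler_wpM2r qi0 P)); rewrite mulrDl lerD2l.
  by rewrite ler_piMr.
have := hmax (b - mu) t s t0.
rewrite (_ : b - mu + s - t = b + s - (mu + t)); last by ring.
by rewrite mulrDr mulrDl mul1r; lra.
Qed.

Lemma Lval_homo q c C a a' b : 1 < q -> 0 <= a <= a' ->
  (Lval q c C a b <= Lval q c C a' b)%E.
Proof.
move=> q1 /andP[a0 aa'].
have q0 : 0 < q by exact: lt_trans q1.
apply: le_ereal_inf_tmp => _ [mu /= mu0 <-].
apply: (@le_trans _ _ (Lobj q c C a b mu)); first by apply: ereal_inf_lbound; exists mu.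
rewrite /Lobj; apply: leeD => //; apply: leeD => //.
case: ifP => _; last first.
  rewrite lee_fin ler_wpM2r ?powR_ge0// ler_wpM2r ?invr_ge0 ?(ltW q0)//.
  by apply: ge0_ler_powR; rewrite ?nnegrE ?(ltW q0)// (le_trans a0).
have [a'0|] := eqVneq a' 0; last by rewrite leey.
have -> : a = 0 by apply/eqP; rewrite eq_le a0 -a'0 aa'.
by rewrite eqxx.
Qed.

Lemma Lval_lipschitz q c C a a' b b' : 1 < q -> 0 <= c -> 0 <= C -> 0 <= a -> 0 <= a' ->
  (Lval q c C a' b' <= Lval q c C a b + ((c + 1) * `|a' - a| + C * `|b' - b|)%:E)%E.
Proof.
move=> q1 c0 C0 a0 a'0.
apply: le_trans (Lval_subadd _ _ q1 c0 C0 a0 (normr_ge0 (a' - a))).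
rewrite [b + _]addrC subrK; apply: Lval_homo => //; rewrite a'0 /=.
by have := ler_norm (a' - a); lra.
Qed.

Lemma Lval_le q c C a b : 1 < q -> 0 <= c -> 0 <= C -> 0 <= a ->
  (Lval q c C a b <= ((c + 1) * a + C * `|b|)%:E)%E.
Proof.
move=> q1 c0 C0 a0.
have q0 : q != 0 by rewrite gt_eqF// (lt_trans _ q1).
have L0 : (Lval q c C 0 0 <= 0)%E.
  apply: ereal_inf_lbound; exists 0 => //=.
  by rewrite /Lobj !eqxx mulr0 subrr maxxx mulr0 !adde0.
apply: (le_trans (Lval_lipschitz 0 b q1 c0 C0 (lexx 0) a0)).
by rewrite !subr0 (ger0_norm a0) -[leRHS]add0e leeD2r.
Qed.

Definition posrat (k : nat) : R :=
  if (choice.unpickle k : option rat) is Some r then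
    if 0 < ratr r :> R then ratr r else 1
  else 1.

Lemma posrat_gt0 k : 0 < posrat k.
Proof. by rewrite /posrat; case: choice.unpickle => // r; case: ifP. Qed.

(** Slightly increasing [mu] to a positive rational increases only the term
    [c mu], so countably many values suffice and measurability follows. *)
Lemma Lval_posrat q c C a b : 1 < q -> 0 <= c -> 0 <= C -> 0 <= a ->
  Lval q c C a b = einfs (fun k => Lobj q c C a b (posrat k)) 0.
Proof.
move=> q1 c0 C0 a0; have q0 : 0 < q by exact: lt_trans q1.
apply/eqP; rewrite eq_le; apply/andP; split.
  apply: le_ereal_inf_tmp => _ [k _ <-]; apply: ereal_inf_lbound.
  by exists (posrat k) => //=; rewrite ltW// posrat_gt0.
apply: le_ereal_inf_tmp => _ [mu /= mu0 <-].
apply/lee_addgt0Pr => eps eps0.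
have c1 : 0 < c + 1 by rewrite ltr_wpDl.
have /rat_in_itvoo[r] : mu < mu + eps / (c + 1) by rewrite ltrDl divr_gt0.
rewrite in_itv/= => /andP[mur rmu].
have r0 : 0 < ratr r :> R by exact: le_lt_trans mur.
have rE : posrat (choice.pickle r) = ratr r by rewrite /posrat choice.pickleK r0.
apply: (@le_trans _ _ (Lobj q c C a b (ratr r))).
  by apply: ereal_inf_lbound; exists (choice.pickle r) => //; rewrite rE.
have H1 : c * ratr r <= c * mu + eps.
  have : c * (ratr r - mu) <= (c + 1) * (eps / (c + 1)).
    by apply: ler_pM => //; lra.
  have -> : (c + 1) * (eps / (c + 1)) = eps by rewrite mulrC divfK ?gt_eqF.
  by rewrite mulrBr; lra.
have H2 : C * Num.max (b - ratr r) 0 <= C * Num.max (b - mu) 0.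
  have br : b - ratr r <= b - mu by rewrite lerD2l lerN2 ltW.
  by rewrite ler_wpM2l// ge_max !le_max lexx br orbT.
have [mu_eq0|mu_neq0] := eqVneq mu 0.
  rewrite [in leRHS]/Lobj mu_eq0 eqxx; have [a_eq0|a_neq0] := eqVneq a 0; last first.
    by rewrite mulr0 add0e /= leey.
  rewrite /Lobj (gt_eqF r0) a_eq0 powR0 ?gt_eqF// !mul0r mu_eq0 in H1 H2 *.
  by rewrite mulr0 !adde0 -!EFinD lee_fin; move: H1; rewrite mulr0; lra.
have mu_gt0 : 0 < mu by rewrite lt_neqAle eq_sym mu_neq0.
rewrite /Lobj (gt_eqF r0) (negbTE mu_neq0) -!EFinD lee_fin.
have H3 : a `^ q / q * ratr r `^ (1 - q) <= a `^ q / q * mu `^ (1 - q).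
  apply: ler_wpM2l; first by rewrite divr_ge0 ?powR_ge0// ltW.
  rewrite -[1 - q]opprB !powRN lef_pV2 ?posrE ?powR_gt0//.
  by apply: ge0_ler_powR; rewrite ?nnegrE ?subr_ge0 ?ltW// ltW.
lra.
Qed.

Lemma measurable_Lval q C dT (T : measurableType dT) (fc fa fb : T -> R) :
  1 < q -> 0 <= C -> (forall x, 0 <= fc x) -> (forall x, 0 <= fa x) ->
  measurable_fun setT fc -> measurable_fun setT fa -> measurable_fun setT fb ->
  measurable_fun setT (fun x => Lval q (fc x) C (fa x) (fb x)).
Proof.
move=> q1 C0 fc0 fa0 mc ma mb.
under eq_fun do rewrite Lval_posrat//.
apply: (@measurable_fun_einfs _ _ _ _ (fun k x => Lobj q (fc x) C (fa x) (fb x) (posrat k))) => k.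
rewrite /Lobj (gt_eqF (posrat_gt0 k)).
under eq_fun do rewrite -!EFinD.
apply/measurable_EFinP.
apply: measurable_realfun.measurable_funD; first apply: measurable_realfun.measurable_funD.
- exact: measurable_realfun.measurable_funM.
- apply: measurable_realfun.measurable_funM => //.
  apply: measurable_realfun.measurable_funM => //.
  by apply: (measurableT_comp (measurable_powR _)).
- apply: measurable_realfun.measurable_funM => //.
  apply: measurable_maxr => //.
  exact: measurable_realfun.measurable_funB.
Qed.

End value_function.

(** * Entries of Lipschitz matrices and the Euclidean norm *)

Section lipschitz_entries.
Context {R : realType} {d : nat}.
Local Notation e j := (delta_mx 0 j : 'rV[R]_d).

Lemma norm_entry (a b : nat) (A : 'M[R]_(a, b)) i j : `|A i j| <= `|A|.
Proof.
rewrite [leRHS]mx_normrE.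
exact: (le_bigmax _ (fun ij : 'I_a * 'I_b => `|A ij.1 ij.2|) (i, j)).
Qed.

Lemma norm_delta (j : 'I_d) (t : R) : `|t *: e j| <= `|t|.
Proof.
rewrite [leLHS]mx_normrE; apply/bigmax_leP; split => // -[k l] _ /=.
by rewrite !mxE normrM ler_piMr// ord1 eqxx/=; case: (l == j); rewrite ?normr1 ?normr0.
Qed.

Lemma lipschitz_entry (a b : nat) (B : 'rV[R]_d -> 'M[R]_(a, b)) : lipschitz B ->
  exists2 L : R, 0 <= L & forall x y i j, `|B x i j - B y i j| <= L * `|x - y|.
Proof.
move=> [M [Mr HM]].
exists (`|M| + 1); first by rewrite addr_ge0.
move=> x y i j; have := HM (`|M| + 1) (ltac:(by rewrite (le_lt_trans (ler_norm _))// ltrDl)) (x, y) (conj I I).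
by apply: le_trans; have := norm_entry (B x - B y) i j; rewrite !mxE.
Qed.

Lemma lipschitz_continuous_entry (u : 'rV[R]_d -> R) (L : R) : 0 <= L ->
  (forall x y, `|u x - u y| <= L * `|x - y|) -> continuous u.
Proof.
move=> L0 uL x; apply/(@cvgrPdist_le _ _ _ _ (@nbhs_filter _ x)) => eps eps0.
have L1 : 0 < L + 1 by rewrite ltr_wpDl.
have e1 : 0 < eps / (L + 1) by rewrite divr_gt0.
have /(@cvgrPdist_le _ _ _ _ (@nbhs_filter _ x)) /(_ _ e1) : id @ x --> x by move=> ?.
apply: (@filterS _ _ (@nbhs_filter _ x)) => y; rewrite ler_pdivlMr// => xy.
apply: (le_trans (uL x y)); apply: le_trans xy; rewrite mulrC ler_wpM2l//.
by rewrite lerDl.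
Qed.

Lemma lipschitz_real (u : 'rV[R]_d -> R) : lipschitz u -> continuous u.
Proof.
move=> [M [Mr HM]].
apply: (@lipschitz_continuous_entry _ (`|M| + 1)); first by rewrite addr_ge0.
move=> x y; exact: (HM (`|M| + 1) (ltac:(by rewrite (le_lt_trans (ler_norm _))// ltrDl)) (x, y) (conj I I)).
Qed.

End lipschitz_entries.

Section norm2.
Context {R : realType} {m : nat}.
Implicit Types u v : 'cV[R]_m.

Lemma norm2_ge0 u : 0 <= norm2 u.
Proof. exact: sqrtr_ge0. Qed.

Lemma norm2_sqr u : norm2 u ^+ 2 = \sum_i u i 0 ^+ 2.
Proof. by rewrite sqr_sqrtr// sumr_ge0// => i _; exact: sqr_ge0. Qed.

Lemma norm2_entry u i : `|u i 0| <= norm2 u.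
Proof.
rewrite -ler_sqr ?nnegrE ?norm2_ge0// norm2_sqr real_normK ?num_real//.
by rewrite (bigD1 i)//= lerDl sumr_ge0// => j _; exact: sqr_ge0.
Qed.

Lemma sum_sqr_le (I : finType) (F : I -> R) : (forall i, 0 <= F i) ->
  \sum_i F i ^+ 2 <= (\sum_i F i) ^+ 2.
Proof.
move=> F0; rewrite expr2 mulr_suml; apply: ler_sum => i _.
by rewrite expr2 ler_wpM2l// (bigD1 i)//= lerDl sumr_ge0.
Qed.

Lemma norm2_triangle u v : norm2 u <= norm2 v + \sum_i `|u i 0 - v i 0|.
Proof.
have S0 : 0 <= \sum_i `|u i 0 - v i 0| by rewrite sumr_ge0.
rewrite -ler_sqr ?nnegrE ?addr_ge0 ?norm2_ge0// norm2_sqr sqrrD norm2_sqr.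
apply: (@le_trans _ _ (\sum_i (v i 0 ^+ 2 + (norm2 v *+ 2) * `|u i 0 - v i 0| + `|u i 0 - v i 0| ^+ 2))).
  apply: ler_sum => i _.
  have -> : u i 0 ^+ 2 = v i 0 ^+ 2 + v i 0 * (u i 0 - v i 0) *+ 2 + (u i 0 - v i 0) ^+ 2 by ring.
  rewrite real_normK ?num_real// lerD2r lerD2l mulrnAl lerMn2r/=.
  apply: (le_trans (ler_norm _)); rewrite normrM ler_wpM2r//; exact: norm2_entry.
rewrite !big_split/= lerD// ?lerD2l.
  by rewrite -mulr_sumr mulrnAl.
exact: sum_sqr_le.
Qed.

Lemma norm2_dist u v : `|norm2 u - norm2 v| <= \sum_i `|u i 0 - v i 0|.
Proof.
rewrite ler_norml; apply/andP; split; last by rewrite lerBlDl norm2_triangle.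
have := norm2_triangle v u; under eq_bigr do rewrite distrC.
by lra.
Qed.

End norm2.

(** * The integrand *)

Section integrand.
Context {R : realType} {d m : nat}.
Variables (q rho C_V M0 : R) (f : 'rV[R]_d -> R) (B : 'rV[R]_d -> 'M[R]_(d, m))
  (mu0 : 'rV[R]_d -> R).
Hypotheses (q1 : 1 < q) (rho0 : 0 < rho) (f0 : forall x, 0 <= f x)
  (fC : forall x, f x <= C_V) (cf : continuous f) (lipB : lipschitz B)
  (mmu0 : measurable_fun setT mu0) (mu00 : forall x, 0 <= mu0 x)
  (mu0M : forall x, mu0 x <= M0).
Local Notation e j := (delta_mx 0 j : 'rV[R]_d).
Local Notation V := (unif d : probability 'rV[R]_d R).

(** Total and measurable; it is the partial derivative at good points. *)
Definition Bderiv j i : 'rV[R]_d -> R := dlim j (fun y => B y j i).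

Definition good_point x := unit_cube d x /\
  forall j i, derivable (fun y => B y j i) x (e j).

Let CV0 : 0 <= C_V. Proof. exact: le_trans (f0 0) (fC 0). Qed.

Lemma continuous_Bentry j i : continuous (fun y => B y j i).
Proof.
have [L L0 BL] := lipschitz_entry lipB.
by apply: (lipschitz_continuous_entry L0) => x y; exact: BL.
Qed.

Lemma Bentry_line : exists2 L : R, 0 <= L & forall j i k x t,
  `|B (t *: e k + x) j i - B x j i| <= L * `|t|.
Proof.
have [L L0 BL] := lipschitz_entry lipB.
exists L => // j i k x t; apply: (le_trans (BL _ _ _ _)).
by rewrite addrK ler_wpM2l// norm_delta.
Qed.

Lemma ae_good_point : {ae V, forall x, good_point x}.
Proof.
have [L L0 BL] := Bentry_line.
have H : {ae V, forall x, forall j i, derivable (fun y => B y j i) x (e j)}.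
  apply: filter_forall => j; apply: filter_forall => i.
  apply: (@lipschitz_unif_derivable _ _ _ _ L); first exact: continuous_Bentry.
  by move=> x t; exact: BL.
by apply: filterS2 unif_cube_ae H => x; split.
Qed.

Lemma measurable_Bderiv j i : measurable_fun setT (Bderiv j i).
Proof. by apply: measurable_dlim; exact: continuous_Bentry. Qed.

Lemma dquot_B_bound : exists2 L : R, 0 <= L & forall j i k x n,
  `|dquot k (fun y => B y j i) n x| <= L.
Proof.
have [L L0 BL] := Bentry_line; exists L => // j i k x n.
rewrite /dquot /quot normrM invrK normr_nat.
have := BL j i k x n.+1%:R^-1; rewrite (ger0_norm (x := _^-1)) ?invr_ge0// => h.
apply: (le_trans (ler_wpM2l _ h)) => //.
by rewrite mulrCA mulfV ?mulr1.
Qed.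

Lemma B_good_bound : exists2 MB : R, 0 <= MB & forall x, good_point x ->
  forall j i, `|B x j i| <= MB /\ `|Bderiv j i x| <= MB.
Proof.
have [L L0 BL] := dquot_B_bound.
have H j i := @continuous_box_bounded R d 0 1 _ (@continuous_Bentry j i).
pose MB j i := s2val (cid2 (H j i)).
have MB0 j i : 0 <= MB j i by exact: (s2valP (cid2 (H j i))).
have MBE j i x : unit_cube d x -> `|B x j i| <= MB j i by exact: (s2valP' (cid2 (H j i))).
have S0 : 0 <= \sum_j \sum_i MB j i by rewrite sumr_ge0// => j _; rewrite sumr_ge0.
exists (L + \sum_j \sum_i MB j i); first by rewrite addr_ge0.
move=> x [cx gx] j i; split.
  apply: (le_trans (MBE j i x cx)); rewrite (bigD1 j)//= (bigD1 i)//=.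
  have s1 : 0 <= \sum_(k | k != i) MB j k by rewrite sumr_ge0.
  have s2 : 0 <= \sum_(l | l != j) \sum_k MB l k by rewrite sumr_ge0// => l _; rewrite sumr_ge0.
  by lra.
rewrite /Bderiv dlimE//; apply: (@le_trans _ _ L); last by rewrite lerDl.
by apply: pderiv_le => // n; exact: BL.
Qed.

(** The product rule for [div (B w)], with the values [w] and the
    derivatives [p] of the components taken as independent variables.
    Classical and weak divergence both reduce to it, which puts [H^m] and
    [(H^1)^m] on one footing. *)
Definition wdivE (w : 'I_m -> R) (p : 'I_m -> 'I_d -> R) x : R :=
  \sum_j \sum_i (p i j * B x j i + w i * Bderiv j i x).

Definition Phi (w : 'I_m -> R) (p : 'I_m -> 'I_d -> R) x : \bar R :=
  Lval q (f x) C_V (norm2 (\col_i w i)) (mu0 x - rho^-1 * wdivE w p x).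

Lemma measurable_Phi dT (T : measurableType dT) (X : T -> 'rV[R]_d)
    (w : T -> 'I_m -> R) (p : T -> 'I_m -> 'I_d -> R) :
  measurable_fun setT X -> (forall i, measurable_fun setT (fun t => w t i)) ->
  (forall i j, measurable_fun setT (fun t => p t i j)) ->
  measurable_fun setT (fun t => Phi (w t) (p t) (X t)).
Proof.
move=> mX mw mp; apply: measurable_Lval => //.
- by move=> t; exact: norm2_ge0.
- by apply: (measurableT_comp _ mX); exact: continuous_measurable_rV.
- rewrite /norm2.
  apply: (@measurableT_comp _ _ _ _ _ _ (@Num.sqrt R)).
    by apply: continuous_measurable_fun; exact: sqrt_continuous.
  apply: measurable_sum => i; apply: measurable_funX.
  by under eq_fun do rewrite mxE; exact: mw.
- apply: measurable_realfun.measurable_funB; first exact: measurableT_comp.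
  apply: measurable_realfun.measurable_funM => //.
  apply: measurable_sum => j; apply: measurable_sum => i.
  apply: measurable_realfun.measurable_funD; apply: measurable_realfun.measurable_funM => //.
    apply: (@measurableT_comp _ _ _ _ _ _ (fun x => B x j i) _ X) => //.
    by apply: continuous_measurable_rV; exact: continuous_Bentry.
  by apply: (measurableT_comp _ mX); exact: measurable_Bderiv.
Qed.

Lemma Phi_ge0 w p x : (0 <= Phi w p x)%E.
Proof. by apply: Lval_ge0 => //; exact: lt_trans q1. Qed.

Definition wsize (w : 'I_m -> R) (p : 'I_m -> 'I_d -> R) : R :=
  \sum_i `|w i| + \sum_i \sum_j `|p i j|.

(** Values and derivatives of [w] enter through [wdivE] with bounded
    coefficients and [L] is Lipschitz in both arguments, uniformly in [x].
    *)
Lemma Phi_lipschitz : exists2 C : R, 0 <= C & forall x, good_point x ->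
  forall w w' p p', (Phi w' p' x <= Phi w p x +
    (C * wsize (fun i => w' i - w i)%R (fun i j => p' i j - p i j)%R)%:E)%E.
Proof.
have [MB MB0 HB] := B_good_bound.
(* [C_V + 1] bounds the slope in [norm2 w], [C_V] that in the divergence term *)
exists (C_V + 1 + C_V * (rho^-1 * (MB * d%:R + MB))).
  by rewrite !addr_ge0// mulr_ge0// mulr_ge0 ?invr_ge0 ?(ltW rho0)// addr_ge0// mulr_ge0.
move=> x gx w w' p p'.
have {}HB j i := HB x gx j i.
set s := wsize _ _.
have P := Lval_lipschitz (mu0 x - rho^-1 * wdivE w p x) (mu0 x - rho^-1 * wdivE w' p' x)
  q1 (f0 x) CV0 (norm2_ge0 (\col_i w i)) (norm2_ge0 (\col_i w' i)).
apply: (le_trans P); rewrite leeD2l// lee_fin [leRHS]mulrDl.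
have s1 : 0 <= \sum_i `|w' i - w i| by exact: sumr_ge0.
have s2 : 0 <= \sum_i \sum_j `|p' i j - p i j| by rewrite sumr_ge0// => i _; rewrite sumr_ge0.
apply: lerD.
  apply: ler_pM => //.
  - by rewrite addr_ge0.
  - by rewrite lerD2r.
  apply: (le_trans (norm2_dist _ _)).
  by under eq_bigr do rewrite !mxE; rewrite /s /wsize lerDl.
rewrite -mulrA ler_wpM2l//.
have -> : mu0 x - rho^-1 * wdivE w' p' x - (mu0 x - rho^-1 * wdivE w p x) =
  - (rho^-1 * (wdivE w' p' x - wdivE w p x)) by ring.
have ri : 0 <= rho^-1 by rewrite invr_ge0 ltW.
rewrite normrN normrM (ger0_norm ri) -mulrA ler_wpM2l//.
rewrite /wdivE -sumrB; apply: (le_trans (ler_norm_sum _ _ _)).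
apply: (@le_trans _ _ (\sum_j \sum_i (MB * `|p' i j - p i j| + MB * `|w' i - w i|))).
  apply: ler_sum => j _; rewrite -sumrB; apply: (le_trans (ler_norm_sum _ _ _)).
  apply: ler_sum => i _.
  have -> : p' i j * B x j i + w' i * Bderiv j i x - (p i j * B x j i + w i * Bderiv j i x)
    = (p' i j - p i j) * B x j i + (w' i - w i) * Bderiv j i x by ring.
  apply: (le_trans (ler_normD _ _)); rewrite !normrM; have [h1 h2] := HB j i.
  by apply: lerD; rewrite mulrC ler_wpM2r.
have -> : \sum_j \sum_i (MB * `|p' i j - p i j| + MB * `|w' i - w i|) =
   MB * (\sum_i \sum_j `|p' i j - p i j|) + (MB * d%:R) * \sum_i `|w' i - w i|.
  under eq_bigr do rewrite big_split/= -!mulr_sumr.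
  rewrite big_split/= -mulr_sumr exchange_big/=; congr (_ + _).
  by rewrite sumr_const card_ord -[LHS]mulr_natr mulrAC.
rewrite /s /wsize mulrDl addrC; apply: lerD.
  by rewrite ler_wpM2l ?mulr_ge0// lerDl.
by rewrite ler_wpM2l// lerDr.
Qed.

Lemma Phi_le : exists C A : R, [/\ 0 <= C, 0 <= A & forall x, good_point x ->
  forall w p, (Phi w p x <= (A + C * wsize w p)%:E)%E].
Proof.
have [C C0 HC] := Phi_lipschitz.
have M00 : 0 <= M0 by exact: le_trans (mu00 0) (mu0M 0).
exists C, (C_V * M0); split => //; first exact: mulr_ge0.
move=> x gx w p; apply: (le_trans (HC x gx (fun=> 0) w (fun _ _ => 0) p)).
rewrite EFinD leeD//; last first.
  rewrite lee_fin ler_wpM2l// /wsize; under eq_bigr do rewrite subr0.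
  by under [X in _ + X <= _]eq_bigr do under eq_bigr do rewrite subr0.
apply: (le_trans (Lval_le _ q1 (f0 x) CV0 (norm2_ge0 _))).
have -> : norm2 (\col_(i < m) (0 : R)) = 0.
  by rewrite /norm2 big1 ?sqrtr0// => i _; rewrite mxE expr0n.
have -> : wdivE (fun=> 0) (fun _ _ => 0) x = 0.
  by rewrite /wdivE big1// => j _; rewrite big1// => i _; rewrite !mul0r addr0.
by rewrite !mulr0 subr0 add0r lee_fin ler_wpM2l// ger0_norm.
Qed.

Lemma Phi_fin_num x w p : Phi w p x \is a fin_num.
Proof.
rewrite ge0_fin_numE ?Phi_ge0//.
apply: (le_lt_trans (Lval_le _ q1 (f0 x) CV0 (norm2_ge0 _))); exact: ltry.
Qed.

Lemma cdiv_good x (w : 'rV[R]_d -> 'cV[R]_m) : good_point x ->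
  (forall i j, derivable (fun y => w y i 0) x (e j)) ->
  cdiv (fun y => B y *m w y) x =
  wdivE (fun i => w x i 0) (fun i j => pderiv j (fun y => w y i 0) x) x.
Proof.
move=> [_ gx] dw; rewrite /cdiv /wdivE; apply: eq_bigr => j _.
rewrite /pderiv.
have -> : (fun y => (B y *m w y) j 0) = \sum_i ((fun y => B y j i) * (fun y => w y i 0)).
  by apply/funext => y; rewrite mxE fct_sumE.
have dM i : derivable ((fun y => B y j i) * (fun y => w y i 0)) x (e j).
  by apply: derivableM; [exact: gx|exact: dw].
rewrite derive_sum//; apply: eq_bigr => i _.
rewrite (deriveM (gx j i) (dw i j)).
rewrite /Bderiv dlimE; last exact: gx.
by congr (_ + _); exact: mulrC.
Qed.

Lemma Gamma_good x (w : 'rV[R]_d -> 'cV[R]_m) : good_point x ->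
  (forall i j, derivable (fun y => w y i 0) x (e j)) ->
  Gamma q rho C_V f B mu0 cdiv w x =
  Phi (fun i => w x i 0) (fun i j => pderiv j (fun y => w y i 0) x) x.
Proof.
move=> gx dw; have E : \col_i w x i 0 = w x by apply/colP => i; rewrite mxE.
by rewrite /Gamma /Phi (cdiv_good gx dw) E.
Qed.

End integrand.

(** * Integral inequalities and the space H^m *)

Section ge0_integral_mono.
Context {dT : measure_display} {T : measurableType dT} {R : realType}.
Variable mu : {measure set T -> \bar R}.
Import HBNNSimple.

(** The integral is a supremum over simple functions below the integrand,
    and a simple function below [f], cut off on the null set, is below [g].
    This form suits integrands such as [Gamma w], which are identified with
    measurable functions only almost everywhere. *)
Lemma ge0_ae_integral_mono (f g : T -> \bar R) :
  (forall x, 0 <= f x)%E -> (forall x, 0 <= g x)%E ->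
  {ae mu, forall x, (f x <= g x)%E} ->
  (\int[mu]_x f x <= \int[mu]_x g x)%E.
Proof.
move=> f0 g0 [N [mN N0 hN]].
rewrite ge0_integralTE// [leRHS]ge0_integralTE//.
apply: ge_ereal_sup => _ [h /= hf <-].
pose h' := proj_nnsfun h (measurableC mN).
apply: (@le_trans _ _ (sintegral mu h')).
  rewrite -!integralT_nnsfun le_eqVlt; apply/orP; left; apply/eqP.
  apply: ge0_ae_eq_integral => //.
  - exact/measurable_EFinP.
  - exact/measurable_EFinP.
  - by move=> x _; rewrite lee_fin.
  - by move=> x _; rewrite lee_fin.
  - exists N; split => // x /= nx; apply: contrapT => Nx; apply: nx => _ /=.
    by rewrite mindicE mem_set// mulr1.
apply: ereal_sup_ubound; exists h' => //= x.
have [xN|xN] := pselect (N x).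
  by rewrite mindicE memNset ?mulr0//=; exact.
rewrite mindicE mem_set// mulr1; apply: (le_trans (hf x)).
by apply: contrapT => h1; apply: xN; exact: hN.
Qed.

Lemma ge0_ae_eq_integral_nomeas (f g : T -> \bar R) :
  (forall x, 0 <= f x)%E -> (forall x, 0 <= g x)%E ->
  {ae mu, forall x, f x = g x} ->
  (\int[mu]_x f x = \int[mu]_x g x)%E.
Proof.
move=> f0 g0 fg; apply/eqP; rewrite eq_le; apply/andP; split;
apply: ge0_ae_integral_mono => //; apply: filterS fg => x ->; exact: lexx.
Qed.

End ge0_integral_mono.

Section evaluation_measurability.
Context {R : realType} {d m : nat} {H : completeNormedModType R}.
Variables (ip : {dot H for idfun}) (ev : H -> 'rV[R]_d -> R)
  (K : 'rV[R]_d -> 'rV[R]_d -> R).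
Hypothesis rk : is_rkhs ip ev K.
Hypothesis KC2 : is_Ck 2 (fun z : 'rV[R]_(d + d) => K (lsubmx z) (rsubmx z)).

Definition evalT := g_sigma_algebraType (eval_sets (m := m) ev).

Lemma measurable_eval i z : measurable_fun setT (fun w : evalT => ev (w i) z).
Proof.
move=> _ Y mY; rewrite setTI; apply: sub_sigma_algebra.
by exists i, z, Y.
Qed.

Lemma measurable_fun_evalT dT (T : measurableType dT) (g : T -> evalT) :
  (forall i z, measurable_fun setT (fun t => ev (g t i) z)) -> measurable_fun setT g.
Proof.
move=> mg; apply: (@measurability _ _ _ _ setT g (eval_sets (m := m) ev)); first by [].
move=> _ [A [i [z [Y [mY ->]]]] <-]; exact: (mg i z measurableT Y mY).
Qed.

Lemma measurable_eval2 i :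
  measurable_fun setT (fun p : evalT * 'rV[R]_d => ev (p.1 i) p.2).
Proof.
apply: (@measurable_caratheodory _ _ _ evalT (fun w x => ev (w i) x)).
  by move=> x; exact: measurable_eval.
by move=> w; exact: (continuous_ev rk KC2).
Qed.

(** For fixed [x] the derivative is a limit of difference quotients of
    evaluations. *)
Lemma measurable_pderiv_eval2 i j :
  measurable_fun setT (fun p : evalT * 'rV[R]_d => pderiv j (ev (p.1 i)) p.2).
Proof.
apply: (@measurable_caratheodory _ _ _ evalT (fun w x => pderiv j (ev (w i)) x)); last first.
  by move=> w; exact: (continuous_pderiv_ev rk KC2).
move=> x; apply: (@measurable_fun_cvg _ _ _ _ (fun n (w : evalT) => dquot j (ev (w i)) n x)).
  move=> n; rewrite /dquot /quot; apply: measurable_realfun.measurable_funM => //.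
  by apply: measurable_realfun.measurable_funB; exact: measurable_eval.
by move=> w _; apply: cvg_dquot; exact: (derivable_ev rk KC2).
Qed.

End evaluation_measurability.

Section Hm.
Context {R : realType} {d m : nat} {H : completeNormedModType R}.
Variables (ip : {dot H for idfun}) (ev : H -> 'rV[R]_d -> R)
  (K : 'rV[R]_d -> 'rV[R]_d -> R).
Hypothesis rk : is_rkhs ip ev K.
Implicit Types g h w : 'I_m -> H.

Lemma norm_Hm_sqr w : norm_Hm w ^+ 2 = ip_Hm ip w w.
Proof.
rewrite sqr_sqrtr; last by rewrite sumr_ge0// => i _; exact: sqr_ge0.
by apply: eq_bigr => i _; rewrite (ip_norm rk).
Qed.

Lemma norm_Hm_ge0 w : 0 <= norm_Hm w. Proof. exact: sqrtr_ge0. Qed.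

Lemma norm_Hm_entry w i : `|w i| <= norm_Hm w.
Proof.
rewrite -ler_sqr ?nnegrE ?norm_Hm_ge0// sqr_sqrtr.
  by rewrite (bigD1 i)//= lerDl sumr_ge0// => j _; exact: sqr_ge0.
by rewrite sumr_ge0// => j _; exact: sqr_ge0.
Qed.

Lemma ip_HmC g h : ip_Hm ip g h = ip_Hm ip h g.
Proof. by apply: eq_bigr => i _; rewrite ipC. Qed.

Lemma ip_HmBr g h w : ip_Hm ip w (g - h) = ip_Hm ip w g - ip_Hm ip w h.
Proof. by rewrite /ip_Hm -sumrB; apply: eq_bigr => i _; rewrite -ipBr. Qed.

Lemma ip_HmZr a g w : ip_Hm ip w (a *: g) = a * ip_Hm ip w g.
Proof. by rewrite /ip_Hm mulr_sumr; apply: eq_bigr => i _; rewrite -ipZr. Qed.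

Lemma ip_Hm_sumr n (g : 'I_n -> ('I_m -> H)) w :
  ip_Hm ip w (\sum_k g k) = \sum_k ip_Hm ip w (g k).
Proof.
rewrite exchange_big/=; apply: eq_bigr => i _.
by rewrite fct_sumE linear_sumr.
Qed.

Lemma norm_HmB_sqr g h : norm_Hm (g - h) ^+ 2 =
  norm_Hm g ^+ 2 - 2 * ip_Hm ip h g + norm_Hm h ^+ 2.
Proof.
rewrite !norm_Hm_sqr ip_HmBr ip_HmC ip_HmBr (ip_HmC (g - h)) ip_HmBr (ip_HmC g h).
by ring.
Qed.

End Hm.

(** * The objective on H^m *)

Section rkhs_objective.
Context {R : realType} {d m : nat} {H : completeNormedModType R}.
Variables (q rho C_V M0 : R) (f : 'rV[R]_d -> R) (B : 'rV[R]_d -> 'M[R]_(d, m))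
  (mu0 : 'rV[R]_d -> R).
Hypotheses (q1 : 1 < q) (rho0 : 0 < rho) (f0 : forall x, 0 <= f x)
  (fC : forall x, f x <= C_V) (cf : continuous f) (lipB : lipschitz B)
  (mmu0 : measurable_fun setT mu0) (mu00 : forall x, 0 <= mu0 x)
  (mu0M : forall x, mu0 x <= M0).
Variables (ip : {dot H for idfun}) (ev : H -> 'rV[R]_d -> R)
  (K : 'rV[R]_d -> 'rV[R]_d -> R).
Hypothesis rk : is_rkhs ip ev K.
Hypothesis KC2 : is_Ck 2 (fun z : 'rV[R]_(d + d) => K (lsubmx z) (rsubmx z)).
Local Notation V := (unif d : probability 'rV[R]_d R).
Local Notation W := (evalT (m := m) ev).
Implicit Types (v w g : 'I_m -> H).

(** The integrand of [G] along [w] in [H^m], with the exceptional null set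
    removed independently of [w]. *)
Definition Psi w x : \bar R :=
  Phi q rho C_V f B mu0 (fun i => ev (w i) x) (fun i j => pderiv j (ev (w i)) x) x.

Local Notation Gam := (Gamma q rho C_V f B mu0 cdiv).
Local Notation G := (Gfun q rho C_V f B mu0 cdiv).

Let CV0 : 0 <= C_V. Proof. exact: le_trans (f0 0) (fC 0). Qed.

Lemma Psi_ge0 w x : (0 <= Psi w x)%E.
Proof. exact: (Phi_ge0 rho B mu0 q1 f0 fC). Qed.

Lemma Psi_fin_num w x : Psi w x \is a fin_num.
Proof. exact: (Phi_fin_num rho B mu0 q1 f0 fC). Qed.

Lemma Gamma_ev_Hm w x : good_point B x -> Gam (ev_Hm ev w) x = Psi w x.
Proof.
move=> gx.
have E i : (fun y => ev_Hm ev w y i 0) = ev (w i) by apply/funext => y; rewrite mxE.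
rewrite (Gamma_good q rho C_V f mu0 gx); last first.
  by move=> i j; rewrite E; exact: (derivable_ev rk KC2).
have E1 : (fun i => ev_Hm ev w x i 0) = (fun i => ev (w i) x).
  by apply/funext => i; rewrite mxE.
have E2 : (fun i j => pderiv j (fun y => ev_Hm ev w y i 0) x) =
    (fun i j => pderiv j (ev (w i)) x).
  by apply/funext => i; apply/funext => j; rewrite E.
by rewrite E1 E2.
Qed.

Lemma measurable_Psi : measurable_fun setT (fun p : W * 'rV[R]_d => Psi p.1 p.2).
Proof.
apply: (@measurable_Phi _ _ _ q rho C_V f B mu0 q1 f0 fC cf lipB mmu0 _ _
  (fun p : W * 'rV[R]_d => p.2) (fun p i => ev (p.1 i) p.2) (fun p i j => pderiv j (ev (p.1 i)) p.2)).
- exact: measurable_snd.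
- by move=> i; exact: (measurable_eval2 rk KC2).
- by move=> i j; exact: (measurable_pderiv_eval2 rk KC2).
Qed.

Lemma Gamma_ge0 dv (w : 'rV[R]_d -> 'cV[R]_m) x :
  (0 <= Gamma q rho C_V f B mu0 dv w x)%E.
Proof. by apply: Lval_ge0 => //; exact: lt_trans q1. Qed.

Lemma G_Psi w : G (ev_Hm ev w) = (\int[V]_x Psi w x)%E.
Proof.
apply: ge0_ae_eq_integral_nomeas.
- by move=> x; exact: Gamma_ge0.
- by move=> x; exact: Psi_ge0.
- by apply: filterS (ae_good_point lipB) => x gx; exact: Gamma_ev_Hm.
Qed.

Lemma measurable_G : measurable_fun setT (fun w : W => G (ev_Hm ev w)).
Proof.
have -> : (fun w : W => G (ev_Hm ev w)) = (fun w : W => (\int[V]_x Psi w x)%E).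
  by apply/funext => w; exact: G_Psi.
exact: (@measurable_fun_fubini_tonelli_F _ _ W _ R V (fun p => Psi p.1 p.2) measurable_Psi (fun p => Psi_ge0 p.1 p.2)).
Qed.

Lemma Psi_bound : exists A D : R, [/\ 0 <= A, 0 <= D & forall w x, good_point B x ->
  (Psi w x <= (A + D * norm_Hm w)%:E)%E].
Proof.
have [C [A [C0 A0 HA]]] := Phi_le q1 rho0 f0 fC lipB mu00 mu0M.
have [M MM0 HM] := rkhs_cube_bound rk KC2.
exists A, (C * (M * (m%:R + m%:R * d%:R))); split => //.
  by rewrite mulr_ge0// mulr_ge0// addr_ge0// mulr_ge0.
move=> w x gx; apply: (le_trans (HA x gx _ _)); rewrite lee_fin lerD2l -mulrA ler_wpM2l//.
have [cx _] := gx.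
have nM i : M * `|w i| <= M * norm_Hm w by rewrite ler_wpM2l// norm_Hm_entry.
rewrite /wsize; apply: (@le_trans _ _ (\sum_(i < m) M * norm_Hm w + \sum_(i < m) \sum_(j < d) M * norm_Hm w)).
  apply: lerD; apply: ler_sum => i _.
    by have [h _] := HM (w i) x cx; exact: le_trans (nM i).
  apply: ler_sum => j _; have [_ h] := HM (w i) x cx; apply: le_trans (nM i).
  apply: pderiv_le; first exact: (derivable_ev rk KC2).
  by move=> n; exact: h.
have cst_sum k (c : R) : \sum_(i < k) c = c * k%:R by rewrite sumr_const card_ord mulr_natr.
under [X in _ + X <= _]eq_bigr do rewrite cst_sum.
rewrite !cst_sum le_eqVlt; apply/orP; left; apply/eqP.
by ring.
Qed.

(** Testing the subgradient inequality at [t g] gives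
    [t |g|^2 <= A + D t |g| + O(1)]; let [t] be large. *)
Lemma subgradient_bound (F : ('I_m -> H) -> \bar R) (A D : R) w g :
  0 <= D -> (forall v, 0 <= F v)%E -> (forall v, (F v <= (A + D * norm_Hm v)%:E)%E) ->
  is_subgradient ip F w g -> norm_Hm g <= D.
Proof.
move=> D0 F0 FA sub.
rewrite leNgt; apply/negP => Dg.
have g0 : 0 < norm_Hm g by exact: le_lt_trans Dg.
(* large enough to violate the inequality when [D < norm_Hm g] *)
pose t := (`|A| + `|ip_Hm ip g w| + 1) / (norm_Hm g * (norm_Hm g - D)).
have den0 : 0 < norm_Hm g * (norm_Hm g - D) by rewrite mulr_gt0// subr_gt0.
have num0 : 0 <= `|A| + `|ip_Hm ip g w| + 1 by rewrite !addr_ge0.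
have t0 : 0 <= t by rewrite divr_ge0// ltW.
have nt : norm_Hm (t *: g) = t * norm_Hm g.
  have tg0 : 0 <= t * norm_Hm g by apply: mulr_ge0 t0 (norm_Hm_ge0 g).
  apply/eqP; rewrite -(eqrXn2 (n := 2)) ?norm_Hm_ge0 ?tg0//.
  by rewrite exprMn !(norm_Hm_sqr rk) ip_HmZr ip_HmC ip_HmZr mulrA.
have := le_trans (sub (t *: g)) (FA _).
have := F0 w; case: (F w) => [r| |]// r0.
rewrite -EFinD lee_fin nt ip_HmBr ip_HmZr -(norm_Hm_sqr rk) => le1.
have tE : t * (norm_Hm g * (norm_Hm g - D)) = `|A| + `|ip_Hm ip g w| + 1.
  by rewrite /t divfK// gt_eqF.
have a1 := ler_norm A; have a2 := ler_norm (ip_Hm ip g w).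
have r00 : 0 <= r by rewrite -lee_fin.
have : t * (norm_Hm g * (norm_Hm g - D)) = t * norm_Hm g ^+ 2 - D * (t * norm_Hm g) by ring.
by move=> e; rewrite e in tE; lra.
Qed.

Lemma subgradients_bounded (sg : ('I_m -> H) -> 'rV[R]_d -> ('I_m -> H)) :
  {ae V, forall x, forall w, is_subgradient ip (fun v => Gam (ev_Hm ev v) x) w (sg w x)} ->
  exists2 D : R, 0 <= D & {ae V, forall x,
    (ereal_sup [set (norm_Hm (sg w x))%:E | w in [set: 'I_m -> H]] <= D%:E)%E}.
Proof.
move=> sub; have [A [D [A0 D0 HD]]] := Psi_bound.
exists D => //; apply: filterS2 sub (ae_good_point lipB) => x sx gx.
apply: ge_ereal_sup => _ [w _ <-]; rewrite lee_fin.
apply: (@subgradient_bound _ A D w (sg w x) D0 _ _ (sx w)).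
  by move=> v; exact: Gamma_ge0.
by move=> v; rewrite Gamma_ev_Hm//; exact: HD.
Qed.

(** Averaging the subgradient inequality at the barycenter cancels the
    linear terms. *)
Lemma subgradient_jensen (F : ('I_m -> H) -> R) n (w : 'I_n -> ('I_m -> H)) : (0 < n)%N ->
  (forall v, exists g, is_subgradient ip (EFin \o F) v g) ->
  F (n%:R^-1 *: \sum_k w k) <= n%:R^-1 * \sum_k F (w k).
Proof.
move=> n0 sub; have [g hg] := sub (n%:R^-1 *: \sum_k w k).
set wb := n%:R^-1 *: \sum_k w k in hg *.
have nn : (n%:R : R) != 0 by rewrite pnatr_eq0 -lt0n.
rewrite mulrC ler_pdivlMr ?ltr0n//.
have S0 : \sum_k ip_Hm ip g (w k - wb) = 0.
  under eq_bigr do rewrite ip_HmBr.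
  rewrite sumrB sumr_const card_ord -ip_Hm_sumr /wb ip_HmZr.
  by rewrite -[X in _ - X]mulr_natl mulrA divff// mul1r subrr.
have : \sum_(k < n) (F wb + ip_Hm ip g (w k - wb)) <= \sum_k F (w k).
  by apply: ler_sum => k _; have := hg (w k); rewrite -EFinD lee_fin.
by rewrite big_split/= S0 addr0 sumr_const card_ord -[X in X <= _ -> _]mulr_natr.
Qed.

End rkhs_objective.

(** * Stochastic subgradient descent *)

Section independence.
Context {R : realType} {d : nat} {dO : measure_display} {Omega : measurableType dO}.
Variables (P : probability Omega R) (X : nat -> {RV P >-> 'rV[R]_d}).
Hypothesis iid : iid_uniform X.
Local Notation V := (unif d : probability 'rV[R]_d R).

(** The pi-system generating the information of the first [k] samples. *)
Definition past_events (k : nat) : set (set Omega) :=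
  [set A | exists2 Y : nat -> set 'rV[R]_d, (forall l, measurable (Y l)) &
     A = \bigcap_(l in `I_k) (X l @^-1` Y l)].

Definition past (k : nat) := g_sigma_algebraType (past_events k).

Let mX l Y : measurable Y -> measurable (X l @^-1` Y).
Proof. by move=> mY; rewrite -[X in measurable X]setTI; exact: measurable_funP. Qed.

Lemma past_events_measurable k : past_events k `<=` measurable.
Proof.
move=> _ [Y mY ->]; apply: fin_bigcap_measurable; first exact: finite_II.
by move=> l _; exact: mX.
Qed.

Lemma past_measurable k A : <<s past_events k >> A -> measurable A.
Proof.
apply: smallest_sub; first exact: sigma_algebra_measurable.
exact: past_events_measurable.
Qed.

Lemma past_eventsS k : past_events k `<=` past_events k.+1.
Proof.
move=> _ [Y mY ->]; exists (fun l => if (l < k)%N then Y l else setT).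
  by move=> l; case: ifP.
apply/seteqP; split => om /= h l /= lk.
  by case: ifPn => // lk'; exact: h.
by have := h l (ltnW lk); rewrite /= lk.
Qed.

Lemma pastS k A : <<s past_events k >> A -> <<s past_events k.+1 >> A.
Proof.
apply: smallest_sub; first exact: smallest_sigma_algebra.
by move=> B /past_eventsS; exact: sub_sigma_algebra.
Qed.

Lemma past_X k l Y : (l < k)%N -> measurable Y -> <<s past_events k >> (X l @^-1` Y).
Proof.
move=> lk mY; apply: sub_sigma_algebra.
exists (fun i => if i == l then Y else setT); first by move=> i; case: ifP.
apply/seteqP; split => om /=; last by move/(_ l lk); rewrite eqxx.
by move=> Yom i _ /=; case: ifPn => // /eqP ->.
Qed.

(** Independence of finite families is the product rule on the pi-system;
    both sides are finite measures in [A]. *)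
Lemma independent_past k A Y : <<s past_events k >> A -> measurable Y ->
  P (A `&` X k @^-1` Y) = (P A * V Y)%E.
Proof.
move=> sA mY.
have mXY := mX k mY.
have VYfin : V Y \is a fin_num by exact: fin_num_measure.
have v0 : 0 <= fine (V Y) by rewrite fine_ge0.
pose m1 := mrestr P mXY.
pose m2 := mscale (NngNum v0) P.
suff : m1 A = m2 A.
  rewrite /m1 /m2 /mrestr /mscale /= => ->.
  by rewrite muleC fineK.
apply: (@g_sigma_algebra_measure_unique _ R Omega (past_events k) _ (fun=> setT)) => //.
- exact: past_events_measurable.
- move=> _; exists (fun=> setT) => //.
  by apply/seteqP; split.
- by rewrite bigcup_const//; exists 0%N.
- move=> _ _ [Y1 mY1 ->] [Y2 mY2 ->]; exists (fun l => Y1 l `&` Y2 l).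
    by move=> l; exact: measurableI.
  apply/seteqP; split => om /=; first by move=> [h1 h2] l lk; split; [exact: h1|exact: h2].
  by move=> h; split => l lk; have [] := h l lk.
- move=> _ [Z mZ ->].
  pose Z' l := if (l < k)%N then Z l else Y.
  have mZ' l : measurable (Z' l) by rewrite /Z'; case: ifP.
  pose I := [fset x in iota 0 k]%fset.
  have kI : k \notin I by rewrite !inE mem_iota add0n ltnn andbF.
  have ZI l : l \in I -> Z' l = Z l by rewrite !inE mem_iota add0n /Z' => /andP[_ ->].
  have [dX ind] := iid.
  have VE : V Y = P (X k @^-1` Y) by rewrite -(dX k).
  transitivity (P (\bigcap_(l in [set` (k |` I)%fset]) X l @^-1` Z' l)).
    rewrite /m1 /mrestr; congr (P _); apply/seteqP; split => om /=.
      move=> [h1 h2] l /=; rewrite !inE => /orP[/eqP ->|]; first by rewrite /Z' ltnn.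
      by rewrite mem_iota add0n /Z' => /andP[_ lk]; rewrite lk; exact: h1.
    move=> h; split; last by have := h k; rewrite /= /Z' ltnn; apply; rewrite /= !inE eqxx.
    move=> l /= lk; have := h l; rewrite /= /Z' lk; apply.
    by rewrite /= !inE mem_iota add0n lk orbT.
  transitivity (V Y * P (\bigcap_(l in [set` I]) X l @^-1` Z' l))%E.
    by rewrite !ind// big_fsetU1//= /Z' ltnn VE.
    transitivity ((fine (V Y))%:E * P (\bigcap_(l in `I_k) X l @^-1` Z l))%E; last by [].
    rewrite fineK//; congr (_ * P _)%E; apply/seteqP; split => om /= h l /=.
      move=> lk; have lI : l \in I by rewrite !inE mem_iota add0n.
      by have := h l lI; rewrite /= ZI.
    by move=> lI; rewrite (ZI _ lI); apply: h; move: lI; rewrite !inE mem_iota add0n.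
- move=> _; apply: (@le_lt_trans _ _ 1%E); last exact: ltry.
  exact: (@probability_le1 _ _ _ P (setT `&` X k @^-1` Y) (measurableI _ _ measurableT mXY)).
Qed.

End independence.

Section sgd_descent.
Context {R : realType} {d m : nat} {H : completeNormedModType R}.
Variables (ip : {dot H for idfun}) (ev : H -> 'rV[R]_d -> R)
  (K : 'rV[R]_d -> 'rV[R]_d -> R).
Hypothesis rk : is_rkhs ip ev K.
Variable sg : ('I_m -> H) -> 'rV[R]_d -> ('I_m -> H).

(** Each step decreases the squared distance to [w] by at least [2 gamma]
    times the gap in function values, up to the squared length of the step;
    the sum over the steps telescopes. *)
Lemma sgd_descent (F : ('I_m -> H) -> 'rV[R]_d -> R) (gamma D : R) (xs : nat -> 'rV[R]_d) :
  0 < gamma ->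
  (forall k w, is_subgradient ip (fun v => (F v (xs k))%:E) w (sg w (xs k))) ->
  (forall k w, norm_Hm (sg w (xs k)) <= D) ->
  forall w n,
  2 * gamma * (\sum_(k < n) F (sgd sg gamma xs k) (xs k)) + norm_Hm (sgd sg gamma xs n - w) ^+ 2
  <= norm_Hm w ^+ 2 + 2 * gamma * (\sum_(k < n) F w (xs k)) + n%:R * (gamma ^+ 2 * D ^+ 2).
Proof.
move=> gamma0 sub bnd w; elim=> [|n IH].
  rewrite !big_ord0 !mulr0 mul0r !addr0 !add0r /=.
  rewrite le_eqVlt; apply/orP; left; apply/eqP.
  rewrite !(norm_Hm_sqr rk) -[- w]scaleN1r ip_HmZr ip_HmC ip_HmZr.
  by rewrite !mulN1r opprK.
rewrite !big_ord_recr/= -natr1.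
set wn := sgd sg gamma xs n in IH *; set g := sg wn (xs n).
have s := sub n wn w; rewrite -EFinD lee_fin -/g in s.
have b : norm_Hm g ^+ 2 <= D ^+ 2.
  rewrite ler_sqr ?nnegrE ?norm_Hm_ge0//; first exact: bnd.
  by apply: le_trans (bnd n wn); exact: norm_Hm_ge0.
have -> : norm_Hm (wn - gamma *: g - w) ^+ 2 = norm_Hm (wn - w) ^+ 2
   + 2 * gamma * ip_Hm ip g (w - wn) + gamma ^+ 2 * norm_Hm g ^+ 2.
  have -> : wn - gamma *: g - w = (wn - w) - gamma *: g by rewrite addrAC.
  have e1 : ip_Hm ip (gamma *: g) (wn - w) = - (gamma * ip_Hm ip g (w - wn)).
    by rewrite ip_HmC ip_HmZr ip_HmC !ip_HmBr -mulrN opprB.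
  have e2 : norm_Hm (gamma *: g) ^+ 2 = gamma ^+ 2 * norm_Hm g ^+ 2.
    by rewrite !(norm_Hm_sqr rk) ip_HmZr ip_HmC ip_HmZr; ring.
  rewrite [LHS](norm_HmB_sqr rk) e1 e2.
  by ring.
have h1 : 2 * gamma * (F wn (xs n) + ip_Hm ip g (w - wn)) <= 2 * gamma * F w (xs n).
  by rewrite ler_wpM2l// mulr_ge0// ltW.
have h2 : gamma ^+ 2 * norm_Hm g ^+ 2 <= gamma ^+ 2 * D ^+ 2.
  by rewrite ler_wpM2l// sqr_ge0.
move: IH h1 h2; rewrite !mulrDr !mulrDl mul1r; lra.
Qed.

End sgd_descent.

Section sgd_expectation.
Context {R : realType} {d m : nat} {H : completeNormedModType R}.
Variables (ip : {dot H for idfun}) (ev : H -> 'rV[R]_d -> R)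
  (K : 'rV[R]_d -> 'rV[R]_d -> R).
Hypothesis rk : is_rkhs ip ev K.
Context {dO : measure_display} {Omega : measurableType dO}.
Variables (P : probability Omega R) (X : nat -> {RV P >-> 'rV[R]_d}).
Hypothesis iid : iid_uniform X.
Variable sg : ('I_m -> H) -> 'rV[R]_d -> ('I_m -> H).
Local Notation V := (unif d : probability 'rV[R]_d R).
Local Notation W := (evalT (m := m) ev).
Hypothesis msg : measurable_fun setT (fun p : W * 'rV[R]_d => sg p.1 p.2 : W).
Variable gamma : R.

Definition iterate k (om : Omega) : 'I_m -> H := sgd sg gamma (fun k => X k om) k.

Lemma ev_sub g h a x : ev (g - a *: h) x = ev g x - a * ev h x.
Proof. by rewrite addrC -scaleNr (rkhs_ev_linear rk) mulNr addrC. Qed.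

Lemma ev0 x : ev 0 x = 0.
Proof.
have := rkhs_ev_linear rk (-1) 0 0 x.
by rewrite scaler0 addr0 mulN1r addNr.
Qed.

(** The iterate [w_k] only depends on the first [k] samples, hence is
    independent of the sample at which it is evaluated next. *)
Lemma measurable_iterate_past k :
  measurable_fun setT (iterate k : past X k -> W).
Proof.
elim: k => [|k IH].
  apply: measurable_fun_evalT => i z.
  rewrite (_ : (fun _ => _) = cst 0); first exact: measurable_cst.
  by apply/funext => om; exact: ev0.
have mk : measurable_fun setT (iterate k : past X k.+1 -> W).
  by move=> _ Y mY; apply: pastS; exact: (IH measurableT Y mY).
have mX : measurable_fun setT (X k : past X k.+1 -> 'rV[R]_d).
  by move=> _ Y mY; rewrite setTI; exact: past_X.
have mp : measurable_fun setT (fun om : past X k.+1 => (iterate k om : W, X k om)).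
  exact: measurable_fun_pair.
have mg : measurable_fun setT (fun om : past X k.+1 => sg (iterate k om) (X k om) : W).
  exact: (measurableT_comp msg mp).
apply: measurable_fun_evalT => i z.
have -> : (fun om : past X k.+1 => ev (iterate k.+1 om i) z) =
  (fun om : past X k.+1 => ev (iterate k om i) z - gamma * ev (sg (iterate k om) (X k om) i) z).
  by apply/funext => om; rewrite -ev_sub.
apply: measurable_realfun.measurable_funB.
  exact: (measurableT_comp (measurable_eval (ev := ev) i z) mk).
apply: measurable_realfun.measurable_funM => //.
exact: (measurableT_comp (measurable_eval (ev := ev) i z) mg).
Qed.

Lemma measurable_iterate k : measurable_fun setT (iterate k : Omega -> W).
Proof.
move=> _ Y mY; rewrite setTI; apply: (@past_measurable _ _ _ _ _ X k).
by have := @measurable_iterate_past k measurableT Y mY; rewrite setTI.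
Qed.

(** The joint law of [w_k] and the next sample is a product measure. *)
Lemma integral_iterate_next k (F : W * 'rV[R]_d -> \bar R) :
  measurable_fun setT F -> (forall p, 0 <= F p)%E ->
  (\int[P]_om F (iterate k om, X k om) = \int[P]_om \int[V]_x F (iterate k om, x))%E.
Proof.
move=> mF F0.
pose wk : Omega -> W := iterate k.
pose wX (om : Omega) : W * 'rV[R]_d := (iterate k om, X k om).
have mw : measurable_fun setT wk := @measurable_iterate k.
have mwX : measurable_fun setT wX by exact: measurable_fun_pair.
pose mix1 := isMeasurableFun.Build _ _ _ _ _ mw.
pose wkM : {mfun Omega >-> W} := HB.pack wk mix1.
pose mix2 := isMeasurableFun.Build _ _ _ _ _ mwX.
pose wXM : {mfun Omega >-> (W * 'rV[R]_d)%type} := HB.pack wX mix2.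
transitivity (\int[distribution P wXM]_p F p)%E.
  by rewrite ge0_integral_distribution.
transitivity (\int[(distribution P wkM \x V)%E]_p F p)%E.
  apply: eq_measure_integral => A mA _; apply/esym.
  apply: (@product_measure_unique _ _ _ _ R (distribution P wkM) V (distribution P wXM)) => //.
  move=> A1 A2 mA1 mA2.
  have s1 : <<s past_events X k >> (iterate k @^-1` A1).
    by have := @measurable_iterate_past k measurableT A1 mA1; rewrite setTI.
  exact: (independent_past iid s1 mA2).
rewrite (@fubini_tonelli1 _ _ W _ R (distribution P wkM) V F mF F0).
rewrite ge0_integral_distribution//.
  exact: (@measurable_fun_fubini_tonelli_F _ _ W _ R V F mF F0).
by move=> w; apply: integral_ge0.
Qed.

Lemma ae_samples (Q : 'rV[R]_d -> Prop) : {ae V, forall x, Q x} ->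
  {ae P, forall om, forall k, Q (X k om)}.
Proof.
move=> [N [mN N0 hN]]; apply/ae_foralln => k.
exists (X k @^-1` N); split.
- by rewrite -[X in measurable X]setTI; exact: measurable_funP.
- by have [dX _] := iid; rewrite -N0 -(dX k N mN).
- by move=> om /= nQ; apply: hN.
Qed.

End sgd_expectation.

(** * Expected regret *)

Section expected_regret.
Context {R : realType} {d m : nat} {H : completeNormedModType R}.
Variables (q rho C_V M0 : R) (f : 'rV[R]_d -> R) (B : 'rV[R]_d -> 'M[R]_(d, m))
  (mu0 : 'rV[R]_d -> R).
Hypotheses (q1 : 1 < q) (rho0 : 0 < rho) (f0 : forall x, 0 <= f x)
  (fC : forall x, f x <= C_V) (cf : continuous f) (lipB : lipschitz B)
  (mmu0 : measurable_fun setT mu0) (mu00 : forall x, 0 <= mu0 x)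
  (mu0M : forall x, mu0 x <= M0).
Variables (ip : {dot H for idfun}) (ev : H -> 'rV[R]_d -> R)
  (K : 'rV[R]_d -> 'rV[R]_d -> R).
Hypothesis rk : is_rkhs ip ev K.
Hypothesis KC2 : is_Ck 2 (fun z : 'rV[R]_(d + d) => K (lsubmx z) (rsubmx z)).
Context {dO : measure_display} {Omega : measurableType dO}.
Variables (P : probability Omega R) (X : nat -> {RV P >-> 'rV[R]_d}).
Hypothesis iid : iid_uniform X.
Variable sg : ('I_m -> H) -> 'rV[R]_d -> ('I_m -> H).
Local Notation V := (unif d : probability 'rV[R]_d R).
Local Notation W := (evalT (m := m) ev).
Local Notation Gam := (Gamma q rho C_V f B mu0 cdiv).
Local Notation G w := (Gfun q rho C_V f B mu0 cdiv (ev_Hm ev w)).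
Local Notation Psi := (Psi q rho C_V f B mu0 ev).
Hypothesis sub : {ae V, forall x, forall w,
  is_subgradient ip (fun v => Gam (ev_Hm ev v) x) w (sg w x)}.
Hypothesis msg : measurable_fun setT (fun p : W * 'rV[R]_d => sg p.1 p.2 : W).
Implicit Types (v w : 'I_m -> H).

Let mPsi := measurable_Psi rho q1 f0 fC cf lipB mmu0 rk KC2.
Let Psi0 w x : (0 <= Psi w x)%E := Psi_ge0 rho B mu0 q1 f0 fC ev w x.
Let Fr v x := fine (Psi v x).
Let FrE v x : (Fr v x)%:E = Psi v x.
Proof. by rewrite fineK//; exact: (Psi_fin_num rho B mu0 q1 f0 fC). Qed.

Let mPsix w : measurable_fun setT (Psi w).
Proof.
have mp : measurable_fun setT (fun x : 'rV[R]_d => (w : W, x)) by exact: measurable_fun_pair.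
exact: (measurableT_comp mPsi mp).
Qed.

Lemma G_ge0 w : (0 <= G w)%E.
Proof. by apply: integral_ge0 => x _; exact: (Gamma_ge0 rho B mu0 q1 f0 fC). Qed.

Let GPsi w : G w = (\int[V]_x Psi w x)%E := G_Psi rho mu0 q1 f0 fC lipB rk KC2 w.

(** Pointwise convexity comes from the existence of subgradients almost
    everywhere. *)
Lemma G_jensen n (w : 'I_n -> ('I_m -> H)) : (0 < n)%N ->
  (n%:R%:E * G (n%:R^-1 *: \sum_k w k) <= \sum_k G (w k))%E.
Proof.
move=> n0.
have -> : (\sum_k G (w k) = \sum_k \int[V]_x Psi (w k) x)%E.
  by apply: eq_bigr => k _; exact: GPsi.
have -> := GPsi (n%:R^-1 *: \sum_k w k).
have nz : (0 <= n%:R%:E :> \bar R)%E by rewrite lee_fin.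
rewrite -(@ge0_integralZl _ _ _ V setT measurableT _ (mPsix _) _ (fun x _ => Psi0 _ x) nz).
rewrite -(@ge0_integral_sum _ _ _ V setT measurableT _ (fun k x => Psi (w k) x)
  (fun k => mPsix (w k)) (fun k x _ => Psi0 (w k) x)).
apply: ge0_ae_integral_mono.
- by move=> x; rewrite mule_ge0// lee_fin.
- by move=> x; rewrite sume_ge0.
apply: filterS2 sub (ae_good_point lipB) => x sx gx.
have h v : exists g, is_subgradient ip (EFin \o (Fr ^~ x)) v g.
  exists (sg v x) => u /=; rewrite !FrE -!(Gamma_ev_Hm q rho C_V f mu0 rk KC2 _ gx).
  exact: sx.
have := subgradient_jensen w n0 h.
rewrite ler_pdivlMl ?ltr0n// => J.
rewrite -[leLHS]/(n%:R%:E * Psi (n%:R^-1 *: \sum_k w k) x)%E -FrE.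
rewrite -[leRHS]/(\sum_k Psi (w k) x)%E (eq_bigr (fun k => (Fr (w k) x)%:E)).
  by rewrite sumEFin -EFinM lee_fin.
by move=> k _; rewrite FrE.
Qed.

Variables (D gamma : R).
Hypothesis D0 : 0 <= D.
Hypothesis gamma0 : 0 < gamma.
Hypothesis bnd : {ae V, forall x,
  (ereal_sup [set (norm_Hm (sg w x))%:E | w in [set: 'I_m -> H]] <= D%:E)%E}.
Local Notation it := (iterate X sg gamma).

Lemma sum_Psi_iterate_le w n :
  (\int[P]_om \sum_(k < n) Psi (it k om) (X k om) <=
   \int[P]_om (\sum_(k < n) Psi w (X k om) +
     (norm_Hm w ^+ 2 / (2 * gamma) + n%:R * (gamma * D ^+ 2 / 2))%:E))%E.
Proof.
have c0 : 0 <= norm_Hm w ^+ 2 / (2 * gamma) + n%:R * (gamma * D ^+ 2 / 2).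
  have g0 := ltW gamma0.
  apply: addr_ge0; first by apply: divr_ge0; [exact: sqr_ge0|exact: mulr_ge0].
  by apply: mulr_ge0 => //; apply: divr_ge0 => //; apply: mulr_ge0 => //; exact: sqr_ge0.
apply: ge0_ae_integral_mono.
- by move=> om; rewrite sume_ge0.
- by move=> om; rewrite adde_ge0 ?lee_fin// sume_ge0.
have H1 := ae_samples iid sub.
have H2 := ae_samples iid bnd.
have H3 := ae_samples iid (ae_good_point lipB).
apply: filterS3 H1 H2 H3 => om s1 s2 s3.
have h1 k v : is_subgradient ip (fun v => (Fr v (X k om))%:E) v (sg v (X k om)).
  by move=> u /=; rewrite !FrE -!(Gamma_ev_Hm q rho C_V f mu0 rk KC2 _ (s3 k)); exact: s1.
have h2 k v : norm_Hm (sg v (X k om)) <= D.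
  rewrite -lee_fin; apply: le_trans (s2 k); apply: ereal_sup_ubound; by exists v.
have := sgd_descent rk gamma0 h1 h2 w n.
rewrite -/(it n om) => h.
have E (v : nat -> ('I_m -> H)) : (\sum_(k < n) Psi (v k) (X k om) = (\sum_(k < n) Fr (v k) (X k om))%:E)%E.
  by rewrite -sumEFin; apply: eq_bigr => k _; rewrite FrE.
rewrite (E (fun k => it k om)) (E (fun=> w)) -EFinD lee_fin.
have {}h : 2 * gamma * (\sum_(k < n) Fr (it k om) (X k om)) <=
  2 * gamma * (\sum_(k < n) Fr w (X k om) +
    (norm_Hm w ^+ 2 / (2 * gamma) + n%:R * (gamma * D ^+ 2 / 2))).
  have -> : 2 * gamma * (\sum_(k < n) Fr w (X k om) +
    (norm_Hm w ^+ 2 / (2 * gamma) + n%:R * (gamma * D ^+ 2 / 2))) =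
    norm_Hm w ^+ 2 + 2 * gamma * (\sum_(k < n) Fr w (X k om)) + n%:R * (gamma ^+ 2 * D ^+ 2).
    by field; rewrite gt_eqF.
  by apply: le_trans h; rewrite lerDl sqr_ge0.
by rewrite -(ler_pM2l (x := 2 * gamma)) ?mulr_gt0.
Qed.

Lemma integral_Psi_sample w k : (\int[P]_om Psi w (X k om) = G w)%E.
Proof.
rewrite GPsi -(ge0_integral_distribution (X k) (mPsix w))//.
by apply: eq_measure_integral => A mA _; have [dX _] := iid; exact: dX.
Qed.

Lemma integral_Psi_iterate k :
  (\int[P]_om Psi (it k om) (X k om) = \int[P]_om G (it k om))%E.
Proof.
transitivity (\int[P]_om \int[V]_x Psi (it k om) x)%E.
  exact (integral_iterate_next rk iid msg gamma k mPsi (fun p => Psi0 p.1 p.2)).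
by apply: eq_integral => om _; rewrite GPsi.
Qed.

Lemma measurable_G_iterate k : measurable_fun setT (fun om => G (it k om)).
Proof.
exact: (measurableT_comp (measurable_G rho q1 f0 fC cf lipB mmu0 rk KC2)
  (@measurable_iterate _ _ _ _ _ _ _ rk _ _ P X sg msg gamma k)).
Qed.

Lemma measurable_Psi_iterate k : measurable_fun setT (fun om => Psi (it k om) (X k om)).
Proof.
have mp : measurable_fun setT (fun om => (it k om : W, X k om)).
  exact: (measurable_fun_pair (@measurable_iterate _ _ _ _ _ _ _ rk _ _ P X sg msg gamma k)
    (measurable_funPT (X k))).
exact: (measurableT_comp mPsi mp).
Qed.

Local Notation EG n := (\int[P]_om G (sgd_mean sg gamma (fun k => X k om) n))%E.

Lemma measurable_G_mean n : measurable_fun setT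
  (fun om => G (sgd_mean sg gamma (fun k => X k om) n)).
Proof.
have mm : measurable_fun setT (fun om => sgd_mean sg gamma (fun k => X k om) n : W).
  apply: measurable_fun_evalT => i z.
  have -> : (fun om => ev (sgd_mean sg gamma (fun k => X k om) n i) z) =
    (fun om => n%:R^-1 * \sum_(k < n) ev (it k om i) z).
    apply/funext => om; rewrite /sgd_mean (evE rk).
    have -> : (n%:R^-1 *: \sum_(k < n) sgd sg gamma (fun k => X k om) k) i =
      n%:R^-1 *: \sum_(k < n) it k om i.
      by rewrite -[LHS]/(n%:R^-1 *: (\sum_(k < n) sgd sg gamma (fun k => X k om) k) i) fct_sumE.
    rewrite ipZl linear_sumlz; congr (_ * _).
    by apply: eq_bigr => k _; rewrite (evE rk).
  apply: measurable_realfun.measurable_funM => //.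
  apply: measurable_sum => k.
  exact: (measurableT_comp (measurable_eval (ev := ev) i z) (@measurable_iterate _ _ _ _ _ _ _ rk _ _ P X sg msg gamma k)).
exact: (measurableT_comp (measurable_G rho q1 f0 fC cf lipB mmu0 rk KC2) mm).
Qed.

(** Jensen bounds [n G] at the mean by the sum of the [G (w_k)]; by
    independence each expectation is that of the integrand at the next
    sample, to which the descent inequality applies. *)
Lemma expected_regret w n : (0 < n)%N ->
  (EG n <= G w + (norm_Hm w ^+ 2 / (2 * gamma * n%:R) + gamma * D ^+ 2 / 2)%:E)%E.
Proof.
move=> n0.
have nn : 0 < (n%:R : R) by rewrite ltr0n.
set c := norm_Hm w ^+ 2 / (2 * gamma) + n%:R * (gamma * D ^+ 2 / 2).
have c0 : 0 <= c.
  have g0 := ltW gamma0.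
  apply: addr_ge0; first by apply: divr_ge0; [exact: sqr_ge0|exact: mulr_ge0].
  by apply: mulr_ge0 => //; apply: divr_ge0 => //; apply: mulr_ge0 => //; exact: sqr_ge0.
have c0' : (0 <= c%:E)%E by rewrite lee_fin.
have step1 : (n%:R%:E * EG n <= \sum_(k < n) \int[P]_om G (it k om))%E.
  have nz : (0 <= n%:R%:E :> \bar R)%E by rewrite lee_fin ltW.
  rewrite -(@ge0_integralZl _ _ _ P setT measurableT _ (@measurable_G_mean n) _
    (fun om _ => G_ge0 _) nz).
  rewrite -(@ge0_integral_sum _ _ _ P setT measurableT _ (fun (k : 'I_n) om => G (it k om))
    (fun k => @measurable_G_iterate k) (fun k om _ => G_ge0 _)).
  apply: ge0_ae_integral_mono.
  - by move=> om; rewrite mule_ge0 ?lee_fin ?G_ge0// ltW.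
  - by move=> om; rewrite sume_ge0// => k _; exact: G_ge0.
  by apply: aeW => om; exact: G_jensen.
have step2 : (\sum_(k < n) \int[P]_om G (it k om) <= n%:R%:E * G w + c%:E)%E.
  rewrite (eq_bigr _ (fun (k : 'I_n) _ => esym (integral_Psi_iterate k))).
  rewrite -(@ge0_integral_sum _ _ _ P setT measurableT _
    (fun (k : 'I_n) om => Psi (it k om) (X k om))
    (fun k => @measurable_Psi_iterate k) (fun k om _ => Psi0 _ _)).
  apply: (le_trans (sum_Psi_iterate_le w n)).
  have mPw k : measurable_fun setT (fun om => Psi w (X k om)).
    exact: (measurableT_comp (mPsix w) (measurable_funPT (X k))).
  have mS : measurable_fun setT (fun om => \sum_(k < n) Psi w (X k om))%E.
    by apply: emeasurable_sum => k; exact: mPw.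
  have S0 om : setT om -> (0 <= \sum_(k < n) Psi w (X k om))%E.
    by move=> _; apply: sume_ge0 => k _; exact: Psi0.
  rewrite (@ge0_integralD _ _ _ P setT measurableT _ (cst c%:E)
    S0 mS (fun _ _ => c0') (measurable_cst _)).
  have -> : (\int[P]_om cst c%:E om = c%:E)%E.
    have E : (c%:E * P setT)%E = c%:E by rewrite probability_setT mule1.
    by apply: etrans E; exact: integral_cst.
  rewrite leeD2r//.
  rewrite (@ge0_integral_sum _ _ _ P setT measurableT _ (fun (k : 'I_n) om => Psi w (X k om))
    (fun k => mPw k) (fun k om _ => Psi0 _ _)).
  rewrite (eq_bigr _ (fun (k : 'I_n) _ => integral_Psi_sample w k)).
  have E k : (\sum_(i < k) G w = k%:R%:E * G w)%E.
    elim: k => [|k IH]; first by rewrite big_ord0 mul0e.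
    by rewrite big_ord_recr /= IH -natr1 EFinD ge0_muleDl ?lee_fin// mul1e.
  by rewrite E.
have : (n%:R%:E * EG n <= n%:R%:E * (G w + (c / n%:R)%:E))%E.
  have cn : (0 <= (c / n%:R)%:E)%E by rewrite lee_fin divr_ge0// ltW.
  have -> : (n%:R%:E * (G w + (c / n%:R)%:E) = n%:R%:E * G w + c%:E)%E.
    rewrite (ge0_muleDr _ (G_ge0 w) cn); congr (_ + _)%E.
    by rewrite -[LHS]/((n%:R * (c / n%:R))%:E) mulrC divfK ?gt_eqF.
  exact: le_trans step1 step2.
rewrite lee_pmul2l// => h; apply: (le_trans h); rewrite leeD2l// lee_fin.
rewrite le_eqVlt; apply/orP; left; apply/eqP; rewrite /c.
by field; rewrite !gt_eqF.
Qed.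

End expected_regret.

(** * Integration by parts on the torus *)

Section torus_lipschitz.
Context {R : realType} {d : nat}.
Implicit Types (u v g k phi : 'rV[R]_d -> R) (j : 'I_d).
Local Notation V := (unif d : probability 'rV[R]_d R).
Local Notation e j := (delta_mx 0 j : 'rV[R]_d).

(** Periodic functions with bounded difference quotients that converge
    almost everywhere to [g].  The class contains both the test functions
    and the entries of [B], and it is closed under products, so a product of
    the two can be differentiated on the torus. *)
Definition torus_lip j u g := [/\ continuous u, forall x, u (x + e j) = u x,
  exists M : R, forall x, unit_cube d x -> forall n, `|dquot j u n x| <= M,
  measurable_fun setT g &
  {ae V, forall x, dquot j u n x @[n --> \oo] --> g x}].

Lemma torus_lip_bounded j u g : torus_lip j u g ->
  exists M : R, [/\ 0 <= M, forall x, unit_cube d x -> `|u x| <= M,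
    forall x, unit_cube d x -> forall n, `|dquot j u n x| <= M &
    {ae V, forall x, `|g x| <= M}].
Proof.
move=> [cu _ [M1 uM1] _ ug].
have [M2 M20 uM2] := @continuous_box_bounded R d 0 1 u cu.
exists (Num.max M1 M2); split.
- by rewrite le_max M20 orbT.
- by move=> x cx; rewrite le_max uM2 ?orbT.
- by move=> x cx n; rewrite le_max uM1.
apply: filterS2 unif_cube_ae ug => x cx ux.
rewrite le_max; apply/orP; left.
apply: (ler_cvg_to (cvg_norm ux) (cvg_cst M1)).
by apply: nearW => n; exact: uM1.
Qed.

Lemma dquotM j u v n x : dquot j (fun y => u y * v y) n x =
  dquot j u n x * v x + u x * dquot j v n x + n.+1%:R^-1 * (dquot j u n x * dquot j v n x).
Proof.
rewrite /dquot /quot; set h := n.+1%:R^-1.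
have h0 : h != 0 by rewrite invr_neq0.
set a := u (h *: e j + x); set b := v (h *: e j + x).
by field.
Qed.

Lemma torus_lipM j u g v k : torus_lip j u g -> torus_lip j v k ->
  torus_lip j (fun x => u x * v x) (fun x => g x * v x + u x * k x).
Proof.
move=> tu tv; have [M [M0 uM duM _]] := torus_lip_bounded tu.
have [N [N0 vN dvN _]] := torus_lip_bounded tv.
case: tu tv => [cu pu _ mg ug] [cv pv _ mk vk].
have mu := continuous_measurable_rV cu; have mv := continuous_measurable_rV cv.
split.
- by move=> x; apply: continuousM; [exact: cu|exact: cv].
- by move=> x; rewrite pu pv.
- exists (M * N + M * N + M * N) => x cx n; rewrite dquotM.
  apply: (le_trans (ler_normD _ _)); apply: lerD.
    apply: (le_trans (ler_normD _ _)); rewrite (normrM (dquot j u n x)) (normrM (u x)); apply: lerD.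
      exact: (ler_pM (normr_ge0 _) (normr_ge0 _) (duM x cx n) (vN x cx)).
    exact: (ler_pM (normr_ge0 _) (normr_ge0 _) (uM x cx) (dvN x cx n)).
  rewrite normrM -[M * N]mul1r; apply: ler_pM => //.
    by rewrite ger0_norm// invf_le1// ler1n.
  by rewrite (normrM (dquot j u n x)); exact: (ler_pM (normr_ge0 _) (normr_ge0 _) (duM x cx n) (dvN x cx n)).
- by apply: measurable_realfun.measurable_funD; exact: measurable_realfun.measurable_funM.
apply: filterS2 ug vk => x ux vx.
have -> : (fun n => dquot j (fun y => u y * v y) n x) = (fun n =>
  dquot j u n x * v x + u x * dquot j v n x + n.+1%:R^-1 * (dquot j u n x * dquot j v n x)).
  by apply/funext => n; exact: dquotM.
(* the cross term of the difference quotient of a product carries the factor 1/(n+1) *)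
rewrite -[X in _ --> X]addr0 -[X in _ --> _ + X](mul0r (g x * k x)).
apply: cvgD; last by apply: cvgM; [exact: cvg_harmonic|exact: cvgM].
by apply: cvgD; apply: cvgM => //; exact: cvg_cst.
Qed.

Lemma torus_lip_test j phi : is_Ck 1 phi -> torus_periodic phi ->
  torus_lip j phi (pderiv j phi).
Proof.
move=> [cphi H] pphi; have [dphi [cd _]] := H j.
have [M M0 HM] := @continuous_box_bounded R d (-1) 2 _ cd.
split => //.
- exists M => x cx n; rewrite /dquot /quot.
  have [s sn ->] := line_mvt x n.+1%:R^-1 dphi.
  rewrite mulrA mulVf ?invr_neq0// mul1r; apply: HM => l.
  have : `|s| <= 1 by apply: (le_trans sn); rewrite ger0_norm// invf_le1// ler1n.
  rewrite ler_norml => /andP[c1 c2]; rewrite !mxE eqxx/=; have /andP[x0 x1] := cx l.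
  by case: eqP => _; rewrite ?mulr1 ?mulr0; apply/andP; split; lra.
- exact: continuous_measurable_rV.
by apply: aeW => x; apply: cvg_dquot; exact: dphi.
Qed.

Lemma torus_lip_integrable j u g v k : torus_lip j u g -> torus_lip j v k ->
  V.-integrable setT (EFin \o (fun x => u x * k x)).
Proof.
move=> tu tv; have [M [M0 uM _ _]] := torus_lip_bounded tu.
have [N [N0 _ _ kN]] := torus_lip_bounded tv.
case: tu tv => [cu _ _ _ _] [_ _ _ mk _].
apply: (@ae_bounded_integrable _ _ _ (M * N)).
  by apply: measurable_realfun.measurable_funM => //; exact: continuous_measurable_rV.
apply: filterS2 unif_cube_ae kN => x cx kx; rewrite normrM.
by apply: ler_pM => //; exact: uM.
Qed.

(** The derivative of a product integrates to 0. *)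
Lemma torus_lip_parts j u g v k : torus_lip j u g -> torus_lip j v k ->
  \int[V]_x (u x * k x) = - \int[V]_x (g x * v x).
Proof.
move=> tu tv; apply/eqP; rewrite -addr_eq0; apply/eqP.
have iuk := torus_lip_integrable tu tv.
have igv : V.-integrable setT (EFin \o (fun x => g x * v x)).
  have := torus_lip_integrable tv tu.
  by under [X in V.-integrable setT (EFin \o X)]eq_fun do rewrite mulrC.
have [c p [N HN] mgk ae] := torus_lipM tu tv.
rewrite addrC -RintegralD//.
exact: (integral_dlim0 c p (fun x n cx => HN x cx n) mgk ae).
Qed.

End torus_lipschitz.

(** * Square integrable functions *)

Section square_integrable.
Context {R : realType} {d : nat}.
Implicit Types (u v g phi : 'rV[R]_d -> R).
Local Notation V := (unif d : probability 'rV[R]_d R).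

Lemma L2_measurable u : L2 u -> measurable_fun setT u.
Proof. by rewrite /L2 inE => /andP[+ _]; rewrite inE. Qed.

Let lee12 : (1 <= 2%:E :> \bar R)%E. Proof. by rewrite lee_fin ler1n. Qed.

Lemma L2B u v : L2 u -> L2 v -> L2 (u \- v).
Proof.
have [_ C] := @Lfun_submod_closed _ _ R V 2%:E lee12.
move=> Lu Lv; have := C (-1) v u Lv Lu.
rewrite /L2; have -> // : -1 *: v + u = u \- v.
by apply/funext => x; rewrite -[LHS]/(-1 * v x + u x) mulN1r addrC.
Qed.

Lemma L2D u v : L2 u -> L2 v -> L2 (u \+ v).
Proof.
have [_ C] := @Lfun_submod_closed _ _ R V 2%:E lee12.
move=> Lu Lv; have := C 1 u v Lu Lv.
rewrite /L2; have -> // : 1 *: u + v = u \+ v.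
by apply/funext => x; rewrite -[LHS]/(1 * u x + v x) mul1r.
Qed.

Lemma L2_0 : L2 (fun _ : 'rV[R]_d => 0 : R).
Proof. by have [C _] := @Lfun_submod_closed _ _ R V 2%:E lee12. Qed.

Lemma L2_sum (I : finType) (F : I -> 'rV[R]_d -> R) : (forall i, L2 (F i)) ->
  L2 (fun x => \sum_i F i x).
Proof.
move=> LF; elim: (index_enum I) => [|i s IH].
  by under eq_fun do rewrite big_nil; exact: L2_0.
by under eq_fun do rewrite big_cons; exact: L2D.
Qed.

Lemma L2_integrable u : L2 u -> V.-integrable setT (EFin \o u).
Proof.
move=> Lu; apply/Lfun1_integrable.
have VT : V setT \is a fin_num by rewrite probability_setT.
exact: (Lfun_subset12 VT Lu).
Qed.

Lemma L2M_integrable u v : L2 u -> L2 v -> V.-integrable setT (EFin \o (fun x => u x * v x)).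
Proof. by move=> Lu Lv; apply/Lfun1_integrable; exact: Lfun2_mul_Lfun1. Qed.

Lemma L2M_bounded u phi (M : R) : L2 u -> measurable_fun setT phi ->
  {ae V, forall x, `|phi x| <= M} -> L2 (fun x => u x * phi x).
Proof.
move=> Lu mphi phiM.
have mu := L2_measurable Lu.
rewrite /L2 inE; apply/andP; split; rewrite inE//=; first exact: measurable_realfun.measurable_funM.
have := Lfun2_integrable_sqr Lu.
move=> /(@integrableZl _ _ _ V setT measurableT (M ^+ 2) _) /integrableP[_ h].
rewrite /finite_norm unlock /= poweR_lty//.
apply: le_lt_trans h; apply: ge0_ae_integral_mono => //.
apply: filterS phiM => x px; rewrite lee_fin.
have -> : `|u x * phi x| `^ 2 = phi x ^+ 2 * u x ^+ 2.
  by rewrite powR_mulrn// real_normK ?num_real// exprMn mulrC.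
apply: le_trans (ler_norm _); apply: ler_wpM2r; first exact: sqr_ge0.
rewrite -(real_normK (num_real (phi x))) ler_pXn2r ?nnegrE//.
exact: le_trans px.
Qed.

Lemma L2_hoelder u v : L2 u -> L2 v ->
  (\int[V]_x `|u x * v x|%:E <= L2norm u * L2norm v)%E.
Proof.
move=> Lu Lv.
have := @hoelder _ _ _ V u v 2 2 (L2_measurable Lu) (L2_measurable Lv).
rewrite Lnorm1; apply => //; by rewrite [RHS]splitr !div1r.
Qed.

Lemma L2_norm1 u : L2 u -> (\int[V]_x `|u x|%:E <= L2norm u)%E.
Proof.
move=> Lu.
have L1 : L2 (fun _ : 'rV[R]_d => 1 : R).
  by apply: (@ae_bounded_L2 _ _ _ 1) => //; apply: aeW => x; rewrite normr1.
have := L2_hoelder Lu L1.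
have -> : L2norm (fun _ : 'rV[R]_d => 1 : R) = 1%E.
  have E : (V setT `^ 2^-1 = 1)%E by rewrite probability_setT poweR1r.
  by rewrite -[RHS]E; exact: (@Lnorm_cst1 _ _ R V 2).
by rewrite mule1; under eq_integral do rewrite mulr1.
Qed.

(** The pairing with a bounded function is controlled by the [L^2] norm,
    since the measure has total mass 1. *)
Lemma L2_test_small u phi (M e : R) : L2 u -> (L2norm u < e%:E)%E ->
  measurable_fun setT phi -> 0 <= M -> {ae V, forall x, `|phi x| <= M} ->
  `|\int[V]_x (u x * phi x)| <= M * e.
Proof.
move=> Lu ue mphi M0 phiM.
have iup := L2_integrable (L2M_bounded Lu mphi phiM).
have iu := L2_integrable Lu.
apply: (le_trans (le_normr_Rintegral _ iup)) => //.
rewrite -lee_fin /Rintegral fineK; last first.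
  by apply: integrable_fin_num => //; exact: (integrable_norm iup).
apply: (@le_trans _ _ (\int[V]_x (M%:E * `|u x|%:E))%E).
  apply: ge0_ae_integral_mono.
  - by move=> x; rewrite lee_fin.
  - by move=> x; rewrite mule_ge0// lee_fin.
  by apply: filterS phiM => x px; rewrite -EFinM lee_fin normrM mulrC ler_wpM2r.
have mnu : measurable_fun setT (fun x => `|u x|%:E).
  by apply/measurable_EFinP; apply: measurableT_comp => //; exact: L2_measurable.
rewrite (@ge0_integralZl _ _ _ V setT measurableT _ mnu M%:E) ?lee_fin// EFinM.
apply: lee_wpmul2l; first by rewrite lee_fin.
exact: (le_trans (L2_norm1 Lu) (ltW ue)).
Qed.

End square_integrable.

(** * Weak derivatives *)

Section weak_derivatives.
Context {R : realType} {d : nat} {H : completeNormedModType R}.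
Variables (ip : {dot H for idfun}) (ev : H -> 'rV[R]_d -> R)
  (K : 'rV[R]_d -> 'rV[R]_d -> R).
Hypothesis rk : is_rkhs ip ev K.
Hypothesis KC2 : is_Ck 2 (fun z : 'rV[R]_(d + d) => K (lsubmx z) (rsubmx z)).
Hypothesis dL2 : dense_L2 ev.
Implicit Types (u v g k phi psi : 'rV[R]_d -> R) (j : 'I_d) (h : H).
Local Notation V := (unif d : probability 'rV[R]_d R).

Lemma continuous_L2 u : continuous u -> L2 u.
Proof.
move=> cu; have [M M0 hM] := @continuous_box_bounded R d 0 1 u cu.
apply: (@ae_bounded_L2 _ _ _ M); first exact: continuous_measurable_rV.
by apply: filterS unif_cube_ae => x cx; exact: hM.
Qed.

Let L2_ev h : L2 (ev h). Proof. by apply: continuous_L2; exact: (continuous_ev rk KC2). Qed.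
Let L2_dev j h : L2 (pderiv j (ev h)).
Proof. by apply: continuous_L2; exact: (continuous_pderiv_ev rk KC2). Qed.
Let ev_lip j h : torus_lip j (ev h) (pderiv j (ev h)).
Proof. by apply: torus_lip_test; [exact: (rkhs_C1 rk KC2)|exact: (rkhs_periodic rk)]. Qed.

(** Approximating [u] by [ev h] gives [int u^2 = int u (u - ev h)], which is
    small by Cauchy-Schwarz. *)
Lemma L2_ae_eq0 u : L2 u -> (forall h, \int[V]_x (u x * ev h x) = 0) ->
  {ae V, forall x, u x = 0}.
Proof.
move=> Lu u0; have mu := L2_measurable Lu.
have iuu := L2M_integrable Lu Lu.
have [n un] : exists n : R, L2norm u = n%:E.
  exists (fine (L2norm u)); rewrite fineK// ge0_fin_numE ?Lnorm_ge0//.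
  by move: Lu; rewrite /L2 inE => /andP[_]; rewrite inE.
have n0 : 0 <= n by rewrite -lee_fin -un Lnorm_ge0.
have small (e : R) : 0 < e -> \int[V]_x (u x * u x) <= n * e.
  move=> e0; have [h [_ he]] := dL2 Lu e0.
  have Ld := L2B Lu (L2_ev h).
  have -> : \int[V]_x (u x * u x) = \int[V]_x (u x * (u x - ev h x)).
    rewrite -[LHS]subr0 -(u0 h) -RintegralB//; last exact: L2M_integrable.
    by apply: eq_Rintegral => x _; rewrite mulrBr.
  apply: (le_trans (ler_norm _)).
  have iud := L2M_integrable Lu Ld.
  apply: (le_trans (le_normr_Rintegral measurableT iud)).
  rewrite -lee_fin /Rintegral fineK; last first.
    by apply: integrable_fin_num => //; exact: (integrable_norm iud).
  apply: (le_trans (L2_hoelder Lu Ld)); rewrite un EFinM.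
  by apply: lee_wpmul2l; [rewrite lee_fin|exact: ltW].
have I0 : \int[V]_x (u x * u x) = 0.
  apply/eqP; rewrite eq_le; apply/andP; split; last first.
    by apply: Rintegral_ge0 => x _; rewrite -expr2 sqr_ge0.
  apply/ler_addgt0Pl => e e0; rewrite addr0.
  have n1 : 0 < n + 1 by rewrite ltr_wpDl.
  apply: (le_trans (small (e / (n + 1)) _)); first by rewrite divr_gt0.
  by rewrite mulrCA ger_pMr// ler_pdivrMr// mul1r lerDl.
have E0 : (\int[V]_x `|(u x * u x)%:E| = 0)%E.
  transitivity (\int[V]_x (u x * u x)%:E)%E.
    by apply: eq_integral => x _; rewrite gee0_abs// lee_fin -expr2 sqr_ge0.
  rewrite -[LHS]fineK; last exact: integrable_fin_num.
  by rewrite -[X in _ = X%:E]I0.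
have muu : measurable_fun setT (fun x => (u x * u x)%:E).
  by apply/measurable_EFinP; exact: measurable_realfun.measurable_funM.
have := (@ae_eq_integral_abs _ _ _ V setT measurableT _ muu).1 E0.
apply: filterS => x /(_ I)[] /eqP; rewrite mulf_eq0 => /orP[] /eqP //.
Qed.

(** The functions [ev h] are admissible test functions and are dense. *)
Lemma is_wpartial_unique j u g k : L2 g -> L2 k -> is_wpartial j u g -> is_wpartial j u k ->
  {ae V, forall x, g x = k x}.
Proof.
move=> Lg Lk ug uk.
have := @L2_ae_eq0 _ (L2B Lg Lk) _.
have Z h : \int[V]_x ((g \- k) x * ev h x) = 0.
  transitivity (\int[V]_x (g x * ev h x - k x * ev h x)).
    by apply: eq_Rintegral => x _; rewrite -mulrBl.
  rewrite RintegralB//; try exact: L2M_integrable.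
  have c1 := rkhs_C1 rk KC2 h; have p1 := rkhs_periodic rk h.
  by apply/eqP; rewrite subr_eq0 -eqr_opp -(ug _ c1 p1) -(uk _ c1 p1).
move=> /(_ Z); apply: filterS => x /eqP; rewrite subr_eq0 => /eqP //.
Qed.

Lemma is_wdiv_unique (v : 'rV[R]_d -> 'cV[R]_d) g k : L2 g -> L2 k ->
  is_wdiv v g -> is_wdiv v k -> {ae V, forall x, g x = k x}.
Proof.
move=> Lg Lk ug uk.
have := @L2_ae_eq0 _ (L2B Lg Lk) _.
have Z h : \int[V]_x ((g \- k) x * ev h x) = 0.
  transitivity (\int[V]_x (g x * ev h x - k x * ev h x)).
    by apply: eq_Rintegral => x _; rewrite -mulrBl.
  rewrite RintegralB//; try exact: L2M_integrable.
  have c1 := rkhs_C1 rk KC2 h; have p1 := rkhs_periodic rk h.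
  by apply/eqP; rewrite subr_eq0 -eqr_opp -(ug _ c1 p1) -(uk _ c1 p1).
move=> /(_ Z); apply: filterS => x /eqP; rewrite subr_eq0 => /eqP //.
Qed.

Lemma wpartialP j u : H1 u -> L2 (wpartial j u) /\ is_wpartial j u (wpartial j u).
Proof. by move=> [_ /(_ j) ex]; exact: (xgetPex (cst 0) ex). Qed.

Lemma is_wpartial_ev j h : is_wpartial j (ev h) (pderiv j (ev h)).
Proof.
by move=> phi c1 p1; exact: (torus_lip_parts (ev_lip j h) (torus_lip_test j c1 p1)).
Qed.

Lemma H1_ev h : H1 (ev h).
Proof. by split => // j; exists (pderiv j (ev h)); split; [|exact: is_wpartial_ev]. Qed.

Lemma wpartial_ev j h : {ae V, forall x, wpartial j (ev h) x = pderiv j (ev h) x}.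
Proof.
have [Lw Iw] := wpartialP j (H1_ev h).
exact: is_wpartial_unique Lw (L2_dev j h) Iw (is_wpartial_ev j h).
Qed.

Lemma L2norm_ae_eq g k : measurable_fun setT g -> measurable_fun setT k ->
  {ae V, forall x, g x = k x} -> L2norm g = L2norm k.
Proof.
move=> mg mk gk; rewrite /L2norm Lnorm.unlock; congr (poweR _ 2^-1).
apply: ge0_ae_eq_integral_nomeas; [by move=> x; exact: poweR_ge0..|].
by apply: filterS gk => x /= ->.
Qed.

Lemma is_wpartialB j u v g k : L2 u -> L2 v -> L2 g -> L2 k ->
  is_wpartial j u g -> is_wpartial j v k -> is_wpartial j (u \- v) (g \- k).
Proof.
move=> Lu Lv Lg Lk ug vk phi c1 p1.
have L2phi : L2 phi by apply: continuous_L2; case: c1.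
have L2dphi : L2 (pderiv j phi) by apply: continuous_L2; case: c1 => _ /(_ j)[_ []].
transitivity (\int[V]_x (u x * pderiv j phi x - v x * pderiv j phi x)).
  by apply: eq_Rintegral => x _; rewrite -mulrBl.
transitivity (- \int[V]_x (g x * phi x - k x * phi x)); last first.
  by congr (- _); apply: eq_Rintegral => x _; rewrite -mulrBl.
rewrite RintegralB//; try exact: L2M_integrable.
rewrite RintegralB//; try exact: L2M_integrable.
by rewrite (ug _ c1 p1) (vk _ c1 p1) opprD.
Qed.

Lemma L2norm_lt_H1 u (e : R) : (H1norm u < e%:E)%E ->
  (L2norm u < e%:E)%E /\ forall j, (L2norm (wpartial j u) < e%:E)%E.
Proof.
have a0 v : (0 <= L2norm v)%E by exact: Lnorm_ge0.
have P0 v : (0 <= L2norm v `^ 2)%E by exact: poweR_ge0.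
have S0 : (0 <= \sum_(j < d) L2norm (wpartial j u) `^ 2)%E by exact: sume_ge0.
have key v : (L2norm v `^ 2 <= L2norm u `^ 2 + \sum_(j < d) L2norm (wpartial j u) `^ 2)%E ->
    (L2norm v <= H1norm u)%E.
  move=> h; have -> : L2norm v = ((L2norm v `^ 2) `^ 2^-1)%E.
    by rewrite -poweRrM mulfV ?pnatr_eq0// poweRe1.
  by apply: gt0_ler_poweR h; rewrite ?invr_ge0// in_itv/= leey ?andbT ?adde_ge0.
move=> ue; split.
  by apply: le_lt_trans ue; apply: key; rewrite leeDl.
move=> j; apply: le_lt_trans ue; apply: key.
rewrite (bigD1 j)//= addeCA leeDl// adde_ge0// sume_ge0//.
Qed.

(** Stated with the classical derivatives of [ev h], which are its weak
    ones. *)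
Lemma H1_approx u (e : R) : dense_H1 ev -> H1 u -> 0 < e ->
  exists h, (L2norm (u \- ev h)%R < e%:E)%E /\
    forall j, (L2norm (wpartial j u \- pderiv j (ev h))%R < e%:E)%E.
Proof.
move=> dH1 Hu e0; have [h [_ he]] := dH1 u Hu e e0.
exists h; have [he1 he2] := L2norm_lt_H1 he; split => // j.
have [Lw Iw] := wpartialP j Hu.
have Iwd := is_wpartialB (proj1 Hu) (L2_ev h) Lw (L2_dev j h) Iw (is_wpartial_ev j h).
have Ld := L2B Lw (L2_dev j h).
have Hd : H1 (u \- ev h).
  split; first exact: L2B (proj1 Hu) (L2_ev h).
  move=> i; have [Lwi Iwi] := wpartialP i Hu.
  exists (wpartial i u \- pderiv i (ev h)); split; first exact: L2B.
  exact: is_wpartialB (proj1 Hu) (L2_ev h) Lwi (L2_dev i h) Iwi (is_wpartial_ev i h).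
have [Lx Ix] := wpartialP j Hd.
rewrite (L2norm_ae_eq (L2_measurable Ld) (L2_measurable Lx))//.
exact: is_wpartial_unique Ld Lx Iwd Ix.
Qed.

(** A Lipschitz function is a legitimate multiplier in a weak derivative:
    this holds for [u = ev h] classically, and both sides are continuous in
    the [H^1] norm. *)
Lemma H1_parts j u psi g : dense_H1 ev -> H1 u -> torus_lip j psi g ->
  \int[V]_x (u x * g x) = - \int[V]_x (wpartial j u x * psi x).
Proof.
move=> dH1 Hu tpsi; have [M [M0 psiM _ gM]] := torus_lip_bounded tpsi.
have [Lw Iw] := wpartialP j Hu; have Lu := proj1 Hu.
have [cpsi _ _ mg _] := tpsi.
have mpsi := continuous_measurable_rV cpsi.
have {}psiM : {ae V, forall x, `|psi x| <= M}.
  by apply: filterS unif_cube_ae => x cx; exact: psiM.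
have Lpsi : L2 psi by exact: continuous_L2.
have Lg : L2 g by exact: ae_bounded_L2 mg gM.
apply/eqP; rewrite -subr_eq0 opprK; set A := _ + _.
have small (e : R) : 0 < e -> `|A| <= 2 * M * e.
  move=> e0; have [h [h1 h2]] := H1_approx dH1 Hu e0.
  have -> : A = \int[V]_x ((u \- ev h) x * g x) +
      \int[V]_x ((wpartial j u \- pderiv j (ev h)) x * psi x).
    have -> : \int[V]_x ((u \- ev h) x * g x) =
        \int[V]_x (u x * g x) - \int[V]_x (ev h x * g x).
      rewrite -RintegralB//; try exact: L2M_integrable.
      by apply: eq_Rintegral => x _; rewrite -mulrBl.
    have -> : \int[V]_x ((wpartial j u \- pderiv j (ev h)) x * psi x) =
        \int[V]_x (wpartial j u x * psi x) - \int[V]_x (pderiv j (ev h) x * psi x).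
      rewrite -RintegralB//; try exact: L2M_integrable.
      by apply: eq_Rintegral => x _; rewrite -mulrBl.
    by rewrite (torus_lip_parts (ev_lip j h) tpsi) /A; ring.
  apply: (le_trans (ler_normD _ _)).
  have -> : 2 * M * e = M * e + M * e by ring.
  apply: lerD.
    exact: (L2_test_small (L2B Lu (L2_ev h)) h1 mg M0 gM).
  exact: (L2_test_small (L2B Lw (L2_dev j h)) (h2 j) mpsi M0 psiM).
rewrite -normr_le0; apply/ler_addgt0Pl => e e0; rewrite addr0.
have n1 : 0 < 2 * M + 1 by rewrite ltr_wpDl// mulr_ge0.
apply: (le_trans (small (e / (2 * M + 1)) _)); first by rewrite divr_gt0.
by rewrite mulrCA ger_pMr// ler_pdivrMr// mul1r lerDl.
Qed.

End weak_derivatives.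

(** * The objective on Sobolev functions *)

Section integral_sums.
Context {R : realType} {d : nat}.
Local Notation V := (unif d : probability 'rV[R]_d R).

Lemma Rintegral_sum (I : finType) (F : I -> 'rV[R]_d -> R) :
  (forall i, V.-integrable setT (EFin \o F i)) ->
  V.-integrable setT (EFin \o (fun x => \sum_i F i x)) /\
  \int[V]_x (\sum_i F i x) = \sum_i \int[V]_x (F i x).
Proof.
move=> iF; elim: (index_enum I) => [|i s [IH1 IH2]].
  rewrite big_nil; split.
    have -> : (fun x => \sum_(i <- [::]) F i x) = cst 0.
      by apply/funext => x; rewrite big_nil.
    have c0 : continuous (cst 0 : 'rV[R]_d -> R) by exact: cst_continuous.
    exact (continuous_integrable c0).
  under eq_Rintegral do rewrite big_nil.
  by rewrite /Rintegral integral0.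
rewrite big_cons; split.
  have -> : (fun x => \sum_(i <- i :: s) F i x) = (fun x => F i x + \sum_(i <- s) F i x).
    by apply/funext => x; rewrite big_cons.
  have := integrableD measurableT (iF i) IH1.
  by apply: eq_integrable => // x _; rewrite /= EFinD.
by under eq_Rintegral do rewrite big_cons; rewrite RintegralD// IH2.
Qed.

End integral_sums.

Section sobolev_objective.
Context {R : realType} {d m : nat} {H : completeNormedModType R}.
Variables (q rho C_V : R) (f : 'rV[R]_d -> R) (B : 'rV[R]_d -> 'M[R]_(d, m))
  (mu0 : 'rV[R]_d -> R).
Hypotheses (q1 : 1 < q) (rho0 : 0 < rho) (f0 : forall x, 0 <= f x)
  (fC : forall x, f x <= C_V) (cf : continuous f) (lipB : lipschitz B)
  (perB : torus_periodic B)
  (mmu0 : measurable_fun setT mu0).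
Variables (ip : {dot H for idfun}) (ev : H -> 'rV[R]_d -> R)
  (K : 'rV[R]_d -> 'rV[R]_d -> R).
Hypothesis rk : is_rkhs ip ev K.
Hypothesis KC2 : is_Ck 2 (fun z : 'rV[R]_(d + d) => K (lsubmx z) (rsubmx z)).
Hypotheses (dL2 : dense_L2 ev) (dH1 : dense_H1 ev).
Local Notation V := (unif d : probability 'rV[R]_d R).
Local Notation G := (Gfun q rho C_V f B mu0 cdiv).
Local Notation G_H1 := (Gfun q rho C_V f B mu0 wdiv).
Local Notation Phi := (Phi q rho C_V f B mu0).
Local Notation wp w := (fun x (i : 'I_m) (j : 'I_d) => wpartial j (fun y => w y i 0) x).
Implicit Types (w : 'rV[R]_d -> 'cV[R]_m).

Lemma torus_lip_B j i : torus_lip j (fun y => B y j i) (Bderiv B j i).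
Proof.
have [L L0 BL] := dquot_B_bound lipB.
split.
- exact: continuous_Bentry.
- by move=> x; rewrite perB.
- by exists L => x _ n; exact: BL.
- exact: measurable_Bderiv.
apply: filterS (ae_good_point lipB) => x [_ gx].
by rewrite /Bderiv dlimE//; exact: cvg_dquot.
Qed.

(** Testing with [B_ji phi], which is only Lipschitz, gives the product rule
    for the weak divergence; uniqueness identifies it. *)
Lemma wdiv_B w : (forall i, H1 (fun x => w x i 0)) ->
  {ae V, forall x, wdiv (fun y => B y *m w y) x =
    wdivE B (fun i => w x i 0) (wp w x) x}.
Proof.
move=> Hw; pose wi i x := w x i 0; pose p i j := wpartial j (wi i).
have Lw i : L2 (wi i) := proj1 (Hw i).
have Lp i j : L2 (p i j) := proj1 (wpartialP j (Hw i)).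
pose D x := wdivE B (fun i => w x i 0) (wp w x) x.
have LF j i : L2 (fun x => p i j x * B x j i + wi i x * Bderiv B j i x).
  have [M [M0 BM _ bM]] := torus_lip_bounded (torus_lip_B j i).
  have [cB _ _ mB _] := torus_lip_B j i.
  have mBe := continuous_measurable_rV cB.
  apply: L2D; last exact: (L2M_bounded (Lw i) mB bM).
  apply: (L2M_bounded (Lp i j) mBe (M := M)).
  by apply: filterS unif_cube_ae => x cx; exact: BM.
have LD : L2 D by apply: L2_sum => j; apply: L2_sum => i; exact: LF.
have DD : is_wdiv (fun y => B y *m w y) D.
  move=> phi c1 p1.
  have cphi : continuous phi by case: c1.
  have Lphi := continuous_L2 cphi.
  have tphi j := torus_lip_test j c1 p1.
  have tpsi j i := torus_lipM (torus_lip_B j i) (tphi j).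
  have cBd j i : continuous (fun x => B x j i * pderiv j phi x).
    have [cB _ _ _ _] := torus_lip_B j i.
    have cd : continuous (pderiv j phi) by case: c1 => _ /(_ j)[_ []].
    by move=> x; apply: continuousM; [exact: cB|exact: cd].
  have i1 j i : V.-integrable setT (EFin \o (fun x => wi i x * (B x j i * pderiv j phi x))).
    by apply: L2M_integrable => //; exact: continuous_L2.
  have i2 j i : V.-integrable setT (EFin \o (fun x =>
      (p i j x * B x j i + wi i x * Bderiv B j i x) * phi x)).
    by apply: L2M_integrable.
  have s1 j := Rintegral_sum (i1 j).
  have s2 j := Rintegral_sum (i2 j).
  have e1 := (Rintegral_sum (fun j => (s1 j).1)).2.
  have e2 := (Rintegral_sum (fun j => (s2 j).1)).2.
  transitivity (\sum_j \sum_i \int[V]_x (wi i x * (B x j i * pderiv j phi x))).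
    rewrite -(eq_bigr _ (fun j _ => (s1 j).2)) -e1.
    apply: eq_Rintegral => x _; apply: eq_bigr => j _.
    by rewrite mxE big_distrl/=; apply: eq_bigr => i _; rewrite /wi; ring.
  transitivity (- \sum_j \sum_i \int[V]_x
      ((p i j x * B x j i + wi i x * Bderiv B j i x) * phi x)); last first.
    congr (- _); rewrite -(eq_bigr _ (fun j _ => (s2 j).2)) -e2.
    apply: eq_Rintegral => x _; rewrite /D /wdivE big_distrl/=; apply: eq_bigr => j _.
    by rewrite big_distrl.
  rewrite -sumrN; apply: eq_bigr => j _; rewrite -sumrN; apply: eq_bigr => i _.
  have [M [M0 BM _ bM]] := torus_lip_bounded (torus_lip_B j i).
  have [cB _ _ mB _] := torus_lip_B j i.
  have Lb : L2 (Bderiv B j i) by exact: ae_bounded_L2 mB bM.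
  have mphi := continuous_measurable_rV cphi.
  have [N [N0 phiN _ _]] := torus_lip_bounded (tphi j).
  have aphi : {ae V, forall x, `|phi x| <= N}.
    by apply: filterS unif_cube_ae => x cx; exact: phiN.
  have i3 : V.-integrable setT (EFin \o (fun x => wi i x * (Bderiv B j i x * phi x))).
    by apply: L2M_integrable => //; exact: L2M_bounded mphi aphi.
  have := H1_parts rk KC2 dL2 dH1 (Hw i) (tpsi j i).
  have -> : \int[V]_x (wi i x * (Bderiv B j i x * phi x + B x j i * pderiv j phi x)) =
    \int[V]_x (wi i x * (Bderiv B j i x * phi x)) +
    \int[V]_x (wi i x * (B x j i * pderiv j phi x)).
    by rewrite -RintegralD//; apply: eq_Rintegral => x _; rewrite mulrDr.
  have -> : \int[V]_x ((p i j x * B x j i + wi i x * Bderiv B j i x) * phi x) =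
    \int[V]_x (p i j x * (B x j i * phi x)) +
    \int[V]_x (wi i x * (Bderiv B j i x * phi x)).
    rewrite -RintegralD//; first by apply: eq_Rintegral => x _; ring.
    apply: L2M_integrable => //; apply: continuous_L2 => x.
    by apply: continuousM; [exact: cB|exact: cphi].
  move=> E; apply/eqP; rewrite opprD -E; apply/eqP.
  by rewrite addrAC subrr add0r.
have ex : exists g, L2 g /\ is_wdiv (fun y => B y *m w y) g by exists D.
have [Lx Ix] : L2 (wdiv (fun y => B y *m w y)) /\
    is_wdiv (fun y => B y *m w y) (wdiv (fun y => B y *m w y)).
  exact: (xgetPex (cst 0) ex).
exact: (is_wdiv_unique rk KC2 dL2 Lx LD Ix DD).
Qed.

Lemma G_H1_Phi w : (forall i, H1 (fun x => w x i 0)) ->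
  G_H1 w = (\int[V]_x Phi (fun i => w x i 0%R) (wp w x) x)%E.
Proof.
move=> Hw; apply: ge0_ae_eq_integral_nomeas.
- by move=> x; exact: (Gamma_ge0 rho B mu0 q1 f0 fC).
- by move=> x; exact: (Phi_ge0 rho B mu0 q1 f0 fC).
apply: filterS (wdiv_B Hw) => x Dx.
rewrite /Gamma Dx -[RHS]/(Lval q (f x) C_V (norm2 (\col_i w x i 0))
  (mu0 x - rho^-1 * wdivE B (fun i => w x i 0) (wp w x) x)).
have -> : \col_i w x i 0 = w x by apply/colP => i; rewrite mxE.
by [].
Qed.

Let ev_HmE (h : 'I_m -> H) i : (fun x => ev_Hm ev h x i 0) = ev (h i).
Proof. by apply/funext => x; rewrite /ev_Hm mxE. Qed.

Lemma H1_ev_Hm (h : 'I_m -> H) i : H1 (fun x => ev_Hm ev h x i 0).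
Proof. by rewrite ev_HmE; exact: (H1_ev rk KC2). Qed.

Lemma G_H1_ev (h : 'I_m -> H) : G_H1 (ev_Hm ev h) = G (ev_Hm ev h).
Proof.
rewrite (G_H1_Phi (H1_ev_Hm h)) (G_Psi rho mu0 q1 f0 fC lipB rk KC2).
apply: ge0_ae_eq_integral_nomeas.
- by move=> x; exact: (Phi_ge0 rho B mu0 q1 f0 fC).
- by move=> x; exact: (Psi_ge0 rho B mu0 q1 f0 fC).
have A : {ae V, forall x, forall i j, wpartial j (ev (h i)) x = pderiv j (ev (h i)) x}.
  by apply: filter_forall => i; apply: filter_forall => j; exact: (wpartial_ev rk KC2 dL2).
apply: filterS A => x Ax; rewrite /Psi.
have -> : (fun i => ev_Hm ev h x i 0) = (fun i => ev (h i) x).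
  by apply/funext => i; rewrite mxE.
have -> : wp (ev_Hm ev h) x = (fun i j => pderiv j (ev (h i)) x).
  by apply/funext => i; apply/funext => j; rewrite ev_HmE.
by [].
Qed.

Lemma integral_wsize_le (a : 'I_m -> 'rV[R]_d -> R) (b : 'I_m -> 'I_d -> 'rV[R]_d -> R)
    (e : R) :
  (forall i, measurable_fun setT (a i)) -> (forall i j, measurable_fun setT (b i j)) ->
  (forall i, (\int[V]_x `|a i x|%:E <= e%:E)%E) ->
  (forall i j, (\int[V]_x `|b i j x|%:E <= e%:E)%E) ->
  (\int[V]_x (wsize (a ^~ x) (fun i j => b i j x))%:E <= (\sum_(i < m) e + \sum_(i < m) \sum_(j < d) e)%:E)%E.
Proof.
move=> ma mb ae be.
have mna i : measurable_fun setT (fun x => `|a i x|%:E).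
  by apply/measurable_EFinP; apply: measurableT_comp.
have mnb i j : measurable_fun setT (fun x => `|b i j x|%:E).
  by apply/measurable_EFinP; apply: measurableT_comp.
have n0 (y : R) : (0 <= `|y|%:E)%E by rewrite lee_fin.
have msb i : measurable_fun setT (fun x => \sum_j `|b i j x|%:E)%E.
  by apply: emeasurable_sum => j.
have sb0 i x : (0 <= \sum_j `|b i j x|%:E)%E by apply: sume_ge0.
apply: (@le_trans _ _ (\int[V]_x (\sum_i `|a i x|%:E + \sum_i \sum_j `|b i j x|%:E))%E).
  rewrite le_eqVlt; apply/orP; left; apply/eqP; apply: eq_integral => x _.
  rewrite /wsize EFinD -!sumEFin; congr (_ + _)%E.
  by apply: eq_bigr => i _; rewrite -sumEFin.
have m1 : measurable_fun setT (fun x => \sum_i `|a i x|%:E)%E by apply: emeasurable_sum.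
have m2 : measurable_fun setT (fun x => \sum_i \sum_j `|b i j x|%:E)%E.
  by apply: emeasurable_sum.
have p1 x : setT x -> (0 <= \sum_i `|a i x|%:E)%E by move=> _; exact: sume_ge0.
have p2 x : setT x -> (0 <= \sum_i \sum_j `|b i j x|%:E)%E by move=> _; exact: sume_ge0.
rewrite (@ge0_integralD _ _ _ V setT measurableT _ _ p1 m1 p2 m2).
rewrite (@ge0_integral_sum _ _ _ V setT measurableT _ _ mna (fun i x _ => n0 (a i x))).
rewrite (@ge0_integral_sum _ _ _ V setT measurableT _ _ msb (fun i x _ => sb0 i x)).
rewrite EFinD -!sumEFin; apply: leeD; apply: lee_sum => i _; first exact: ae.
rewrite (@ge0_integral_sum _ _ _ V setT measurableT _ _ (mnb i) (fun j x _ => n0 (b i j x))).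
by apply: lee_sum => j _; exact: be.
Qed.

(** [G] is Lipschitz for the [H^1] norm, as [Phi] is Lipschitz in values and
    derivatives. *)
Lemma G_approx w (eps : R) : (forall i, H1 (fun x => w x i 0)) -> 0 < eps ->
  exists h : 'I_m -> H, (G (ev_Hm ev h) <= G_H1 w + eps%:E)%E.
Proof.
move=> Hw eps0; have [C C0 HC] := Phi_lipschitz mu0 q1 rho0 f0 fC lipB.
pose k : R := \sum_(i < m) 1 + \sum_(i < m) \sum_(j < d) 1.
have k0 : 0 <= k by rewrite addr_ge0// sumr_ge0// => i _; rewrite sumr_ge0.
have D0 : 0 < C * k + 1 by rewrite ltr_wpDl// mulr_ge0.
pose e := eps / (C * k + 1).
have e0 : 0 < e by rewrite divr_gt0.
have /choice[h hP] i := H1_approx rk KC2 dL2 dH1 (Hw i) e0.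
exists h.
have Lw i := proj1 (Hw i).
have Lp i j := proj1 (wpartialP j (Hw i)).
have Le i : L2 (ev (h i)) by apply: continuous_L2; exact: (continuous_ev rk KC2).
have Ld i j : L2 (pderiv j (ev (h i))).
  by apply: continuous_L2; exact: (continuous_pderiv_ev rk KC2).
pose a i x := ev (h i) x - w x i 0.
pose b i j x := pderiv j (ev (h i)) x - wpartial j (fun y => w y i 0) x.
have La i : L2 (a i) by exact: L2B (Le i) (Lw i).
have Lb i j : L2 (b i j) by exact: L2B (Ld i j) (Lp i j).
have small u v : L2 u -> L2 v -> (L2norm (u \- v)%R < e%:E)%E ->
    (\int[V]_x `|v x - u x|%:E <= e%:E)%E.
  move=> Lu Lv /ltW; apply: le_trans; apply: le_trans (L2_norm1 (L2B Lu Lv)).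
  rewrite le_eqVlt; apply/orP; left; apply/eqP; apply: eq_integral => x _.
  by rewrite distrC.
have ws := integral_wsize_le (fun i => L2_measurable (La i))
  (fun i j => L2_measurable (Lb i j))
  (fun i => small _ _ (Lw i) (Le i) (hP i).1)
  (fun i j => small _ _ (Lp i j) (Ld i j) ((hP i).2 j)).
rewrite (G_Psi rho mu0 q1 f0 fC lipB rk KC2) (G_H1_Phi Hw).
pose F x := Phi (fun i => w x i 0) (wp w x) x.
pose S x := wsize (a ^~ x) (fun i j => b i j x).
have F0 x : setT x -> (0 <= F x)%E by move=> _; exact: (Phi_ge0 rho B mu0 q1 f0 fC).
have S0 x : setT x -> (0 <= (S x)%:E)%E.
  move=> _; rewrite lee_fin addr_ge0// sumr_ge0// => i _; by rewrite sumr_ge0.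
have mF : measurable_fun setT F.
  apply: (measurable_Phi rho q1 f0 fC cf lipB mmu0) => //.
    by move=> i; exact: L2_measurable (Lw i).
  by move=> i j; exact: L2_measurable (Lp i j).
have mS : measurable_fun setT (fun x => (S x)%:E).
  apply/measurable_EFinP; apply: measurable_realfun.measurable_funD.
    by apply: measurable_sum => i; apply: measurableT_comp => //; exact: L2_measurable (La i).
  apply: measurable_sum => i; apply: measurable_sum => j.
  by apply: measurableT_comp => //; exact: L2_measurable (Lb i j).
have C0' : (0 <= C%:E)%E by rewrite lee_fin.
have mCS : measurable_fun setT (fun x => C%:E * (S x)%:E)%E.
  by apply: emeasurable_funM.
have CS0 x : setT x -> (0 <= C%:E * (S x)%:E)%E by move=> /S0 ?; exact: mule_ge0.
apply: (@le_trans _ _ (\int[V]_x (F x + C%:E * (S x)%:E))%E).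
  apply: ge0_ae_integral_mono.
  - by move=> x; exact: (Psi_ge0 rho B mu0 q1 f0 fC).
  - by move=> x; apply: adde_ge0; [exact: F0|exact: CS0].
  apply: filterS (ae_good_point lipB) => x gx.
  by rewrite -EFinM; exact: (HC x gx).
rewrite (@ge0_integralD _ _ _ V setT measurableT _ _ F0 mF CS0 mCS) leeD2l//.
rewrite (@ge0_integralZl _ _ _ V setT measurableT _ mS _ S0 C0').
apply: (le_trans (lee_wpmul2l C0' ws)); rewrite -EFinM lee_fin.
have -> : \sum_(i < m) e + \sum_(i < m) \sum_(j < d) e = k * e.
  have E l : \sum_(i < l) e = (\sum_(i < l) 1) * e.
    by rewrite big_distrl/=; apply: eq_bigr => i _; rewrite mul1r.
  by rewrite /k mulrDl -E (big_distrl e)/=; congr (_ + _); apply: eq_bigr => i _; exact: E.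
have -> : C * (k * e) = eps * (C * k / (C * k + 1)) by rewrite /e; field; rewrite gt_eqF.
by rewrite ger_pMr// ler_pdivrMr// mul1r lerDl.
Qed.

End sobolev_objective.

(** * Infimum and limit *)

Section limit.
Context {R : realType}.

(** The minimizing point [w] is fixed first; the term in [n] vanishes
    afterwards. *)
Lemma cvg_ereal_inf (T : Type) (g : T -> \bar R) (u : nat -> \bar R) :
  ereal_inf [set g w | w in setT] \is a fin_num ->
  (forall n, (ereal_inf [set g w | w in setT] <= u n)%E) ->
  (forall w, exists c : R, forall n, (0 < n)%N -> (u n <= g w + (c / Num.sqrt n%:R)%:E)%E) ->
  u n @[n --> \oo] --> ereal_inf [set g w | w in setT].
Proof.
set I := ereal_inf _ => If Iu ub.
have [r IE] : exists r, I = r%:E by exists (fine I); rewrite fineK.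
have near_small (eps : R) : 0 < eps -> \forall n \near \oo, u n \is a fin_num /\ `|r - fine (u n)| <= eps.
  move=> eps0; have e2 : 0 < eps / 2 by rewrite divr_gt0.
  have [_ [w _ <-] gw] := lb_ereal_inf_adherent e2 If.
  have gI : (I <= g w)%E by apply: ereal_inf_lbound; exists w.
  have gf : g w \is a fin_num.
    apply/fin_real/andP; split; first by apply: lt_le_trans gI; rewrite IE ltNyr.
    by apply: (lt_trans gw); rewrite -/I IE -EFinD ltry.
  have [c hc] := ub w.
  near=> n.
  have n1 : 1 <= (n%:R : R) by near: n; exact: nbhs_infty_ger.
  (* makes [c / sqrt n <= eps / 2] *)
  have nc : (c / (eps / 2)) ^+ 2 <= (n%:R : R) by near: n; exact: nbhs_infty_ger.
  have sn : 0 < Num.sqrt (n%:R : R) by rewrite sqrtr_gt0 (lt_le_trans ltr01).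
  have cs : c / Num.sqrt n%:R <= eps / 2.
    rewrite ler_pdivrMr// mulrC -ler_pdivrMr//.
    apply: (le_trans (ler_norm _)); rewrite -sqrtr_sqr.
    exact: ler_wsqrtr.
  have n0 : (0 < n)%N by rewrite -(ltr0n R) (lt_le_trans ltr01).
  have uI := Iu n.
  have ule := hc n n0.
  have {}ule : (u n <= I + eps%:E)%E.
    apply: (le_trans ule); rewrite [eps]splitr EFinD addeA.
    by apply: leeD; [exact: ltW|rewrite lee_fin].
  have uf : u n \is a fin_num.
    apply/fin_real/andP; split; first by apply: lt_le_trans uI; rewrite IE ltNyr.
    by apply: (le_lt_trans ule); rewrite IE -EFinD ltry.
  split => //.
  move: uI ule; rewrite IE -(fineK uf) -EFinD !lee_fin => h1 h2.
  by rewrite distrC ger0_norm ?subr_ge0// lerBlDl.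
rewrite IE; apply/fine_cvgP; split.
  by apply: filterS (near_small 1 ltr01) => n [].
apply/cvgrPdist_le => eps eps0.
by apply: filterS (near_small _ eps0) => n [].
Unshelve. all: by end_near.
Qed.

End limit.

Section infimum.
Context {R : realType} {d m : nat} {H : completeNormedModType R}.
Variables (q rho C_V M0 : R) (f : 'rV[R]_d -> R) (B : 'rV[R]_d -> 'M[R]_(d, m))
  (mu0 : 'rV[R]_d -> R).
Hypotheses (q1 : 1 < q) (rho0 : 0 < rho) (f0 : forall x, 0 <= f x)
  (fC : forall x, f x <= C_V) (cf : continuous f) (lipB : lipschitz B)
  (perB : torus_periodic B)
  (mmu0 : measurable_fun setT mu0) (mu00 : forall x, 0 <= mu0 x)
  (mu0M : forall x, mu0 x <= M0).
Variables (ip : {dot H for idfun}) (ev : H -> 'rV[R]_d -> R)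
  (K : 'rV[R]_d -> 'rV[R]_d -> R).
Hypothesis rk : is_rkhs ip ev K.
Hypothesis KC2 : is_Ck 2 (fun z : 'rV[R]_(d + d) => K (lsubmx z) (rsubmx z)).
Local Notation V := (unif d : probability 'rV[R]_d R).
Local Notation G w := (Gfun q rho C_V f B mu0 cdiv (ev_Hm ev w)).
Local Notation G_H1 := (Gfun q rho C_V f B mu0 wdiv).
Local Notation infG := (ereal_inf [set G w | w in [set: 'I_m -> H]]).

Lemma infG_fin_num : infG \is a fin_num.
Proof.
have [A [D [A0 D0 hA]]] := Psi_bound q1 rho0 f0 fC lipB mu00 mu0M rk KC2.
rewrite ge0_fin_numE; last first.
  by apply: le_ereal_inf_tmp => _ [w _ <-]; exact: (G_ge0 rho B mu0 q1 f0 fC).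
have G0 : (G (0%R : 'I_m -> H) <= (A + D * norm_Hm (0%R : 'I_m -> H))%:E)%E.
  rewrite (G_Psi rho mu0 q1 f0 fC lipB rk KC2).
  set c := A + _; have c0 : 0 <= c by rewrite addr_ge0// mulr_ge0// norm_Hm_ge0.
  have <- : (\int[V]_x cst c%:E x = c%:E)%E.
    have E : (c%:E * V setT)%E = c%:E by rewrite probability_setT mule1.
    by apply: etrans E; exact: integral_cst.
  apply: ge0_ae_integral_mono.
  - by move=> x; exact: (Psi_ge0 rho B mu0 q1 f0 fC).
  - by move=> x; rewrite /= lee_fin.
  by apply: filterS (ae_good_point lipB) => x gx; exact: hA.
have le0 : (infG <= G (0%R : 'I_m -> H))%E by apply: ereal_inf_lbound; exists 0.
by apply: (le_lt_trans (le_trans le0 G0)); exact: ltry.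
Qed.

(** Density of [H^m] in [(H^1)^m] and continuity of [G] for the [H^1] norm.
    *)
Lemma infG_H1 : dense_L2 ev -> dense_H1 ev ->
  ereal_inf [set G_H1 w | w in [set w : 'rV[R]_d -> 'cV[R]_m |
                                forall i, H1 (fun x => w x i 0%R)]] = infG.
Proof.
move=> dL2 dH1; apply/eqP; rewrite eq_le; apply/andP; split.
  apply: le_ereal_inf_tmp => _ [h _ <-].
  rewrite -(G_H1_ev rho mu0 q1 f0 fC lipB perB rk KC2 dL2 dH1).
  by apply: ereal_inf_lbound; exists (ev_Hm ev h) => // i; exact: (H1_ev_Hm rk KC2).
apply: le_ereal_inf_tmp => _ [w Hw <-].
apply/lee_addgt0Pr => eps eps0.
have [h hP] := G_approx q1 rho0 f0 fC cf lipB perB mmu0 rk KC2 dL2 dH1 Hw eps0.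
by apply: le_trans hP; apply: ereal_inf_lbound; exists h.
Qed.

Lemma infG_le_expectation (dO : measure_display) (Omega : measurableType dO)
    (P : probability Omega R) (Y : Omega -> 'I_m -> H) :
  (infG <= \int[P]_om G (Y om))%E.
Proof.
have I0 : (0 <= infG)%E.
  by apply: le_ereal_inf_tmp => _ [w _ <-]; exact: (G_ge0 rho B mu0 q1 f0 fC).
have <- : (\int[P]_om cst infG om = infG)%E.
  have E : (infG * P setT)%E = infG by rewrite probability_setT mule1.
  by apply: etrans E; exact: integral_cst.
apply: ge0_ae_integral_mono.
- by move=> om.
- by move=> om; exact: (G_ge0 rho B mu0 q1 f0 fC).
by apply: aeW => om; apply: ereal_inf_lbound; exists (Y om).
Qed.

End infimum.

Theorem theorem3 (R : realType) (d m : nat) (rho q C_V : R)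
    (f : 'rV[R]_d -> R) (a : 'rV[R]_d -> 'cV[R]_d)
    (B : 'rV[R]_d -> 'M[R]_(d, m))
    (P0 : probability 'rV[R]_d R) (mu0 : 'rV[R]_d -> R)
    (H : completeNormedModType R) (ip : {dot H for idfun})
    (ev : H -> 'rV[R]_d -> R) (K : 'rV[R]_d -> 'rV[R]_d -> R)
    (dO : measure_display) (Omega : measurableType dO) (P : probability Omega R)
    (X : nat -> {RV P >-> 'rV[R]_d})
    (sg : ('I_m -> H) -> 'rV[R]_d -> ('I_m -> H)) :
  (0 < d)%N -> (0 < m)%N -> 0 < rho -> 1 < q <= 2 ->
  (* data *)
  torus_periodic f -> torus_periodic a -> torus_periodic B -> torus_periodic mu0 ->
  (forall x, 0 <= f x) -> (forall x, f x <= C_V) ->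
  (* mu_0: probability measure with full support and bounded density mu0 *)
  measurable_fun setT mu0 -> (forall x, 0 <= mu0 x) ->
  (exists M : R, forall x, mu0 x <= M) ->
  (forall A : set 'rV[R]_d, measurable A ->
     P0 A = \int[unif d]_(x in A) (mu0 x)%:E)%E ->
  (forall O : set 'rV[R]_d, open O -> (O `&` unit_cube d) !=set0 ->
     0 < P0 O)%E ->
  (* RKHS *)
  is_rkhs ip ev K ->
  is_Ck 2 (fun z : 'rV[R]_(d + d) => K (lsubmx z) (rsubmx z)) ->
  dense_L2 ev ->
  (* assumptions on a, f, B *)
  (forall x, a x = 0) -> lipschitz f -> lipschitz B ->
  (exists alpha : 'rV[R]_d -> 'cV[R]_m,
     (forall i, (fun x => alpha x i 0)
                  \in Lfun (unif d : probability 'rV[R]_d R) +oo%E) /\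
     (forall x, a x = B x *m alpha x)) ->
  (* sg is a measurable choice of subgradients of Gamma(., x) *)
  let Gam := Gamma q rho C_V f B mu0 cdiv in
  let G := Gfun q rho C_V f B mu0 cdiv in
  let G_H1 := Gfun q rho C_V f B mu0 wdiv in
  {ae unif d, forall x, forall w,
     is_subgradient ip (fun v => Gam (ev_Hm ev v) x) w (sg w x)} ->
  measurable_fun setT
    (fun p : g_sigma_algebraType (eval_sets (m := m) ev) * 'rV[R]_d =>
       sg p.1 p.2 : g_sigma_algebraType (eval_sets (m := m) ev)) ->
  let grad_bound D := {ae unif d, forall x,
    (ereal_sup [set (norm_Hm (sg w x))%:E | w in [set: 'I_m -> H]]
       <= D%:E)%E} in
  let EG gamma n :=
    (\int[P]_om G (ev_Hm ev (sgd_mean sg gamma (fun k => X k om) n)))%E in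
  iid_uniform X ->
  [/\ (exists2 D : R, 0 <= D & grad_bound D),
      (forall D : R, 0 <= D -> grad_bound D ->
       forall gamma : R, 0 < gamma -> forall n : nat, (0 < n)%N ->
         (EG gamma n <=
          ereal_inf [set G (ev_Hm ev w)
                         + (norm_Hm w ^+ 2 / (2 * gamma * n%:R))%:E
                    | w in [set: 'I_m -> H]]
          + (gamma * D ^+ 2 / 2)%:E)%E)
    & (dense_H1 ev -> forall gamma0 : R, 0 < gamma0 ->
         (fun n : nat => EG (gamma0 / Num.sqrt n%:R) n) @ \oo -->
         ereal_inf [set G_H1 w
                   | w in [set w : 'rV[R]_d -> 'cV[R]_m |
                           forall i, H1 (fun x => w x i 0)]])].
Proof.
move=> d0 m0 rho0 /andP[q1 q2] pf pa pB pmu0 f0 fC mmu0 mu00 [M0 mu0M] _ _.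
move=> rk KC2 dL2 a0 lipf lipB _ Gam G G_H1 sub msg grad_bound EG iid.
have cf := lipschitz_real lipf.
have bounded := subgradients_bounded q1 rho0 f0 fC lipB mu00 mu0M rk KC2 sub.
have regret := expected_regret q1 f0 fC cf lipB mmu0 rk KC2 iid sub msg.
split; first exact: bounded.
  move=> D D0 bnd gamma gamma0 n n0.
  rewrite -leeBlDr//; apply: le_ereal_inf_tmp => _ [w _ <-].
  rewrite leeBlDr// -addeA -EFinD.
  exact: (regret D gamma gamma0 bnd w n n0).
move=> dH1 gamma0 gamma00.
have [D D0 bnd] := bounded.
rewrite (infG_H1 q1 rho0 f0 fC cf lipB pB mmu0 rk KC2 dL2 dH1).
apply: cvg_ereal_inf.
- exact: (infG_fin_num q1 rho0 f0 fC lipB mu00 mu0M rk KC2).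
- by move=> n; exact: (infG_le_expectation rho B mu0 q1 f0 fC ev P _).
move=> w; exists (norm_Hm w ^+ 2 / (2 * gamma0) + gamma0 * D ^+ 2 / 2) => n n0.
have s0 : 0 < Num.sqrt (n%:R : R) by rewrite sqrtr_gt0 ltr0n.
have g0 : 0 < gamma0 / Num.sqrt (n%:R : R) by rewrite divr_gt0.
apply: (le_trans (regret D _ g0 bnd w n n0)).
rewrite leeD2l// lee_fin le_eqVlt; apply/orP; left; apply/eqP.
have -> : (n%:R : R) = Num.sqrt n%:R ^+ 2 by rewrite sqr_sqrtr.
rewrite sqrtr_sqr (ger0_norm (ltW s0)).
by field; rewrite !gt_eqF.
Qed.
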